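(* Let $X$ be a compact geodesic semi-locally simply-connected metric space with basepoint $\bullet$, let $c>0$ be the smallest critical value of the $\pi_1$-persistence of $X$ via open Rips complexes, and let $0<s<c/2$. Then the persistence $\{\pi_1(\mathrm{Rips}(X,r),\bullet)\}_{r>2s}$ is isomorphic to the minimal element of $FP(X,s)$ with respect to the order $\le$ (that is, to an element of $FP(X,s)$ which is $\le$ every element of $FP(X,s)$).
   Context: A metric space $(X,d)$ is geodesic if any $x,y\in X$ are joined by a path of length $d(x,y)$. A path-connected space $X$ is semi-locally simply-connected if every $x\in X$ has a neighborhood $U$ such that $\pi_1(U,x)\to\pi_1(X,x)$ is trivial. $A\subset X$ is $s$-dense if for every $x\in X$ there is $y\in A$ with $d(x,y)<s$. For a metric space $Y$ and $r>0$, the (open) Rips complex $\mathrm{Rips}(Y,r)$ is the simplicial complex with vertex set $Y$ in which a finite nonempty $\sigma\subset Y$ is a simplex iff $\mathrm{Diam}(\sigma)<r$. The $\pi_1$-persistence of $X$ is $\{\pi_1(\mathrm{Rips}(X,r),\bullet)\}_{r>0}$ with bonding maps $i_{p,q}$ induced by inclusions. A number $p>0$ is a critical value if either $i_{p-\varepsilon,p}$ is not an isomorphism for all small enough $\varepsilon>0$, or $i_{p,p+\varepsilon}$ is not an isomorphism for all $\varepsilon>0$. For a group $G$ and $r_0>0$, an initially constant surjective persistent group starting with $G$ at $r_0$ is a family of groups $\mathcal{H}=\{G_r\}_{r>r_0}$ with surjective commuting bonding homomorphisms $i_{p,q}\colon G_p\to G_q$ ($r_0<p<q$) such that there is $\varepsilon_{\mathcal{H}}>r_0$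 for which all $i_{p,q}$ with $r_0<p<q<\varepsilon_{\mathcal{H}}$ are identities on $G$. A homomorphism $\phi\colon\mathcal{H}\to\mathcal{H}'$ of two such persistences (with the same $G$ and $r_0$) is a family of homomorphisms $\phi_r\colon G_r\to G'_r$ commuting with the bonding maps and equal to the identity of $G$ for all $r$ close enough to $r_0$; it is an isomorphism if all $\phi_r$ are isomorphisms. Define $\mathcal{H}\le\mathcal{H}'$ iff there exists a homomorphism $\phi\colon\mathcal{H}'\to\mathcal{H}$. For $s<c/2$, define $$FP(X,s)=\big\{\{\pi_1(\mathrm{Rips}(A,r),\bullet)\}_{r>2s}\ \big|\ A \text{ an } s\text{-dense finite subset of } X \text{ containing } \bullet\big\},$$ with bonding maps induced by inclusions. These, and $\{\pi_1(\mathrm{Rips}(X,r),\bullet)\}_{r>2s}$, are initially constant surjective persistent groups starting with $\pi_1(X,\bullet)$ at $r_0=2s$, under the following natural identifications for $2s<r\le c$: $\pi_1(X,\bullet)\cong\pi_1(\mathrm{Rips}(X,r),\bullet)$ by sending the class of a based loop $\alpha\colon[0,a]\to X$ to the class of the simplicial loop $\alpha(t_0),\alpha(t_1),\dots,\alpha(t_m),\alpha(t_0)$ for any subdivision $0=t_0<\dots<t_m\le a$ fine enough that $\mathrm{Diam}\,\alpha([t_i,t_{i+1}])<r$ for $0\le i<m$ and $\mathrm{Diam}\,\alpha([t_m,a])<r$; and $\pi_1(\mathrm{Rips}(A,r),\bullet)\cong\pi_1(\mathrm{Rips}(X,r),\bullet)$ via the inclusion-induced map. *)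

(* Defs.v *)
From HB Require Import structures.
From Stdlib Require Import Relation_Operators Operators_Properties.
From mathcomp Require Import all_boot all_order all_algebra generic_quotient.
From mathcomp Require Import all_classical all_reals all_analysis.
From mathcomp Require Import ring lra.

Set Implicit Arguments.
Unset Strict Implicit.
Unset Printing Implicit Defensive.

Import Order.TTheory GRing.Theory Num.Theory.
Import numFieldNormedType.Exports.

Local Open Scope classical_set_scope.
Local Open Scope ring_scope.
Local Open Scope quotient_scope.

(* Paths are functions on R restricted to [0, 1]; the values outside [0, 1]
   are irrelevant, and homotopic loops need not agree there. *)
Definition unit_itv {R : realType} : set R := `[0, 1].

Definition unit_square {R : realType} : set (R * R) := unit_itv `*` unit_itv.

Section ContinuityWithin.

Lemma within_comp (S T U : topologicalType) (A : set S) (B : set T)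
    (f : T -> U) (g : S -> T) :
  {within A, continuous g} -> (forall x, A x -> B (g x)) ->
  {within B, continuous f} -> {within A, continuous (f \o g)}.
Proof.
move=> /subspace_continuousP cg gAB /subspace_continuousP cf.
apply/subspace_continuousP => x Ax; apply: cvg_trans (cf _ (gAB _ Ax)).
move=> V /= fV; have := cg x Ax _ fV; rewrite /= !nbhs_simpl /within /=.
by move=> h; near=> y => Ay; apply: (near h y) => //; exact: gAB.
Unshelve. all: by end_near. Qed.

Lemma within_eq (S T : topologicalType) (A : set S) (f g : S -> T) :
  (forall x, A x -> f x = g x) ->
  {within A, continuous f} -> {within A, continuous g}.
Proof.
by move=> fg; apply: subspace_eq_continuous => x /set_mem Ax; exact: fg.
Qed.

Lemma within_paste (S T : topologicalType) (A B C : set S) (f g h : S -> T) :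
  closed A -> closed B -> closed C -> (forall x, C x -> A x \/ B x) ->
  (forall x, C x -> A x -> f x = h x) -> (forall x, C x -> B x -> g x = h x) ->
  {within C `&` A, continuous f} -> {within C `&` B, continuous g} ->
  {within C, continuous h}.
Proof.
move=> cA cB cC CAB fh gh cf cg.
apply: (@continuous_subspaceW _ _ _ ((C `&` A) `|` (C `&` B))).
  by move=> x Cx; have [Ax|Bx] := CAB x Cx; [left|right].
apply: withinU_continuous; [exact: closedI|exact: closedI| |].
- by apply: within_eq cf => x [Cx Ax]; exact: fh.
- by apply: within_eq cg => x [Cx Bx]; exact: gh.
Qed.

Lemma continuous_pair (S T U : topologicalType) (f : S -> T) (g : S -> U) :
  continuous f -> continuous g -> continuous (fun z => (f z, g z)).
Proof. by move=> cf cg x; apply: cvg_pair; [exact: cf|exact: cg]. Qed.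

Context {R : realType}.

Lemma unit_itvP (t : R) : unit_itv t <-> 0 <= t <= 1.
Proof. by rewrite /unit_itv /= in_itv. Qed.

Lemma unit_squareP (s t : R) :
  unit_square (s, t) <-> 0 <= s <= 1 /\ 0 <= t <= 1.
Proof. by rewrite -!unit_itvP. Qed.

Lemma closed_unit_itv : closed (@unit_itv R).
Proof. exact: interval_closed. Qed.

Lemma closed_unit_square : closed (@unit_square R).
Proof.
rewrite (_ : unit_square = fst @^-1` unit_itv `&` snd @^-1` unit_itv)//.
apply: closedI; apply: preimage_closed; try exact: closed_unit_itv.
  by move=> x _; exact: cvg_fst.
by move=> x _; exact: cvg_snd.
Qed.

Lemma closed_le_comp (T : topologicalType) (h : T -> R) (c : R) :
  continuous h -> closed [set z | h z <= c].
Proof.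
move=> ch; rewrite (_ : [set z | h z <= c] = h @^-1` [set y | y <= c])//.
by apply: preimage_closed; [move=> z _; exact: ch|exact: closed_le].
Qed.

Lemma closed_ge_comp (T : topologicalType) (h : T -> R) (c : R) :
  continuous h -> closed [set z | c <= h z].
Proof.
move=> ch; rewrite (_ : [set z | c <= h z] = h @^-1` [set y | c <= y])//.
by apply: preimage_closed; [move=> z _; exact: ch|exact: closed_ge].
Qed.

Lemma unit_itv_conv (s a b : R) : unit_itv s -> unit_itv a -> unit_itv b ->
  unit_itv ((1 - s) * a + s * b).
Proof. by move=> /unit_itvP ? /unit_itvP ? /unit_itvP ?; apply/unit_itvP; nra. Qed.

End ContinuityWithin.

Section Loops.
Context {R : realType} {X : topologicalType}.

Record loop (x : X) := Loop {
  loop_fun :> R -> X;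
  loop_continuous : {within unit_itv, continuous loop_fun};
  loop0 : loop_fun 0 = x;
  loop1 : loop_fun 1 = x }.

HB.instance Definition _ (x : X) := gen_eqMixin (loop x).
HB.instance Definition _ (x : X) := gen_choiceMixin (loop x).

Implicit Type x : X.

Definition loop_homotopic x (f g : loop x) : Prop :=
  exists H : R * R -> X,
    [/\ {within unit_square, continuous H},
        forall t, unit_itv t -> H (0, t) = f t /\ H (1, t) = g t &
        forall s, unit_itv s -> H (s, 0) = x /\ H (s, 1) = x].

Lemma loop_homotopic_reparam x (f g h : loop x) (phi psi : R -> R) :
  continuous phi -> continuous psi ->
  (forall t, unit_itv t -> unit_itv (phi t)) ->
  (forall t, unit_itv t -> unit_itv (psi t)) ->
  phi 0 = psi 0 -> phi 1 = psi 1 ->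
  (forall t, unit_itv t -> g t = f (phi t)) ->
  (forall t, unit_itv t -> h t = f (psi t)) ->
  loop_homotopic g h.
Proof.
move=> cphi cpsi phi01 psi01 e0 e1 gE hE.
have U0 : unit_itv (0 : R) by apply/unit_itvP; lra.
have U1 : unit_itv (1 : R) by apply/unit_itvP; lra.
exists (fun z => f ((1 - z.1) * phi z.2 + z.1 * psi z.2)); split.
- apply: (@within_comp _ _ _ unit_square unit_itv f
    (fun z : R * R => (1 - z.1) * phi z.2 + z.1 * psi z.2)).
  + apply: continuous_subspaceT => z.
    have c1 : {for z, continuous (fst : R * R -> R)} by exact: cvg_fst.
    have c2 : {for z, continuous (snd : R * R -> R)} by exact: cvg_snd.
    apply: cvgD; apply: cvgM => //.
    * by apply: cvgB => //; exact: cst_continuous.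
    * by apply: continuous_comp => //; exact: cphi.
    * by apply: continuous_comp => //; exact: cpsi.
  + by move=> [s t] /= [Us Ut]; apply: unit_itv_conv => //; auto.
  + exact: loop_continuous.
- move=> t Ut /=; rewrite gE// hE// subr0 subrr !mul0r !mul1r addr0 add0r.
  by split.
- move=> s Us /=; rewrite -e0 -e1 -!mulrDl subrK !mul1r -!gE//.
  by rewrite loop0 loop1.
Qed.

Lemma loop_homotopic_refl x (f : loop x) : loop_homotopic f f.
Proof.
by apply: (@loop_homotopic_reparam x f f f id id) => //; move=> ?; exact: cvg_id.
Qed.

Lemma loop_homotopic_sym x (f g : loop x) :
  loop_homotopic f g -> loop_homotopic g f.
Proof.
move=> [H [cH H01 Hx]]; exists (fun z => H (1 - z.1, z.2)); split.
- apply: (@within_comp _ _ _ unit_square unit_square H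
    (fun z : R * R => (1 - z.1, z.2))) => //.
  + apply: continuous_subspaceT; apply: continuous_pair => z.
      apply: cvgB; first exact: cst_continuous.
      exact: cvg_fst.
    exact: cvg_snd.
  + move=> [s t] /unit_squareP[Us Ut]; apply/unit_squareP; split => /=; lra.
- by move=> t /H01 /=; rewrite subr0 subrr => -[-> ->].
- by move=> s /unit_itvP Us /=; apply: Hx; apply/unit_itvP; lra.
Qed.

Lemma loop_homotopic_trans x (f g h : loop x) :
  loop_homotopic f g -> loop_homotopic g h -> loop_homotopic f h.
Proof.
move=> [H [cH H01 Hx]] [K [cK K01 Kx]].
exists (fun z => if z.1 <= 2^-1 then H (2 * z.1, z.2)
                 else K (2 * z.1 - 1, z.2)); split.
- apply: (@within_paste _ _ [set z : R * R | z.1 <= 2^-1]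
    [set z : R * R | 2^-1 <= z.1] _
    (fun z => H (2 * z.1, z.2)) (fun z => K (2 * z.1 - 1, z.2))).
  + by apply: closed_le_comp => z; exact: cvg_fst.
  + by apply: closed_ge_comp => z; exact: cvg_fst.
  + exact: closed_unit_square.
  + by move=> z _ /=; apply/orP; exact: le_total.
  + by move=> z _ /= ->.
  + move=> [s t] [_ Ut] /= hs; case: ifPn => // hs'.
    have -> : s = 2^-1 by apply/eqP; rewrite eq_le hs hs'.
    rewrite mulfV// subrr.
    by rewrite (K01 t Ut).1 (H01 t Ut).2.
  + apply: (@within_comp _ _ _ _ unit_square H
      (fun z : R * R => (2 * z.1, z.2))) => //.
      apply: continuous_subspaceT; apply: continuous_pair => z.
        apply: cvgM; first exact: cst_continuous.
        exact: cvg_fst.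
      exact: cvg_snd.
    move=> [s t] [/unit_squareP[Us Ut] /= h2]; apply/unit_squareP; split => /=; lra.
  + apply: (@within_comp _ _ _ _ unit_square K
      (fun z : R * R => (2 * z.1 - 1, z.2))) => //.
      apply: continuous_subspaceT; apply: continuous_pair => z.
        apply: cvgB; last exact: cst_continuous.
        apply: cvgM; first exact: cst_continuous.
        exact: cvg_fst.
      exact: cvg_snd.
    move=> [s t] [/unit_squareP[Us Ut] /= h2]; apply/unit_squareP; split => /=; lra.
- move=> t Ut /=; rewrite !mulr0 invr_ge0 ler0n.
  rewrite ifN ?mulr1; last by rewrite -ltNge; lra.
  rewrite (_ : 2 - 1 = 1 :> R); last lra.
  by rewrite (H01 t Ut).1 (K01 t Ut).2.
- move=> s /unit_itvP Us /=; case: ifPn => hs.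
    by apply: Hx; apply/unit_itvP; lra.
  by rewrite -ltNge in hs; apply: Kx; apply/unit_itvP; lra.
Qed.

Lemma cst_loop_continuous x : {within unit_itv, continuous (cst x : R -> X)}.
Proof. by apply: continuous_subspaceT; exact: cst_continuous. Qed.

Definition cst_loop x : loop x :=
  @Loop x (cst x) (@cst_loop_continuous x) erefl erefl.

Section Inverse.
Variables (x : X) (f : loop x).

Lemma inv_loop_continuous : {within unit_itv, continuous (fun t => f (1 - t))}.
Proof.
apply: (@within_comp _ _ _ unit_itv unit_itv f (fun t : R => 1 - t)).
- apply: continuous_subspaceT => t; apply: cvgB.
    exact: cst_continuous.
  exact: cvg_id.
- by move=> t /unit_itvP Ut; apply/unit_itvP; lra.
- exact: loop_continuous.
Qed.

Lemma inv_loop0 : f (1 - 0) = x. Proof. by rewrite subr0 loop1. Qed.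
Lemma inv_loop1 : f (1 - 1) = x. Proof. by rewrite subrr loop0. Qed.

Definition inv_loop : loop x :=
  @Loop x (fun t => f (1 - t)) inv_loop_continuous inv_loop0 inv_loop1.

End Inverse.

Section Concatenation.
Variables (x : X) (f g : loop x).

Definition cat_loop_fun (t : R) : X :=
  if t <= 2^-1 then f (2 * t) else g (2 * t - 1).

Lemma cat_loop_continuous : {within unit_itv, continuous cat_loop_fun}.
Proof.
apply: (@within_paste _ _ [set t : R | t <= 2^-1] [set t : R | 2^-1 <= t] _
    (fun t => f (2 * t)) (fun t => g (2 * t - 1))).
- exact: closed_le.
- exact: closed_ge.
- exact: closed_unit_itv.
- by move=> t _ /=; apply/orP; exact: le_total.
- by move=> t _ /=; rewrite /cat_loop_fun => ->.
- move=> t _ /= ht; rewrite /cat_loop_fun; case: ifPn => // ht'.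
  have -> : t = 2^-1 by apply/eqP; rewrite eq_le ht ht'.
  by rewrite mulfV// subrr loop0 loop1.
- apply: (@within_comp _ _ _ _ unit_itv f (fun t : R => 2 * t)).
  + apply: continuous_subspaceT => t; apply: cvgM.
      exact: cst_continuous.
    exact: cvg_id.
  + by move=> t [/unit_itvP Ut /= ht]; apply/unit_itvP; lra.
  + exact: loop_continuous.
- apply: (@within_comp _ _ _ _ unit_itv g (fun t : R => 2 * t - 1)).
  + apply: continuous_subspaceT => t; apply: cvgB.
      apply: cvgM; [exact: cst_continuous|exact: cvg_id].
    exact: cst_continuous.
  + by move=> t [/unit_itvP Ut /= ht]; apply/unit_itvP; lra.
  + exact: loop_continuous.
Qed.

Lemma cat_loop0 : cat_loop_fun 0 = x.
Proof. by rewrite /cat_loop_fun invr_ge0 ler0n mulr0 loop0. Qed.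

Lemma cat_loop1 : cat_loop_fun 1 = x.
Proof.
rewrite /cat_loop_fun ifN; last by rewrite -ltNge; lra.
by rewrite mulr1 (_ : 2 - 1 = 1 :> R) ?loop1//; lra.
Qed.

Definition cat_loop : loop x :=
  @Loop x cat_loop_fun cat_loop_continuous cat_loop0 cat_loop1.

End Concatenation.

Lemma cat_loop_homotopic x (f f' g g' : loop x) :
  loop_homotopic f f' -> loop_homotopic g g' ->
  loop_homotopic (cat_loop f g) (cat_loop f' g').
Proof.
move=> [H [cH H01 Hx]] [K [cK K01 Kx]].
exists (fun z => if z.2 <= 2^-1 then H (z.1, 2 * z.2)
                 else K (z.1, 2 * z.2 - 1)); split.
- apply: (@within_paste _ _ [set z : R * R | z.2 <= 2^-1]
    [set z : R * R | 2^-1 <= z.2] _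
    (fun z => H (z.1, 2 * z.2)) (fun z => K (z.1, 2 * z.2 - 1))).
  + by apply: closed_le_comp => z; exact: cvg_snd.
  + by apply: closed_ge_comp => z; exact: cvg_snd.
  + exact: closed_unit_square.
  + by move=> z _ /=; apply/orP; exact: le_total.
  + by move=> z _ /= ->.
  + move=> [s t] [/= Us _] /= ht; case: ifPn => // ht'.
    have -> : t = 2^-1 by apply/eqP; rewrite eq_le ht ht'.
    by rewrite mulfV// subrr (Kx s Us).1 (Hx s Us).2.
  + apply: (@within_comp _ _ _ _ unit_square H
      (fun z : R * R => (z.1, 2 * z.2))) => //.
      apply: continuous_subspaceT; apply: continuous_pair => z.
        exact: cvg_fst.
      apply: cvgM; first exact: cst_continuous.
      exact: cvg_snd.
    move=> [s t] [/unit_squareP[Us Ut] /= h2]; apply/unit_squareP; split => /=; lra.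
  + apply: (@within_comp _ _ _ _ unit_square K
      (fun z : R * R => (z.1, 2 * z.2 - 1))) => //.
      apply: continuous_subspaceT; apply: continuous_pair => z.
        exact: cvg_fst.
      apply: cvgB; last exact: cst_continuous.
      apply: cvgM; first exact: cst_continuous.
      exact: cvg_snd.
    move=> [s t] [/unit_squareP[Us Ut] /= h2]; apply/unit_squareP; split => /=; lra.
- move=> t /unit_itvP Ut; rewrite /= /cat_loop_fun; case: ifPn => ht.
    by apply: H01; apply/unit_itvP; lra.
  by rewrite -ltNge in ht; apply: K01; apply/unit_itvP; lra.
- move=> s Us /=; rewrite invr_ge0 ler0n ifN; last by rewrite -ltNge; lra.
  rewrite mulr0 mulr1 (_ : 2 - 1 = 1 :> R); last lra.
  by rewrite (Hx s Us).1 (Kx s Us).2.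
Qed.

Lemma inv_loop_homotopic x (f g : loop x) :
  loop_homotopic f g -> loop_homotopic (inv_loop f) (inv_loop g).
Proof.
move=> [H [cH H01 Hx]]; exists (fun z => H (z.1, 1 - z.2)); split.
- apply: (@within_comp _ _ _ unit_square unit_square H
    (fun z : R * R => (z.1, 1 - z.2))) => //.
  + apply: continuous_subspaceT; apply: continuous_pair => z.
      exact: cvg_fst.
    apply: cvgB; first exact: cst_continuous.
    exact: cvg_snd.
  + move=> [s t] /unit_squareP[Us Ut]; apply/unit_squareP; split => /=; lra.
- by move=> t /unit_itvP Ut /=; apply: H01; apply/unit_itvP; lra.
- by move=> s /Hx /=; rewrite subr0 subrr => -[-> ->].
Qed.

Let cst_ (c : R) : continuous (fun _ : R => c).
Proof. by move=> t; exact: cst_continuous. Qed.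

Let id_ : continuous (fun t : R => t).
Proof. by move=> t; exact: cvg_id. Qed.

Let affine_continuous (a b : R) : continuous (fun t : R => a * t + b).
Proof.
by move=> t; apply: cvgD;
  [apply: cvgM; [exact: cst_|exact: id_]|exact: cst_].
Qed.

Let min_continuous_ (f g : R -> R) : continuous f -> continuous g ->
  continuous (fun t => Num.min (f t) (g t)).
Proof. by move=> cf cg t; apply: continuous_min; [exact: cf|exact: cg]. Qed.

Let max_continuous_ (f g : R -> R) : continuous f -> continuous g ->
  continuous (fun t => Num.max (f t) (g t)).
Proof. by move=> cf cg t; apply: continuous_max; [exact: cf|exact: cg]. Qed.

Lemma cat_cst_loop x (f : loop x) : loop_homotopic (cat_loop (cst_loop x) f) f.
Proof.
apply: (@loop_homotopic_reparam x f _ _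
  (fun t => Num.max (0 * t + 0) (2 * t + (-1))) (fun t => 1 * t + 0)) => //.
- by apply: max_continuous_.
- move=> t /unit_itvP Ut; apply/unit_itvP.
  by case: (leP (0 * t + 0) (2 * t + -1)); lra.
- by move=> t /unit_itvP Ut; apply/unit_itvP; lra.
- by case: (leP (0 * 0 + 0 : R) (2 * 0 + -1)); lra.
- by case: (leP (0 * 1 + 0 : R) (2 * 1 + -1)); lra.
- move=> t _; rewrite /= /cat_loop_fun mul0r addr0.
  case: (leP 0 (2 * t + -1)) => h; case: ifPn => // h'.
  + rewrite /= (_ : 2 * t + -1 = 0) ?loop0//; lra.
  + by rewrite loop0.
  + by exfalso; rewrite -?ltNge in h'; lra.
- by move=> t _; rewrite mul1r addr0.
Qed.

Lemma cat_loop_cst x (f : loop x) : loop_homotopic (cat_loop f (cst_loop x)) f.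
Proof.
apply: (@loop_homotopic_reparam x f _ _
  (fun t => Num.min (0 * t + 1) (2 * t + 0)) (fun t => 1 * t + 0)) => //.
- by apply: min_continuous_.
- move=> t /unit_itvP Ut; apply/unit_itvP.
  by case: (leP (0 * t + 1) (2 * t + 0)); lra.
- by move=> t /unit_itvP Ut; apply/unit_itvP; lra.
- by case: (leP (0 * 0 + 1 : R) (2 * 0 + 0)); lra.
- by case: (leP (0 * 1 + 1 : R) (2 * 1 + 0)); lra.
- move=> t _; rewrite /= /cat_loop_fun mul0r add0r addr0.
  case: (leP 1 (2 * t)) => h; case: ifPn => // h'.
  + by rewrite (_ : 2 * t = 1)//; lra.
  + by rewrite /= loop1.
  + by exfalso; rewrite -?ltNge in h'; lra.
- by move=> t _; rewrite mul1r addr0.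
Qed.

Lemma cat_inv_loop x (f : loop x) :
  loop_homotopic (cat_loop (inv_loop f) f) (cst_loop x).
Proof.
apply: (@loop_homotopic_reparam x f _ _
  (fun t => Num.max ((-2) * t + 1) (2 * t + (-1))) (fun t => 0 * t + 1)) => //.
- by apply: max_continuous_.
- move=> t /unit_itvP Ut; apply/unit_itvP.
  by case: (leP (-2 * t + 1) (2 * t + -1)); lra.
- by move=> t /unit_itvP Ut; apply/unit_itvP; lra.
- by case: (leP (-2 * 0 + 1 : R) (2 * 0 + -1)); lra.
- by case: (leP (-2 * 1 + 1 : R) (2 * 1 + -1)); lra.
- move=> t _; rewrite /= /cat_loop_fun /=.
  case: (leP (-2 * t + 1) (2 * t + -1)) => h; case: ifPn => // h'.
  + by congr (f _); lra.
  + by congr (f _); lra.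
  + by exfalso; rewrite -?ltNge in h'; lra.
- by move=> t _; rewrite mul0r add0r loop1.
Qed.

Lemma cat_loop_inv x (f : loop x) :
  loop_homotopic (cat_loop f (inv_loop f)) (cst_loop x).
Proof.
apply: (@loop_homotopic_reparam x f _ _
  (fun t => Num.min (2 * t + 0) ((-2) * t + 2)) (fun t => 0 * t + 0)) => //.
- by apply: min_continuous_.
- move=> t /unit_itvP Ut; apply/unit_itvP.
  by case: (leP (2 * t + 0) (-2 * t + 2)); lra.
- by move=> t /unit_itvP Ut; apply/unit_itvP; lra.
- by case: (leP (2 * 0 + 0 : R) (-2 * 0 + 2)); lra.
- by case: (leP (2 * 1 + 0 : R) (-2 * 1 + 2)); lra.
- move=> t _; rewrite /= /cat_loop_fun /=.
  case: (leP (2 * t + 0) (-2 * t + 2)) => h; case: ifPn => // h'.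
  + by congr (f _); lra.
  + by exfalso; rewrite -?ltNge in h'; lra.
  + by congr (f _); lra.
  + by congr (f _); lra.
- by move=> t _; rewrite mul0r add0r loop0.
Qed.

Lemma cat_loopA x (f g h : loop x) :
  loop_homotopic (cat_loop f (cat_loop g h)) (cat_loop (cat_loop f g) h).
Proof.
apply: (@loop_homotopic_reparam x (cat_loop f (cat_loop g h)) _ _
  (fun t => 1 * t + 0)
  (fun t => Num.min (Num.min (2 * t + 0) (1 * t + 4^-1)) (2^-1 * t + 2^-1)))
  => //.
- by apply: min_continuous_ => //; apply: min_continuous_.
- by move=> t /unit_itvP Ut; apply/unit_itvP; lra.
- move=> t /unit_itvP Ut; apply/unit_itvP.
  by rewrite /Num.min; do ?case: ifPn; rewrite -?leNgt; lra.
- by rewrite /Num.min; do ?case: ifPn; rewrite -?leNgt; lra.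
- by rewrite /Num.min; do ?case: ifPn; rewrite -?leNgt; lra.
- by move=> t _; rewrite mul1r addr0.
- move=> t /unit_itvP Ut.
  set m := Num.min _ _.
  have mE : m = if t <= 2^-1 then if 2 * t <= 2^-1 then 2 * t else t + 4^-1
                else 2^-1 * t + 2^-1.
    by rewrite /m /Num.min; do !case: ifPn; rewrite -?leNgt -?ltNge; lra.
  rewrite mE /= /cat_loop_fun /= /cat_loop_fun.
  case: (leP t 2^-1) => ht; last first.
    rewrite ifN; last by rewrite -ltNge; lra.
    rewrite ifN; last by rewrite -ltNge; lra.
    by congr (h _); lra.
  case: (leP (2 * t) 2^-1) => ht'; first by rewrite ht'.
  rewrite ifN; last by rewrite -ltNge; lra.
  rewrite ifT; last lra.
  by congr (g _); lra.
Qed.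

End Loops.
Arguments loop R {X} x.

(* A group given by operations on T satisfying the group laws up to an
   equivalence relation compatible with them. *)
Record group_upto (T : choiceType) := GroupUpto {
  upto_rel : T -> T -> Prop;
  upto_mul : T -> T -> T;
  upto_one : T;
  upto_inv : T -> T;
  upto_refl : forall a, upto_rel a a;
  upto_sym : forall a b, upto_rel a b -> upto_rel b a;
  upto_trans : forall a b c, upto_rel a b -> upto_rel b c -> upto_rel a c;
  upto_mul_congr : forall a a' b b', upto_rel a a' -> upto_rel b b' ->
    upto_rel (upto_mul a b) (upto_mul a' b');
  upto_inv_congr : forall a b, upto_rel a b ->
    upto_rel (upto_inv a) (upto_inv b);
  upto_mulA : forall a b c,
    upto_rel (upto_mul a (upto_mul b c)) (upto_mul (upto_mul a b) c);
  upto_1mul : forall a, upto_rel (upto_mul upto_one a) a;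
  upto_mul1 : forall a, upto_rel (upto_mul a upto_one) a;
  upto_Vmul : forall a, upto_rel (upto_mul (upto_inv a) a) upto_one;
  upto_mulV : forall a, upto_rel (upto_mul a (upto_inv a)) upto_one }.

Section GroupQuotient.
Context {T : choiceType} (C : group_upto T).

Definition upto_relb : rel T := fun a b => `[< upto_rel C a b >].

Lemma upto_relb_refl : reflexive upto_relb.
Proof. by move=> a; apply/asboolP; exact: upto_refl. Qed.

Lemma upto_relb_sym : symmetric upto_relb.
Proof. by move=> a b; apply/asboolP/asboolP; exact: upto_sym. Qed.

Lemma upto_relb_trans : transitive upto_relb.
Proof.
by move=> b a c /asboolP ab /asboolP bc; apply/asboolP; exact: upto_trans ab bc.
Qed.

Canonical upto_equiv := EquivRel upto_relb
  upto_relb_refl upto_relb_sym upto_relb_trans.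

Definition group_quotient := {eq_quot upto_equiv}.

HB.instance Definition _ := Choice.on group_quotient.

Definition gclass (a : T) : group_quotient := \pi_{eq_quot upto_equiv} a.

Lemma gclass_eq a b : gclass a = gclass b <-> upto_rel C a b.
Proof.
split=> [ab|ab]; first by apply/asboolP; exact/(@eqmodP _ upto_equiv).
by apply/(@eqmodP _ upto_equiv); exact/asboolP.
Qed.

Definition grepr (g : group_quotient) : T :=
  @repr _ {eq_quot upto_equiv} g.

Lemma greprK g : gclass (grepr g) = g.
Proof. exact: reprK. Qed.

Lemma gclass_surj g : exists a, g = gclass a.
Proof. by exists (grepr g); rewrite greprK. Qed.

Definition gq_mul (g h : group_quotient) : group_quotient :=
  gclass (upto_mul C (grepr g) (grepr h)).
Definition gq_one : group_quotient := gclass (upto_one C).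
Definition gq_inv (g : group_quotient) : group_quotient :=
  gclass (upto_inv C (grepr g)).

Lemma gq_mulE a b : gq_mul (gclass a) (gclass b) = gclass (upto_mul C a b).
Proof.
by apply/gclass_eq; apply: upto_mul_congr; apply/gclass_eq; exact: greprK.
Qed.

Lemma gq_invE a : gq_inv (gclass a) = gclass (upto_inv C a).
Proof.
by apply/gclass_eq; apply: upto_inv_congr; apply/gclass_eq; exact: greprK.
Qed.

Lemma gq_mulA : associative gq_mul.
Proof.
move=> g h k; have [a ->] := gclass_surj g; have [b ->] := gclass_surj h.
have [c ->] := gclass_surj k; rewrite !gq_mulE; apply/gclass_eq.
exact: upto_mulA.
Qed.

Lemma gq_1mul : left_id gq_one gq_mul.
Proof.
move=> g; have [a ->] := gclass_surj g.
by rewrite gq_mulE; apply/gclass_eq; exact: upto_1mul.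
Qed.

Lemma gq_mul1 : right_id gq_one gq_mul.
Proof.
move=> g; have [a ->] := gclass_surj g.
by rewrite gq_mulE; apply/gclass_eq; exact: upto_mul1.
Qed.

Lemma gq_Vmul : left_inverse gq_one gq_inv gq_mul.
Proof.
move=> g; have [a ->] := gclass_surj g.
by rewrite gq_invE gq_mulE; apply/gclass_eq; exact: upto_Vmul.
Qed.

Lemma gq_mulV : right_inverse gq_one gq_inv gq_mul.
Proof.
move=> g; have [a ->] := gclass_surj g.
by rewrite gq_invE gq_mulE; apply/gclass_eq; exact: upto_mulV.
Qed.

HB.instance Definition _ := isGroup.Build group_quotient
  gq_mulA gq_1mul gq_mul1 gq_Vmul gq_mulV.

Lemma gclassM a b : (gclass a * gclass b)%g = gclass (upto_mul C a b).
Proof. exact: gq_mulE. Qed.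

Lemma gclassV a : (gclass a)^-1%g = gclass (upto_inv C a).
Proof. exact: gq_invE. Qed.

Lemma gclass1 : gclass (upto_one C) = 1%g.
Proof. by []. Qed.

End GroupQuotient.

Definition loop_upto (R : realType) (X : topologicalType) (x : X) :
    group_upto (loop R x) :=
  GroupUpto (@loop_homotopic_refl R X x) (@loop_homotopic_sym R X x)
    (@loop_homotopic_trans R X x) (@cat_loop_homotopic R X x)
    (@inv_loop_homotopic R X x) (@cat_loopA R X x) (@cat_cst_loop R X x)
    (@cat_loop_cst R X x) (@cat_inv_loop R X x) (@cat_loop_inv R X x).

Definition pi1 (R : realType) (X : topologicalType) (x : X) : groupType :=
  group_quotient (loop_upto R x).
Arguments pi1 R {X} x.

Definition pi1_class (R : realType) (X : topologicalType) (x : X)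
    (f : loop R x) : pi1 R x := gclass (loop_upto R x) f.

(* [pi_1(U, y) -> pi_1(X, y)] is trivial: every loop of U based at y is trivial
   in X.  Path-connectedness, part of the usual notion, is automatic for the
   geodesic spaces considered here. *)
Definition semilocally_simply_connected (R : realType) (X : topologicalType) :=
  forall y : X, exists2 U : set X, nbhs y U &
    forall f : loop R y, (forall t, unit_itv t -> U (f t)) ->
      pi1_class f = 1%g.
Arguments semilocally_simply_connected R X : clear implicits.

Section Geodesic.
Context {R : realType} {X : metricType R}.

Definition path_variation (a b : R) (f : R -> X) (s : seq R) : R :=
  let F := f \o nth b (a :: s) in
  \sum_(0 <= n < size s) mdist (F n) (F n.+1).

Definition path_length (a b : R) (f : R -> X) : \bar R :=
  ereal_sup [set (path_variation a b f s)%:E | s in itv_partition a b].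

End Geodesic.

Definition geodesic (R : realType) (X : metricType R) :=
  forall x y : X, exists f : R -> X,
    [/\ {within unit_itv, continuous f}, f 0 = x, f 1 = y &
        path_length 0 1 f = (mdist x y)%:E].
Arguments geodesic {R} X.

(* The vertex set is [set v | simplex K [set v]]. *)
Record simplicial_complex (V : Type) := SimplicialComplex {
  simplex : set (set V);
  simplex_finite : forall sigma, simplex sigma -> finite_set sigma;
  simplex_neq0 : forall sigma, simplex sigma -> sigma !=set0;
  simplex_face : forall sigma tau,
    simplex sigma -> tau !=set0 -> tau `<=` sigma -> simplex tau }.

Section EdgePathGroup.
Context {V : choiceType} (K : simplicial_complex V).

Definition adjacent : rel V := fun u w => `[< simplex K [set u; w] >].

(* The closed edge path v, e_1, ..., e_n = v is represented by e_1, ..., e_n. *)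
Record edge_loop (v : V) := EdgeLoop {
  edges :> seq V;
  edges_path : path adjacent v edges;
  edges_last : last v edges = v }.

HB.instance Definition _ v := gen_eqMixin (edge_loop v).
HB.instance Definition _ v := gen_choiceMixin (edge_loop v).

Inductive edge_move : seq V -> seq V -> Prop :=
| edge_move_repeat p u q : edge_move (p ++ [:: u, u & q]) (p ++ u :: q)
| edge_move_triangle p u v w q : simplex K [set u; v; w] ->
    edge_move (p ++ [:: u, v, w & q]) (p ++ [:: u, w & q]).

Definition edge_homotopic : seq V -> seq V -> Prop :=
  clos_refl_sym_trans (seq V) edge_move.

Lemma edge_homotopic_cat p q a b : edge_homotopic a b ->
  edge_homotopic (p ++ a ++ q) (p ++ b ++ q).
Proof.
elim=> [{}a {}b|{}a|{}a {}b _|{}a {}b c _ IH1 _ IH2].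
- case=> [r u s|r u v w s Kuvw]; apply: rst_step; rewrite -!catA !(catA p) /=.
    exact: edge_move_repeat.
  exact: edge_move_triangle.
- exact: rst_refl.
- exact: rst_sym.
- exact: rst_trans IH1 IH2.
Qed.

Lemma edge_homotopic_rev a b : edge_homotopic a b ->
  edge_homotopic (rev a) (rev b).
Proof.
elim=> [{}a {}b|{}a|{}a {}b _|{}a {}b c _ IH1 _ IH2].
- case=> [r u s|r u v w s Kuvw]; apply: rst_step;
    rewrite !rev_cat !rev_cons -!cats1 -!catA /=.
    exact: edge_move_repeat.
  apply: edge_move_triangle.
  suff -> : [set w; v; u] = [set u; v; w] by [].
  by rewrite setUC setUA [in LHS]setUAC setUC setUA.
- exact: rst_refl.
- exact: rst_sym.
- exact: rst_trans IH1 IH2.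
Qed.

Lemma adjacent_sym u w : adjacent u w = adjacent w u.
Proof. by rewrite /adjacent setUC. Qed.

Lemma edge_homotopic_backtrack v s : path adjacent v s ->
  edge_homotopic (v :: s ++ rev (belast v s)) [:: v].
Proof.
elim: s v => [|w s IH] v /=; first by move=> _; exact: rst_refl.
case/andP => /asboolP vw ws.
rewrite rev_cons -cats1.
have h := edge_homotopic_cat [:: v] [:: v] (IH _ ws).
rewrite /= -catA in h; apply: rst_trans h _.
apply: (@rst_trans _ _ _ [:: v; v]); apply: rst_step.
  apply: (@edge_move_triangle [::] v w v [::]).
  by rewrite setUAC setUid.
exact: (@edge_move_repeat [::] v [::]).
Qed.

Section BasePoint.
Variable v : V.

Definition edge_loop_homotopic (a b : edge_loop v) : Prop :=
  edge_homotopic (v :: a) (v :: b).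

Definition cst_edge_loop : edge_loop v :=
  @EdgeLoop v [::] erefl erefl.

Lemma cat_edge_path (a b : edge_loop v) : path adjacent v (a ++ b).
Proof. by rewrite cat_path edges_path edges_last edges_path. Qed.

Lemma cat_edge_last (a b : edge_loop v) : last v (a ++ b) = v.
Proof. by rewrite last_cat !edges_last. Qed.

Definition cat_edge_loop (a b : edge_loop v) : edge_loop v :=
  EdgeLoop (cat_edge_path a b) (cat_edge_last a b).

Lemma inv_edge_path (a : edge_loop v) : path adjacent v (rev (belast v a)).
Proof.
rewrite -[X in path _ X _](edges_last a) rev_path.
rewrite (eq_path (e' := adjacent)); first exact: edges_path.
by move=> u w; rewrite /= adjacent_sym.
Qed.

Lemma inv_edge_last (a : edge_loop v) : last v (rev (belast v a)) = v.
Proof.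
by case: a => -[|u a] //= _ _; rewrite rev_cons last_rcons.
Qed.

Definition inv_edge_loop (a : edge_loop v) : edge_loop v :=
  EdgeLoop (inv_edge_path a) (inv_edge_last a).

Lemma cons_inv_edge (a : edge_loop v) : v :: inv_edge_loop a = rev (v :: a).
Proof.
by rewrite [v :: a]lastI edges_last rev_rcons.
Qed.

Lemma edge_loop_congr (a a' b b' : edge_loop v) :
  edge_loop_homotopic a a' -> edge_loop_homotopic b b' ->
  edge_loop_homotopic (cat_edge_loop a b) (cat_edge_loop a' b').
Proof.
rewrite /edge_loop_homotopic /= => aa' bb'.
apply: (@rst_trans _ _ _ (v :: a' ++ b)).
  by have := edge_homotopic_cat [::] b aa'.
have e (c : edge_loop v) d : v :: c ++ d = belast v c ++ (v :: d).
  by rewrite -cat_cons [v :: c]lastI edges_last cat_rcons.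
rewrite !e; have := edge_homotopic_cat (belast v a') [::] bb'.
by rewrite !cats0.
Qed.

Lemma inv_edge_loop_congr (a b : edge_loop v) : edge_loop_homotopic a b ->
  edge_loop_homotopic (inv_edge_loop a) (inv_edge_loop b).
Proof.
by rewrite /edge_loop_homotopic !cons_inv_edge; exact: edge_homotopic_rev.
Qed.

Lemma cat_edge_loop_inv (a : edge_loop v) :
  edge_loop_homotopic (cat_edge_loop a (inv_edge_loop a)) cst_edge_loop.
Proof. by apply: edge_homotopic_backtrack; exact: edges_path. Qed.

Lemma inv_inv_edge (a : edge_loop v) : inv_edge_loop (inv_edge_loop a) = a :> seq V.
Proof.
suff [] : v :: inv_edge_loop (inv_edge_loop a) = v :: a by [].
by rewrite 2!cons_inv_edge revK.
Qed.

Lemma cat_inv_edge_loop (a : edge_loop v) :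
  edge_loop_homotopic (cat_edge_loop (inv_edge_loop a) a) cst_edge_loop.
Proof.
have := cat_edge_loop_inv (inv_edge_loop a).
rewrite /edge_loop_homotopic.
have -> // : cat_edge_loop (inv_edge_loop a) (inv_edge_loop (inv_edge_loop a))
  = cat_edge_loop (inv_edge_loop a) a :> seq V.
by rewrite [LHS]/(_ ++ inv_edge_loop (inv_edge_loop a)) inv_inv_edge.
Qed.

Lemma edge_loop_refl (a : edge_loop v) : edge_loop_homotopic a a.
Proof. exact: rst_refl. Qed.

Lemma edge_loop_sym (a b : edge_loop v) :
  edge_loop_homotopic a b -> edge_loop_homotopic b a.
Proof. exact: rst_sym. Qed.

Lemma edge_loop_trans (a b c : edge_loop v) :
  edge_loop_homotopic a b -> edge_loop_homotopic b c ->
  edge_loop_homotopic a c.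
Proof. exact: rst_trans. Qed.

Lemma cat_edge_loopA (a b c : edge_loop v) :
  edge_loop_homotopic (cat_edge_loop a (cat_edge_loop b c))
    (cat_edge_loop (cat_edge_loop a b) c).
Proof. by rewrite /edge_loop_homotopic /= catA; exact: rst_refl. Qed.

Lemma cat_cst_edge_loop (a : edge_loop v) :
  edge_loop_homotopic (cat_edge_loop cst_edge_loop a) a.
Proof. exact: rst_refl. Qed.

Lemma cat_edge_loop_cst (a : edge_loop v) :
  edge_loop_homotopic (cat_edge_loop a cst_edge_loop) a.
Proof. by rewrite /edge_loop_homotopic /= cats0; exact: rst_refl. Qed.

Definition edge_upto : group_upto (edge_loop v) :=
  GroupUpto edge_loop_refl edge_loop_sym edge_loop_trans edge_loop_congr
    inv_edge_loop_congr cat_edge_loopA cat_cst_edge_loop cat_edge_loop_cst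
    cat_inv_edge_loop cat_edge_loop_inv.

(* The edge-path group, i.e., pi_1 of the complex based at v. *)
Definition edge_pi1 : groupType := group_quotient edge_upto.

Definition edge_class (a : edge_loop v) : edge_pi1 := gclass edge_upto a.

End BasePoint.
End EdgePathGroup.

Section InclusionInduced.
Context {V : choiceType} (K L : simplicial_complex V) (KL : simplex K `<=` simplex L).
Variable v : V.

Lemma incl_edge_path (a : edge_loop K v) : path (adjacent L) v a.
Proof.
apply: sub_path (edges_path a) => u w /asboolP Kuw.
by apply/asboolP; exact: KL.
Qed.

Definition incl_edge_loop (a : edge_loop K v) : edge_loop L v :=
  EdgeLoop (incl_edge_path a) (edges_last a).

Lemma incl_edge_homotopic (a b : seq V) :
  edge_homotopic K a b -> edge_homotopic L a b.
Proof.
elim=> [{}a {}b|{}a|{}a {}b _|{}a {}b c _ IH1 _ IH2].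
- case=> [p u q|p u w z q Kuwz]; apply: rst_step.
    exact: edge_move_repeat.
  by apply: edge_move_triangle; exact: KL.
- exact: rst_refl.
- exact: rst_sym.
- exact: rst_trans IH1 IH2.
Qed.

Definition edge_pi1_incl (g : edge_pi1 K v) : edge_pi1 L v :=
  edge_class (incl_edge_loop (grepr g)).

Lemma edge_pi1_inclE (a : edge_loop K v) :
  edge_pi1_incl (edge_class a) = edge_class (incl_edge_loop a).
Proof.
apply/gclass_eq; apply: incl_edge_homotopic.
exact/(gclass_eq (edge_upto K v))/greprK.
Qed.

Lemma edge_pi1_inclM : {morph edge_pi1_incl : g h / (g * h)%g}.
Proof.
move=> g h; have [a ->] := gclass_surj g; have [b ->] := gclass_surj h.
rewrite gclassM (edge_pi1_inclE (cat_edge_loop a b)) !edge_pi1_inclE.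
rewrite gclassM; apply/gclass_eq; exact: rst_refl.
Qed.

HB.instance Definition _ :=
  isMultiplicative.Build (edge_pi1 K v) (edge_pi1 L v) edge_pi1_incl
    edge_pi1_inclM.

End InclusionInduced.

Section Rips.
Context {R : realType} {X : metricType R}.
Implicit Types (A B : set X) (p q r : R).

Definition diam A : \bar R := ereal_sup [set (mdist x y)%:E | x in A & y in A].

Lemma diam_subset A B : A `<=` B -> (diam A <= diam B)%E.
Proof.
move=> AB; apply: le_ereal_sup => _ [x Ax [y Ay <-]].
by exists x; [exact: AB|exists y => //; exact: AB].
Qed.

Definition rips_simplex A r : set (set X) :=
  [set sigma | [/\ finite_set sigma, sigma !=set0, sigma `<=` A &
                   (diam sigma < r%:E)%E]].

Lemma rips_finite A r sigma : rips_simplex A r sigma -> finite_set sigma.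
Proof. by case. Qed.

Lemma rips_neq0 A r sigma : rips_simplex A r sigma -> sigma !=set0.
Proof. by case. Qed.

Lemma rips_face A r sigma tau : rips_simplex A r sigma -> tau !=set0 ->
  tau `<=` sigma -> rips_simplex A r tau.
Proof.
move=> [fs _ sA ds] t0 ts; split => //.
- exact: sub_finite_set ts fs.
- exact: subset_trans ts sA.
- exact: le_lt_trans (diam_subset ts) ds.
Qed.

(* The open Rips complex of the subspace A of X. *)
Definition Rips A r : simplicial_complex X :=
  SimplicialComplex (@rips_finite A r) (@rips_neq0 A r) (@rips_face A r).

Lemma Rips_subset A B p q : A `<=` B -> p <= q ->
  simplex (Rips A p) `<=` simplex (Rips B q).
Proof.
move=> AB pq sigma [fs s0 sA ds]; split => //; first exact: subset_trans AB.
by apply: lt_le_trans ds _; rewrite lee_fin.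
Qed.

Variable x0 : X.

Definition rips_pi1 A r : groupType := edge_pi1 (Rips A r) x0.

Definition rips_bond A p q (pq : p < q) :
    {multiplicative rips_pi1 A p -> rips_pi1 A q} :=
  edge_pi1_incl (Rips_subset (@subset_refl _ A) (ltW pq)) (v := x0).

Definition rips_incl A r : {multiplicative rips_pi1 A r -> rips_pi1 setT r} :=
  edge_pi1_incl (Rips_subset (@subsetT _ A) (lexx r)) (v := x0).

(* Only 0 < q < p matter in the first alternative, as the persistence is
   indexed by the positive reals. *)
Definition critical_value p : Prop :=
  0 < p /\
  ((exists2 d, 0 < d & forall q (qp : q < p), 0 < q -> p - d < q ->
      ~ bijective (rips_bond setT qp)) \/
   (forall q (pq : p < q), ~ bijective (rips_bond setT pq))).

Definition smallest_critical_value (c : R) : Prop :=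
  critical_value c /\ forall p, critical_value p -> c <= p.

(* s = [:: t_1; ...; t_m], with t_0 = 0 left implicit *)
Definition fine_subdivision r (f : R -> X) (s : seq R) : Prop :=
  let t := nth 0 (0 :: s) in
  let tm := last 0 s in
  [/\ path <%R 0 s, tm <= 1,
      forall i, (i < size s)%N -> (diam (f @` `[t i, t i.+1]) < r%:E)%E &
      (diam (f @` `[tm, 1%R]) < r%:E)%E].

(* [g] and [h] correspond under the natural identification of pi_1(X) with
   pi_1(Rips(X, r)): some loop representing [g] has a fine subdivision whose
   simplicial loop f(t_0), ..., f(t_m), f(t_0) represents [h]. *)
Definition pi1_rips_corr r (g : pi1 R x0) (h : rips_pi1 setT r) : Prop :=
  exists (f : loop R x0) (s : seq R) (a : edge_loop (Rips setT r) x0),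
    [/\ g = pi1_class f, fine_subdivision r f s,
        edges a = rcons (map f s) x0 & h = edge_class a].

(* For A = setT the inclusion is the identity and this is [pi1_rips_corr]. *)
Definition rips_ident A r (g : pi1 R x0) (h : rips_pi1 A r) : Prop :=
  pi1_rips_corr g (rips_incl A r h).

End Rips.

Section Persistence.
Context {R : realType} {G : groupType}.

(* A persistent group with a correspondence between G and its groups, meant to
   be an identification close to r0.  Only the indices > r0 are used. *)
Record persistence := Persistence {
  pgroup : R -> groupType;
  bond : forall p q, p < q -> {multiplicative pgroup p -> pgroup q};
  ident : forall r, G -> pgroup r -> Prop }.

(* "The bonding maps are identities on G" close to r0 is read through the
   identifications: there [ident] is the graph of isomorphisms from G, which
   the bonding maps commute with. *)
Definition icsp (r0 : R) (H : persistence) : Prop :=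
  [/\ forall p q t (pq : p < q) (qt : q < t) (pt : p < t), r0 < p ->
        bond H pt =1 bond H qt \o bond H pq,
      forall p q (pq : p < q), r0 < p -> forall h, exists g, bond H pq g = h &
      exists2 e, r0 < e &
        exists iota : forall r, {multiplicative G -> pgroup H r},
          (forall r, r0 < r < e ->
             bijective (iota r) /\ forall g h, ident g h <-> h = iota r g) /\
          (forall p q (pq : p < q), r0 < p -> q < e ->
             bond H pq \o iota p =1 iota q)].

Definition persistence_hom (r0 : R) (H H' : persistence)
    (phi : forall r, {multiplicative pgroup H r -> pgroup H' r}) : Prop :=
  (forall p q (pq : p < q), r0 < p ->
     bond H' pq \o phi p =1 phi q \o bond H pq) /\
  (exists2 e, r0 < e & forall r, r0 < r < e ->
     forall g h, ident g h -> ident g (phi r h)).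

Definition persistence_iso (r0 : R) (H H' : persistence) : Prop :=
  [/\ icsp r0 H, icsp r0 H' &
      exists2 phi, @persistence_hom r0 H H' phi &
        forall r, r0 < r -> bijective (phi r)].

Definition persistence_le (r0 : R) (H H' : persistence) : Prop :=
  [/\ icsp r0 H, icsp r0 H' & exists phi, @persistence_hom r0 H' H phi].

End Persistence.
Arguments persistence R G : clear implicits.

Section FP.
Context {R : realType} {X : metricType R} (x0 : X).

Definition rips_persistence (A : set X) : persistence R (pi1 R x0) :=
  Persistence (rips_bond x0 A) (@rips_ident R X x0 A).

Definition s_dense (s : R) (A : set X) : Prop :=
  forall x, exists2 y, A y & mdist x y < s.

(* A predicate: [persistence] is too large a type for [set]. *)
Definition FP (s : R) (H : persistence R (pi1 R x0)) : Prop :=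
  exists2 A : set X, [/\ finite_set A, s_dense s A & A x0] &
    H = rips_persistence A.

End FP.
Arguments FP {R X} x0 s H.

(* Main.v *)
Require Import Defs.
From HB Require Import structures.
From Stdlib Require Import Relation_Operators Operators_Properties.
From mathcomp Require Import all_boot all_order all_algebra.
From mathcomp Require Import all_classical all_reals all_analysis.
From mathcomp Require Import ring lra zify.
Import Order.TTheory GRing.Theory Num.Theory.
Import numFieldNormedType.Exports.
Set Implicit Arguments.
Unset Strict Implicit.
Unset Printing Implicit Defensive.
Local Open Scope classical_set_scope.
Local Open Scope ring_scope.

(** Paths in a geodesic space can be subdivided at will, so the groups of the
    Rips complexes of X form a decreasing chain of quotients, and below the
    smallest critical value c all of them are pi_1(X).  Let A be s-dense and
    r > 2 s.  Moving every point of X to a point of A at distance less than s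
    sends the Rips complex of X at scale r - 2 s to that of A at scale r.  It
    sends a finely subdivided geodesic between two points a and b of A with
    d(a, b) < r to a path that can be contracted to the edge from a to b, because
    the first half of the path stays close enough to a and the second half to b
    ([approx_chain]).  Hence the bonding maps of A are surjective
    ([approx_bond_surj]), and the map from the group of A to the group of X is
    surjective ([approx_incl_surj]) and, for r < c, injective
    ([approx_incl_inj_small]).

    For r >= c injectivity can only fail because A has too few triangles: it
    holds as soon as the perimeter of each geodesic triangle of X with sides
    shorter than r is null-homotopic in the Rips complex of A at scale r
    ([approx_incl_inj]).  Cut the sides of all geodesic triangles into the same
    number of small steps.  The resulting closed paths form a compact space, and
    nearby ones are homotopic at a small fixed scale.  So there are finitely many
    homotopy classes of triangles, and every class contains a triangle of least
    diameter ([minimal_triangles]).  As the Rips complexes are open, a least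
    triangle is filled in at every scale at which some triangle of its class is.
    A finite s-dense set that contains the vertices of these finitely many least
    triangles therefore has, at all scales r > 2 s, the same groups as X
    ([finite_approximation]).  Any other element of FP(X, s) maps to X by
    inclusion, hence to this one ([rips_persistence_hom]), which is minimal.

    It remains to identify pi_1(X) with the group of the Rips complex of X at
    scales r < c ([rips_iota]).  Subdivisions of a loop have common refinements
    and homotopies can be restricted to fine grids, so subdividing loops defines
    a morphism ([fine_subdivision_homotopic], [homotopic_subdivisions]).  It is
    surjective because an edge path can be realised by geodesics.  For small r it
    is injective because the homotopy class of this realisation depends on that
    of the edge path only ([realize_edge_homotopic]): in a compact semi-locally
    simply-connected space, short paths with common ends are homotopic
    ([short_paths]).  The bonding maps transport this to all r < c, as the first
    scale at which they could fail to be injective would be a critical value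
    ([rips_bond_bijective]). *)

(** * Edge homotopies in a simplicial complex *)

Section EdgeHomotopy.
Context {V : choiceType} (K : simplicial_complex V).
Implicit Types (u v w : V) (a b p q : seq V).

Lemma edge_homotopic_cons u a b :
  edge_homotopic K a b -> edge_homotopic K (u :: a) (u :: b).
Proof. by move=> /(edge_homotopic_cat [:: u] [::]); rewrite !cats0. Qed.

Lemma edge_homotopic_catr a b q :
  edge_homotopic K a b -> edge_homotopic K (a ++ q) (b ++ q).
Proof. exact: (edge_homotopic_cat [::] q). Qed.

Lemma edge_homotopic_catl p a b :
  edge_homotopic K a b -> edge_homotopic K (p ++ a) (p ++ b).
Proof. by move=> /(edge_homotopic_cat p [::]); rewrite !cats0. Qed.

Lemma edge_repeat u q : edge_homotopic K [:: u, u & q] (u :: q).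
Proof. exact/rst_step/(@edge_move_repeat _ K [::]). Qed.

Lemma edge_triangle u v w q : simplex K [set u; v; w] ->
  edge_homotopic K [:: u, v, w & q] [:: u, w & q].
Proof. by move=> h; exact/rst_step/(@edge_move_triangle _ K [::]). Qed.

Lemma edge_triangleV u v w q : simplex K [set u; v; w] ->
  edge_homotopic K [:: u, w & q] [:: u, v, w & q].
Proof. by move=> h; apply: rst_sym; exact: edge_triangle. Qed.

(** All triangles with vertices in P are available, so the second vertex of the
    path can be removed again and again. *)
Lemma edge_clique (P : set V) u a :
  (forall x y z, P x -> P y -> P z -> simplex K [set x; y; z]) ->
  P u -> (forall x, x \in a -> P x) ->
  edge_homotopic K (u :: a) [:: u; last u a].
Proof.
move=> hP; elim: a u => [|v a IH] u Pu Pa /=.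
  exact/rst_sym/edge_repeat.
have Pv : P v by apply: Pa; rewrite mem_head.
have Pa' x : x \in a -> P x by move=> xa; apply: Pa; rewrite inE xa orbT.
apply: (rst_trans _ _ _ _ _ (edge_homotopic_cons u (IH v Pv Pa'))).
apply/edge_triangle/hP => //.
case: (lastP a) Pa' => [//|a' z] Pa'; rewrite last_rcons.
by apply: Pa'; rewrite mem_rcons mem_head.
Qed.

Lemma edge_const u a : (forall x, x \in a -> x = u) ->
  edge_homotopic K (u :: a) [:: u].
Proof.
elim: a => [|v a IH] h; first exact: rst_refl.
rewrite (h v) ?mem_head//; apply: rst_trans (edge_repeat _ _) _.
by apply: IH => x xa; apply: h; rewrite inE xa orbT.
Qed.

(** The two families span a prism over every step of the index path; sliding one
    path along the prisms onto the other leaves the rungs at the two ends. *)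
Lemma edge_ladder (I : Type) (e : rel I) (g h : I -> V) i s :
  (forall i, simplex K [set g i; h i; g i]) ->
  (forall i j, e i j -> simplex K [set g i; g j; h j]) ->
  (forall i j, e i j -> simplex K [set g i; h i; h j]) ->
  path e i s ->
  edge_homotopic K (map g (i :: s))
    (g i :: map h (i :: s) ++ [:: g (last i s)]).
Proof.
move=> h0 h1 h2; elim: s i => [|j s IH] i /=.
  move=> _; apply: rst_trans (edge_triangleV _ (h0 i)).
  exact/rst_sym/edge_repeat.
move=> /andP[eij js].
apply: rst_trans (edge_homotopic_cons _ (IH j js)) _.
apply: rst_trans (edge_triangle _ (h1 _ _ eij)) _.
exact: edge_triangleV (h2 _ _ eij).
Qed.

(** When the two families share their end points, the rungs degenerate. *)
Lemma edge_ladder_ends (I : Type) (e : rel I) (g h : I -> V) i s :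
  (forall i, simplex K [set g i; h i; g i]) ->
  (forall i j, e i j -> simplex K [set g i; g j; h j]) ->
  (forall i j, e i j -> simplex K [set g i; h i; h j]) ->
  path e i s -> h i = g i -> h (last i s) = g (last i s) ->
  edge_homotopic K (map g (i :: s)) (map h (i :: s)).
Proof.
move=> h0 h1 h2 es hi hl; apply: rst_trans (edge_ladder h0 h1 h2 es) _.
rewrite -hi -hl /=; apply: rst_trans (edge_repeat _ _) _.
rewrite -cat_cons; case: (lastP s) {es hl} => [|s' z]; first exact: edge_repeat.
rewrite last_rcons map_rcons -cats1 -cat_cons -catA; apply: edge_homotopic_catl.
exact: edge_repeat.
Qed.

End EdgeHomotopy.

(** With V = W a metric space, L a Rips complex of a subset and f a retraction
    to this subset, the pulled back complex has the points of the whole space as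
    its vertices.  It contains both L and a Rips complex of the whole space, so
    homotopies in all three can be combined before applying f. *)
Section Pullback.
Context {V W : choiceType} (f : V -> W) (L : simplicial_complex W).

Definition pullback_simplex : set (set V) :=
  [set sigma | finite_set sigma /\ simplex L (f @` sigma)].

Lemma pullback_finite sigma : pullback_simplex sigma -> finite_set sigma.
Proof. by case. Qed.

Lemma pullback_neq0 sigma : pullback_simplex sigma -> sigma !=set0.
Proof. by move=> [_ /simplex_neq0[_ [x sx _]]]; exists x. Qed.

Lemma pullback_face sigma tau : pullback_simplex sigma -> tau !=set0 ->
  tau `<=` sigma -> pullback_simplex tau.
Proof.
move=> [fs Ls] [x tx] ts; split; first exact: sub_finite_set ts fs.
by apply: simplex_face Ls _ _; [exists (f x), x|exact: image_subset].
Qed.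

Definition pullback : simplicial_complex V :=
  SimplicialComplex pullback_finite pullback_neq0 pullback_face.

Lemma pullback_triangle u v w :
  simplex pullback [set u; v; w] <-> simplex L [set f u; f v; f w].
Proof.
rewrite /= /pullback_simplex /= !image_setU !image_set1; split=> [[]//|h].
by split=> //; rewrite !finite_setU; do !split; exact: finite_set1.
Qed.

Lemma pullback_homotopic a b : edge_homotopic pullback a b ->
  edge_homotopic L (map f a) (map f b).
Proof.
elim=> [{}a {}b|{}a|{}a {}b _|{}a {}b c _ IH1 _ IH2].
- case=> [p u q|p u v w q /pullback_triangle h]; apply: rst_step;
    rewrite !map_cat /=.
    exact: edge_move_repeat.
  exact: edge_move_triangle.
- exact: rst_refl.
- exact: rst_sym.
- exact: rst_trans IH1 IH2.
Qed.

End Pullback.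

Section Refine.
(* c u w lists the vertices after u of a path from u to w *)
Context {V : choiceType} (c : V -> V -> seq V).
Hypothesis c_last : forall u w, last u (c u w) = w.

Fixpoint refine u (a : seq V) : seq V :=
  if a is v :: a' then c u v ++ refine v a' else [::].

Lemma refine_last u a : last u (refine u a) = last u a.
Proof. by elim: a u => //= v a IH u; rewrite last_cat c_last IH. Qed.

Lemma refine_path (e : rel V) u a :
  (forall u w, path e u (c u w)) -> path e u (refine u a).
Proof. by move=> ce; elim: a u => //= v a IH u; rewrite cat_path ce c_last IH. Qed.

Lemma refine_homotopic (K : simplicial_complex V) (e : rel V) u a :
  (forall u w, e u w -> edge_homotopic K (u :: c u w) [:: u; w]) ->
  path e u a -> edge_homotopic K (u :: refine u a) (u :: a).
Proof.
move=> ce; elim: a u => [|v a IH] u /=; first by move=> _; exact: rst_refl.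
move=> /andP[euv va]; rewrite -cat_cons.
apply: rst_trans (edge_homotopic_catr _ (ce _ _ euv)) _.
exact: edge_homotopic_cons (IH _ va).
Qed.

Definition refine_seq (a : seq V) : seq V :=
  if a is u :: a' then u :: refine u a' else [::].

(** A degenerate triangle shows that c w u and c u w are inverse to each other,
    so the null-homotopic boundary of a triangle u v w turns into a homotopy from
    the refinement of u v w to that of u w, as an edge move requires. *)
Lemma refine_seq_homotopic (K L : simplicial_complex V) :
  (forall u, edge_homotopic K (u :: c u u) [:: u]) ->
  (forall u v w, simplex L [set u; v; w] ->
     edge_homotopic K (u :: c u v ++ c v w ++ c w u) [:: u]) ->
  forall a b, edge_homotopic L a b ->
    edge_homotopic K (refine_seq a) (refine_seq b).
Proof.
move=> cuu ctri.
have catl u w a b : edge_homotopic K (w :: a) (w :: b) ->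
    edge_homotopic K (u :: c u w ++ a) (u :: c u w ++ b).
  move=> /(edge_homotopic_catl (belast u (c u w))).
  by rewrite -!cat_cons ![u :: c u w]lastI c_last !cat_rcons.
have digon u v w : simplex L [set u; v; w] ->
    edge_homotopic K (w :: c w u ++ c u w) [:: w].
  move=> h; have {}h : simplex L [set w; w; u].
    apply: simplex_face h _ _; first by exists w; left; left.
    by move=> x [[->|->]|->]; [right|right|left; left].
  apply: rst_trans (ctri _ _ _ h); rewrite -cat_cons.
  by apply: rst_sym; apply: edge_homotopic_catr (cuu w).
have tri u v w : simplex L [set u; v; w] ->
    edge_homotopic K (u :: c u v ++ c v w) (u :: c u w).
  move=> h.
  have := edge_homotopic_catr (c u w) (ctri _ _ _ h).
  apply: rst_trans; rewrite -!cat_cons -!catA.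
  apply: (catl); rewrite -[X in _ :: X]cats0; apply: (catl).
  exact/rst_sym/(digon _ _ _ h).
suff key a b : edge_move L a b ->
    edge_homotopic K (refine_seq a) (refine_seq b).
  move=> a b; elim=> [{}a {}b /key//|{}a|{}a {}b _|{}a {}b d _ IH1 _ IH2].
  - exact: rst_refl.
  - exact: rst_sym.
  - exact: rst_trans IH1 IH2.
suff pre p q q' : ohead q = ohead q' ->
    edge_homotopic K (refine_seq q) (refine_seq q') ->
    edge_homotopic K (refine_seq (p ++ q)) (refine_seq (p ++ q')).
  case=> [p u q|p u v w q Luvw]; apply: pre => //=; rewrite -cat_cons.
    by apply: edge_homotopic_catr (cuu u).
  by rewrite catA -!cat_cons; apply: edge_homotopic_catr; exact: tri.
move=> hq h; elim: p => //= x [|y p] /= IH; last exact: catl IH.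
case: q q' hq h {IH} => [|z q] [|z' q'] /= hq h; first exact: rst_refl.
- by case: hq.
- by case: hq.
- by case: hq h => <- h; exact: catl h.
Qed.

End Refine.

(** * Maps of edge-path groups induced by inclusions *)

Lemma multiplicative1 (G H : groupType) (f : {multiplicative G -> H}) :
  f 1%g = 1%g.
Proof. by apply: (@mulgI _ (f 1%g)); rewrite -gmulfM !mulg1. Qed.

Lemma multiplicative_inj (G H : groupType) (f : {multiplicative G -> H}) :
  (forall g, f g = 1%g -> g = 1%g) -> injective f.
Proof.
move=> hf g h gh; apply: (@mulIg _ h^-1%g); rewrite mulgV; apply: hf.
by rewrite gmulfM gh -gmulfM mulgV multiplicative1.
Qed.

Section InclusionMaps.
Context {V : choiceType} (K L : simplicial_complex V).
Context (KL : simplex K `<=` simplex L) (v : V).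

Lemma edge_class_eq (M : simplicial_complex V) (a b : edge_loop M v) :
  edge_class a = edge_class b <-> edge_homotopic M (v :: a) (v :: b).
Proof. exact: gclass_eq. Qed.

Lemma edge_pi1_incl_surj :
  (forall b : edge_loop L v, exists a : edge_loop K v,
     edge_homotopic L (v :: a) (v :: b)) ->
  forall h, exists g, edge_pi1_incl KL (v := v) g = h.
Proof.
move=> hs h; have [b ->] := gclass_surj h; have [a ab] := hs b.
by exists (edge_class a); rewrite edge_pi1_inclE; apply/edge_class_eq.
Qed.

Lemma edge_pi1_incl_inj :
  (forall a : edge_loop K v, edge_homotopic L (v :: a) [:: v] ->
     edge_homotopic K (v :: a) [:: v]) ->
  injective (edge_pi1_incl KL (v := v)).
Proof.
move=> hi; apply: multiplicative_inj => k.
have [a ->] := gclass_surj k; rewrite -/(edge_class a) /= edge_pi1_inclE.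
move=> /(edge_class_eq (incl_edge_loop KL a) (cst_edge_loop L v)) /hi.
by move=> /(edge_class_eq a (cst_edge_loop K v)).
Qed.

End InclusionMaps.

(** * Distances, diameters and geodesics *)

Section Metric.
Context {R : realType} {X : metricType R}.
Implicit Types (A B : set X) (r : R).

Lemma cvg_mdist (T : Type) (F : set_system T) (FF : Filter F) (f g : T -> X) x y :
  f @ F --> x -> g @ F --> y -> mdist (f t) (g t) @[t --> F] --> mdist x y.
Proof.
move=> fx gy; apply/cvgrPdist_lt => e e0.
have e2 : 0 < e / 2 by rewrite divr_gt0.
near=> t.
have h1 : mdist x (f t) < e / 2.
  by near: t; apply: metricType_numDomainType.cvgr_dist_lt.
have h2 : mdist y (g t) < e / 2.
  by near: t; apply: metricType_numDomainType.cvgr_dist_lt.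
have := metric_triangle x (f t) y; have := metric_triangle (f t) (g t) y.
have := metric_triangle (f t) x (g t); have := metric_triangle x y (g t).
rewrite (metric_sym (g t) y) (metric_sym (f t) x) => *.
by rewrite ltr_distl; apply/andP; split; lra.
Unshelve. all: by end_near. Qed.

Lemma within_mdist (T : topologicalType) (D : set T) (f : T -> X) x :
  {within D, continuous f} -> {within D, continuous (fun t => mdist x (f t))}.
Proof.
move=> /subspace_continuousP cf; apply/subspace_continuousP => t Dt.
by apply: cvg_mdist; [exact: cvg_cst|exact: cf].
Qed.

Lemma diam_le B (m : R) :
  (forall x y, B x -> B y -> mdist x y <= m) -> (diam B <= m%:E)%E.
Proof.
move=> h; apply: ge_ereal_sup => _ [x Bx [y By <-]].
by rewrite lee_fin; exact: h.
Qed.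

Lemma mdist_lt_diam B r x y :
  (diam B < r%:E)%E -> B x -> B y -> mdist x y < r.
Proof.
move=> Br Bx By; rewrite -lte_fin; apply: le_lt_trans Br.
by apply: ereal_sup_ubound; exists x => //; exists y.
Qed.

Lemma rips_triangle A r u v w : A u -> A v -> A w ->
  mdist u v < r -> mdist v w < r -> mdist u w < r ->
  simplex (Rips A r) [set u; v; w].
Proof.
move=> Au Av Aw uv vw uw; split.
- by rewrite !finite_setU; do !split; exact: finite_set1.
- by exists u; left; left.
- by move=> x [[->|->]|->].
- pose m := Num.max (mdist u v) (Num.max (mdist v w) (mdist u w)).
  apply: (@le_lt_trans _ _ m%:E); last by rewrite lte_fin !gt_max uv vw uw.
  have m0 : 0 <= m by rewrite le_max mdist_ge0.
  have [muv mvw muw] : [/\ mdist u v <= m, mdist v w <= m & mdist u w <= m].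
    by rewrite !le_max !lexx !orbT.
  apply: diam_le => x y [[->|->]|->] [[->|->]|->];
    by rewrite ?mdistxx// metric_sym.
Qed.

Lemma rips_triangleP A r u v w : simplex (Rips A r) [set u; v; w] ->
  [/\ A u, A v, A w & [/\ mdist u v < r, mdist v w < r & mdist u w < r]].
Proof.
move=> [_ _ sA dr].
have [hu hv hw] : [/\ [set u; v; w] u, [set u; v; w] v & [set u; v; w] w].
  by split; [left; left|left; right|right].
by split; [exact: sA|exact: sA|exact: sA|split; exact: mdist_lt_diam dr _ _].
Qed.

Lemma rips_adjacent A r u w :
  Defs.adjacent (Rips A r) u w <-> [/\ A u, A w & mdist u w < r].
Proof.
split=> [/asboolP|[Au Aw uw]].
  by rewrite -[X in X `|` _]setUid => /rips_triangleP[? _ ? [_ ? _]].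
apply/asboolP; rewrite -[X in X `|` _]setUid; apply: rips_triangle => //.
by rewrite mdistxx; exact: le_lt_trans (mdist_ge0 _ _) uw.
Qed.

(** The left-hand side is the variation of f over the partition 0, a, b, 1.
    Partitions being strictly increasing, coinciding points are treated
    apart. *)
Lemma geodesic_three (f : R -> X) (a b : R) :
  path_length 0 1 f = (mdist (f 0) (f 1))%:E -> 0 <= a -> a <= b -> b <= 1 ->
  mdist (f 0) (f a) + mdist (f a) (f b) + mdist (f b) (f 1) <=
  mdist (f 0) (f 1).
Proof.
move=> len a0 ab b1.
have var s : itv_partition 0 1 s -> path_variation 0 1 f s <= mdist (f 0) (f 1).
  by move=> hs; rewrite -lee_fin -len; apply: ereal_sup_ubound; exists s.
have var1 c : 0 < c -> c < 1 -> mdist (f 0) (f c) + mdist (f c) (f 1) <=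
    mdist (f 0) (f 1).
  move=> c0 c1; have := var [:: c; 1].
  rewrite /path_variation /= !big_nat_recl// big_geq//= addr0; apply.
  by split; rewrite /= ?c0 ?c1 ?eqxx.
have [a0'|] := ltP 0 a; last first.
  move=> a0'; have {a0'}-> : a = 0 by apply/eqP; rewrite eq_le a0 a0'.
  rewrite mdistxx add0r.
  have [b1'|b1'] := ltP b 1; last first.
    have -> : b = 1 by apply/eqP; rewrite eq_le b1 b1'.
    by rewrite mdistxx addr0.
  have [b0'|b0'] := ltP 0 b; first exact: var1.
  have -> : b = 0 by apply/eqP; rewrite eq_le b0' (le_trans a0 ab).
  by rewrite mdistxx add0r.
have [b1'|b1'] := ltP b 1; last first.
  have -> : b = 1 by apply/eqP; rewrite eq_le b1 b1'.
  rewrite mdistxx addr0.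
  have [a1'|a1'] := ltP a 1; first exact: var1.
  have -> : a = 1 by apply/eqP; rewrite eq_le a1' (le_trans ab b1).
  by rewrite mdistxx addr0.
have [ab'|ab'] := ltP a b; last first.
  have -> : b = a by apply/eqP; rewrite eq_le ab ab'.
  by rewrite mdistxx addr0; apply: var1 => //; exact: le_lt_trans ab b1'.
have := var [:: a; b; 1].
rewrite /path_variation /= !big_nat_recl// big_geq//= addr0 addrA; apply.
by split; rewrite /= ?a0' ?ab' ?b1' ?eqxx.
Qed.

(** Equality holds: a geodesic is isometric to an interval, however it is
    parametrised. *)
Lemma geodesic_mdist (f : R -> X) (a b : R) :
  path_length 0 1 f = (mdist (f 0) (f 1))%:E -> unit_itv a -> unit_itv b ->
  mdist (f a) (f b) <= `|mdist (f 0) (f a) - mdist (f 0) (f b)|.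
Proof.
move=> len; wlog ab : a b / a <= b => [hw|].
  have [ab|ba] := leP a b; first exact: hw.
  by move=> ? ?; rewrite metric_sym distrC; apply: hw => //; exact: ltW.
move=> /unit_itvP/andP[a0 a1] /unit_itvP/andP[b0 b1].
have := geodesic_three len a0 ab b1; have := metric_triangle (f 0) (f b) (f 1).
by move=> ? ?; rewrite distrC; apply: le_trans (ler_norm _); lra.
Qed.

Lemma geodesic_mdist_le (f : R -> X) (a b : R) :
  path_length 0 1 f = (mdist (f 0) (f 1))%:E -> unit_itv a -> unit_itv b ->
  mdist (f a) (f b) <= mdist (f 0) (f 1).
Proof.
move=> len; wlog ab : a b / a <= b => [hw|].
  have [ab|ba] := leP a b; first exact: hw.
  by move=> ? ?; rewrite metric_sym; apply: hw => //; exact: ltW.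
move=> /unit_itvP/andP[a0 a1] /unit_itvP/andP[b0 b1].
have := geodesic_three len a0 ab b1.
have := mdist_ge0 (f 0) (f a); have := mdist_ge0 (f b) (f 1); lra.
Qed.

(** By the intermediate value theorem a geodesic from u to w meets every sphere
    around u of radius at most d(u, w); the i-th point is at distance
    i / n d(u, w) from u, and at w for i > n. *)
Lemma geodesic_chain (hgeo : geodesic X) n u w : (0 < n)%N ->
  exists c : nat -> X, [/\ c 0%N = u, c n = w,
    forall i, mdist (c i) (c i.+1) <= mdist u w / n%:R &
    forall i, mdist u (c i) + mdist (c i) w <= mdist u w].
Proof.
move=> n0; have [f [cf f0 f1 len]] := hgeo u w; subst u w.
set D := mdist (f 0) (f 1) in len *; have D0 : 0 <= D by exact: mdist_ge0.
have nr : 0 < n%:R :> R by rewrite ltr0n.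
have ex i : exists t, unit_itv t /\ mdist (f 0) (f t) = D * Num.min (i%:R / n%:R) 1.
  have m01 : 0 <= Num.min (i%:R / n%:R : R) 1 <= (1 : R).
    by rewrite le_min ler01 ge_min lexx orbT divr_ge0// ler0n.
  have [|t ht et] := @IVT R (fun t => mdist (f 0) (f t)) 0 1
      (D * Num.min (i%:R / n%:R) 1) ler01 (within_mdist cf).
    by rewrite mdistxx min_l// max_r// -/D; nra.
  by exists t; split => //; move: ht; rewrite /unit_itv /= in_itv.
have [t ht] := choice ex.
have three i : mdist (f 0) (f (t i)) + mdist (f (t i)) (f 1) <= mdist (f 0) (f 1).
  have [/unit_itvP/andP[t0 t1] _] := ht i.
  by have := geodesic_three len t0 (lexx _) t1; rewrite mdistxx addr0.
exists (f \o t); split => //=.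
- apply: mdist_positivity; rewrite metric_sym; apply/eqP; rewrite (ht 0%N).2.
  by rewrite mul0r min_l ?mulr0.
- have := three n; rewrite (ht n).2 divff ?gt_eqF// min_l// mulr1 -/D => h.
  by apply: mdist_positivity; apply/eqP; rewrite eq_le mdist_ge0; lra.
- move=> i; apply: le_trans (geodesic_mdist len (ht _).1 (ht _).1) _.
  rewrite !(ht _).2 -mulrBr normrM ger0_norm// -/D ler_wpM2l//.
  have n0' : 0 < (n%:R)^-1 :> R by rewrite invr_gt0.
  have -> : i.+1%:R / n%:R = i%:R / n%:R + n%:R^-1 :> R.
    by rewrite -natr1 mulrDl mul1r.
  by rewrite ler_norml /Num.min; do !case: ifPn; rewrite -?leNgt; lra.
Qed.

End Metric.

(** * Approximating the space by a dense subset *)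

Lemma last_iota1 n : last 0%N (iota 1 n) = n.
Proof. by rewrite -nth_last size_iota; case: n => // n; rewrite nth_iota. Qed.

Section Between.
Context {R : realType} {X : metricType R}.
Implicit Types (A : set X) (r : R) (u v w x y : X).

Definition between u w : set X :=
  [set x | mdist u x + mdist x w <= mdist u w].

(** The detours from x to y through u and through w have total length at most
    2 d(u, w). *)
Lemma between_mdist u w x y : between u w x -> between u w y ->
  mdist x y <= mdist u w.
Proof.
rewrite /between /= => hx hy.
have := metric_triangle x u y; have := metric_triangle x w y.
rewrite (metric_sym x u) (metric_sym w y) => *; lra.
Qed.

Lemma between_ends u w : between u w u /\ between u w w.
Proof. by rewrite /between /= !mdistxx add0r addr0. Qed.

(** The choice of a finely subdivided geodesic from u to w, listed without u, for
    all u and w. *)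
Definition geodesic_chains (d : R) (c : X -> X -> seq X) : Prop :=
  [/\ forall u w, last u (c u w) = w,
      forall u w, path (fun x y => mdist x y <= d) u (c u w) &
      forall u w x, x \in c u w -> between u w x].

Definition chain_seq n (k : X -> X -> nat -> X) u w : seq X :=
  [seq k u w i | i <- iota 1 n].

Lemma geodesic_subdivisions (hgeo : geodesic X) (M d : R) :
  (forall x y, mdist x y <= M) -> 0 < d -> exists n k, forall u w,
    [/\ k u w 0%N = u, k u w n = w,
        forall i, mdist (k u w i) (k u w i.+1) <= d &
        forall i, between u w (k u w i)].
Proof.
move=> hM d0; pose n := (Num.trunc (`|M| / d)).+1.
have nd : M / n%:R <= d.
  rewrite ler_pdivrMr ?ltr0n// mulrC -ler_pdivrMr//.
  apply: le_trans (ltW (truncnS_gt _)); rewrite ler_pM2r ?invr_gt0//.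
  exact: ler_norm.
have /choice[k hk] : forall uw : X * X, exists c : nat -> X,
    [/\ c 0%N = uw.1, c n = uw.2,
    forall i, mdist (c i) (c i.+1) <= d & forall i, between uw.1 uw.2 (c i)].
  move=> [u w] /=.
  have [c [c0 cn ci cb]] := geodesic_chain (n := n) hgeo u w (ltn0Sn _).
  exists c; split => // i; apply: le_trans (ci i) _; apply: le_trans nd.
  by rewrite ler_pM2r ?invr_gt0 ?ltr0n.
by exists n, (fun u w => k (u, w)) => u w; exact: hk (u, w).
Qed.

Lemma geodesic_chains_seq n k (d : R) :
  (forall u w, [/\ k u w 0%N = u, k u w n = w,
     forall i, mdist (k u w i) (k u w i.+1) <= d &
     forall i, between u w (k u w i)]) ->
  geodesic_chains d (chain_seq n k).
Proof.
move=> hk; rewrite /chain_seq; split => u w.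
- by have [c0 cn _ _] := hk u w; rewrite -{1}c0 last_map last_iota1.
- have [c0 _ ci _] := hk u w; rewrite -{1}c0 path_map.
  have hp m i : path (fun i j => j == i.+1) i (iota i.+1 m).
    by elim: m i => //= m IH i; rewrite IH andbT.
  by apply: sub_path (hp n 0%N) => i j /eqP ->; exact: ci.
- by move=> x /mapP[i _ ->]; have [_ _ _] := hk u w.
Qed.

Lemma geodesic_chains_exist (hgeo : geodesic X) (M d : R) :
  (forall x y, mdist x y <= M) -> 0 < d -> exists c, geodesic_chains d c.
Proof.
move=> hM /(geodesic_subdivisions hgeo hM)[n [k hk]].
by exists (chain_seq n k); exact: geodesic_chains_seq.
Qed.

(** The points of a subdivided geodesic from u to w are at distance at most
    d(u, w) from each other, so they all lie in one simplex. *)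
Lemma refine_rips (d r : R) c u a : geodesic_chains d c ->
  path (Defs.adjacent (Rips setT r)) u a ->
  edge_homotopic (Rips setT r) (u :: refine c u a) (u :: a).
Proof.
move=> [cl _ cb] ap; apply: refine_homotopic ap => {}u w /rips_adjacent[_ _ uw].
rewrite -{2}(cl u w); have [bu _] := between_ends u w.
apply: (edge_clique (P := between u w)) => //; last exact: cb.
by move=> x y z hx hy hz; apply: rips_triangle => //;
  exact: le_lt_trans (between_mdist _ _) uw.
Qed.

End Between.

Section Approximation.
Context {R : realType} {X : metricType R} (A : set X) (s : R) (f : X -> X).
Hypotheses (fA : forall x, A (f x)) (fs : forall x, mdist x (f x) < s).
Hypothesis fid : forall x, A x -> f x = x.
Implicit Types (r d : R).

Let fdist x y : mdist (f x) (f y) < mdist x y + 2 * s.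
Proof.
have := metric_triangle (f x) x (f y); have := metric_triangle x y (f y).
have := fs x; have := fs y; rewrite (metric_sym (f x) x) => *; lra.
Qed.

Let fdistl x y : mdist x (f y) < mdist x y + s.
Proof. by have := metric_triangle x y (f y); have := fs y; lra. Qed.

Let s_gt0 (x : X) : 0 < s.
Proof. exact: le_lt_trans (mdist_ge0 _ _) (fs x). Qed.

Let K r := pullback f (Rips A r).

Lemma approx_triangle r u v w : mdist (f u) (f v) < r ->
  mdist (f v) (f w) < r -> mdist (f u) (f w) < r ->
  simplex (K r) [set u; v; w].
Proof. by move=> *; apply/pullback_triangle; exact: rips_triangle. Qed.

(** Moving the vertices by less than s increases diameters by less than 2 s. *)
Lemma approx_rips d r : d + 2 * s <= r ->
  simplex (Rips setT d) `<=` simplex (K r).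
Proof.
move=> dr sigma [fsig [x sx] _ sd]; split=> //; split.
- exact: finite_image.
- by exists (f x), x.
- by move=> _ [y _ <-].
- have s0 := s_gt0 x.
  have [m dm ms] : exists2 m, (diam sigma <= m%:E)%E & m < d.
    have dge : (0%:E <= diam sigma)%E.
      by apply: ereal_sup_ubound; exists x => //; exists x => //; rewrite mdistxx.
    case: (diam sigma) sd dge => //= m md _.
    by exists m => //; rewrite -lte_fin.
  apply: (@le_lt_trans _ _ (m + 2 * s)%:E); last by rewrite lte_fin; lra.
  apply: diam_le => _ _ [y sy <-] [z sz <-]; apply: ltW.
  apply: lt_le_trans (fdist y z) _; rewrite lerD2r -lee_fin.
  by apply: le_trans dm; apply: ereal_sup_ubound; exists y => //; exists z.
Qed.

(** Points x of the path in the first half of the geodesic satisfy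
    d(a, f x) < r / 2 + s, those in the second half d(b, f x) < r / 2 + s; as
    s < r / 2, they can be joined to a, resp. to b, in the pulled back complex.
    The term d in the first hypothesis is for steps across the midpoint, the ends
    of which have to be joined to both a and b. *)
Lemma approx_chain d r a b l : 2 * (d + s) <= r ->
  A a -> A b -> mdist a b < r -> path (fun x y => mdist x y <= d) a l ->
  last a l = b -> (forall x, x \in l -> between a b x) ->
  edge_homotopic (K r) (a :: l) [:: a; b].
Proof.
move=> dsr Aa Ab abr al lb lbet; set D := mdist a b in abr.
have s0 := s_gt0 a; have D0 : 0 <= D by exact: mdist_ge0.
suff key q : path (fun x y => mdist x y <= d) q l -> last q l = b ->
    between a b q -> 
    (mdist a q <= D / 2 -> edge_homotopic (K r) (q :: l) [:: q; a; b]) /\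
    (D / 2 < mdist a q -> edge_homotopic (K r) (q :: l) [:: q; b]).
  have [ba _] := between_ends a b.
  apply: rst_trans (edge_repeat _ _ _).
  by apply: (key a al lb ba).1; rewrite mdistxx divr_ge0.
have near0 x e c : A c -> mdist c x <= D / 2 + e -> e <= d ->
    mdist c (f x) < r.
  by move=> _ h1 h2; have := fdistl c x; lra.
elim: l q {al lb} lbet => [|q' l IH] q lbet /=.
  move=> _ -> _; split=> h; last exact/rst_sym/edge_repeat.
  have ab : a = b by apply: mdist_positivity; rewrite -/D; rewrite -/D in h; lra.
  rewrite ab; apply: rst_sym; apply: rst_trans (edge_repeat _ _ _) _.
  exact: edge_repeat.
move=> /andP[qq' q'l] lb bq.
have bq' : between a b q' by apply: lbet; rewrite mem_head.
have d0 : 0 <= d by exact: le_trans (mdist_ge0 _ _) qq'.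
have [|IH1 IH2] := IH q' _ q'l lb bq'.
  by move=> x xl; apply: lbet; rewrite inE xl orbT.
have fqq' : mdist (f q) (f q') < r by have := fdist q q'; lra.
have fab : mdist (f a) (f b) < r by rewrite !fid.
have tq' := metric_triangle a q q'; have tq := metric_triangle a q' q.
have tb' := metric_triangle b q q'; have tb := metric_triangle b q' q.
rewrite /between /= -/D in bq bq'.
rewrite ![mdist b _]metric_sym !(metric_sym q' q) in tq tq' tb tb'.
have fa x : mdist a x <= D / 2 + d -> mdist (f a) (f x) < r.
  by move=> h; rewrite (fid Aa); exact: (near0 x d).
have fb x : mdist x b <= D / 2 + d -> mdist (f b) (f x) < r.
  by move=> h; rewrite (fid Ab); apply: (near0 x d) => //; rewrite metric_sym.
have sy x y : mdist (f x) (f y) < r -> mdist (f y) (f x) < r.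
  by rewrite metric_sym.
have [q'a|q'b] := leP (mdist a q') (D / 2).
  have h := edge_homotopic_cons q (IH1 q'a).
  have fq' : mdist (f a) (f q') < r by apply: fa; lra.
  have fq : mdist (f a) (f q) < r by apply: fa; lra.
  have {}h : edge_homotopic (K r) [:: q, q' & l] [:: q; a; b].
    by apply: rst_trans h _; apply: edge_triangle; apply: approx_triangle; auto.
  split=> // qb; apply: rst_trans h _; apply: edge_triangle.
  by apply: approx_triangle; auto; apply: sy; apply: fb; lra.
have h := edge_homotopic_cons q (IH2 q'b).
have fq' : mdist (f b) (f q') < r by apply: fb; lra.
split=> [qa|qb].
  have fq : mdist (f a) (f q) < r by apply: fa; lra.
  have fq'a : mdist (f a) (f q') < r by apply: fa; lra.
  apply: rst_trans h _.
  apply: (@rst_trans _ _ _ [:: q; a; q'; b]).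
    by apply: edge_triangleV; apply: approx_triangle; auto.
  apply: edge_homotopic_cons; apply: edge_triangle.
  by apply: approx_triangle; auto.
have fq : mdist (f b) (f q) < r by apply: fb; lra.
by apply: rst_trans h _; apply: edge_triangle; apply: approx_triangle; auto.
Qed.

Lemma approx_refine d r c u a : 2 * (d + s) <= r -> geodesic_chains d c ->
  path (Defs.adjacent (Rips A r)) u a ->
  edge_homotopic (K r) (u :: refine c u a) (u :: a).
Proof.
move=> dsr [cl cp cb] ap; apply: refine_homotopic ap => {}u w /rips_adjacent[Au Aw uw].
exact: (approx_chain dsr Au Aw uw (cp u w) (cl u w) (cb u w)).
Qed.

Variable x0 : X.
Hypothesis Ax0 : A x0.

Let edges_fid r (a : edge_loop (Rips A r) x0) : map f (x0 :: a) = x0 :: a.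
Proof.
have h (l : seq X) u : path (Defs.adjacent (Rips A r)) u l -> map f l = l.
  by elim: l u => //= v l IH u /andP[/rips_adjacent[_ Av _] /IH ->]; rewrite fid.
by rewrite /= fid// (h _ _ (edges_path a)).
Qed.

Let approx_loop d r c (cc : geodesic_chains d c) (a : seq X) :
  d + 2 * s <= r -> last x0 a = x0 -> exists b : edge_loop (Rips A r) x0,
    edges b = map f (refine c x0 a).
Proof.
have [cl cp _] := cc => dsr al.
have bp : path (Defs.adjacent (Rips A r)) x0 (map f (refine c x0 a)).
  rewrite -{1}(fid Ax0) path_map.
  apply: sub_path (refine_path cl x0 a cp) => x y xy.
  by apply/rips_adjacent; split => //; have := fdist x y; lra.
have bl : last x0 (map f (refine c x0 a)) = x0.
  by rewrite -{1}(fid Ax0) last_map refine_last// al fid.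
by exists (EdgeLoop bp bl).
Qed.

Hypotheses (hgeo : geodesic X) (M : R) (hM : forall x y : X, mdist x y <= M).

(** An edge path of A is homotopic to its refinement in the pulled back complex;
    the image under f of this homotopy ends in a path with short steps. *)
Lemma approx_bond_surj p q : 2 * s < p -> p <= q ->
  forall b : edge_loop (Rips A q) x0,
  exists a : edge_loop (Rips A p) x0,
    edge_homotopic (Rips A q) (x0 :: a) (x0 :: b).
Proof.
move=> sp pq b; pose d := (p - 2 * s) / 2; have s0 := s_gt0 x0.
have d0 : 0 < d by rewrite /d divr_gt0// subr_gt0.
have [c cc] := geodesic_chains_exist hgeo hM d0.
have dE : 2 * d = p - 2 * s by rewrite /d; lra.
have [|a aE] := approx_loop (r := p) cc _ (edges_last b); first lra.
exists a => //.
have := @pullback_homotopic _ _ f _ _ _ (approx_refine _ cc (edges_path b)).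
rewrite edges_fid aE /= (fid Ax0); apply; lra.
Qed.

(** A refined path x0, x1, ... and its image f x0, f x1, ... form a ladder with
    rungs shorter than s. *)
Lemma approx_incl_surj r : 2 * s < r ->
  forall b : edge_loop (Rips setT r) x0,
  exists a : edge_loop (Rips A r) x0,
    edge_homotopic (Rips setT r) (x0 :: a) (x0 :: b).
Proof.
move=> sr b; pose d := (r - 2 * s) / 2; have s0 := s_gt0 x0.
have d0 : 0 < d by rewrite /d divr_gt0// subr_gt0.
have [c cc] := geodesic_chains_exist hgeo hM d0.
have dE : 2 * d = r - 2 * s by rewrite /d; lra.
have [|a aE] := approx_loop (r := r) cc _ (edges_last b); first lra.
have [cl cp _] := cc.
exists a => //; rewrite aE.
apply: rst_trans (refine_rips cc (edges_path b)); apply: rst_sym.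
have -> : x0 :: map f (refine c x0 b) = map f (x0 :: refine c x0 b).
  by rewrite /= fid.
have : edge_homotopic (Rips setT r) (map id (x0 :: refine c x0 b))
  (map f (x0 :: refine c x0 b)); last by rewrite map_id.
apply: (edge_ladder_ends (e := fun x y => mdist x y <= d)).
- move=> x; apply: rips_triangle => //; rewrite ?mdistxx ?(metric_sym _ x);
    have := fs x; lra.
- move=> x y xy; apply: rips_triangle => //; have := fs y;
    have := fdistl x y; lra.
- move=> x y xy; apply: rips_triangle => //; have := fs x;
    have := fdistl x y; have := fdist x y; lra.
- exact: refine_path.
- exact: fid.
- by rewrite refine_last// edges_last fid.
Qed.

(** The refinement of a is null-homotopic at scale r, hence at scale r - 2 s by
    assumption, and f maps this smaller null-homotopy to A. *)
Lemma approx_incl_inj_small r : 2 * s < r ->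
  (forall b : edge_loop (Rips setT (r - 2 * s)) x0,
    edge_homotopic (Rips setT r) (x0 :: b) [:: x0] ->
    edge_homotopic (Rips setT (r - 2 * s)) (x0 :: b) [:: x0]) ->
  forall a : edge_loop (Rips A r) x0,
    edge_homotopic (Rips setT r) (x0 :: a) [:: x0] ->
    edge_homotopic (Rips A r) (x0 :: a) [:: x0].
Proof.
move=> sr hinj a a0; pose d := (r - 2 * s) / 2; have s0 := s_gt0 x0.
have d0 : 0 < d by rewrite /d divr_gt0// subr_gt0.
have [c cc] := geodesic_chains_exist hgeo hM d0.
have dE : 2 * d = r - 2 * s by rewrite /d; lra.
have [cl cp _] := cc.
have bp : path (Defs.adjacent (Rips setT (r - 2 * s))) x0 (refine c x0 a).
  apply: sub_path (refine_path cl x0 a cp) => x y xy.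
  by apply/rips_adjacent; split => //; lra.
have bl : last x0 (refine c x0 a) = x0 by rewrite refine_last ?edges_last.
have b0 : edge_homotopic (Rips setT (r - 2 * s)) (x0 :: refine c x0 a) [:: x0].
  apply: (hinj (EdgeLoop bp bl)) => /=; apply: rst_trans a0.
  apply: refine_rips cc _; apply: sub_path (edges_path a) => x y.
  by move=> /rips_adjacent[_ _ xy]; apply/rips_adjacent.
rewrite -(edges_fid a) -[in X in edge_homotopic _ _ X](fid Ax0).
apply: (@pullback_homotopic _ _ f _ _ [:: x0]).
apply: rst_trans (rst_sym _ _ _ _ (approx_refine _ cc (edges_path a))) _; first lra.
by apply: (incl_edge_homotopic (approx_rips _)) b0; lra.
Qed.

(** Refining each vertex sequence of a null-homotopy at scale r gives a
    null-homotopy in the pulled back complex, which f maps to A. *)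
Lemma approx_incl_inj d r c : 2 * (d + s) <= r -> geodesic_chains d c ->
  (forall u v w, mdist u v < r -> mdist v w < r -> mdist u w < r ->
     edge_homotopic (K r) (u :: c u v ++ c v w ++ c w u) [:: u]) ->
  forall a : edge_loop (Rips A r) x0,
    edge_homotopic (Rips setT r) (x0 :: a) [:: x0] ->
    edge_homotopic (Rips A r) (x0 :: a) [:: x0].
Proof.
move=> dsr cc ctri a a0; have [cl _ cb] := cc.
have cuu u : edge_homotopic (K r) (u :: c u u) [:: u].
  apply: edge_const => x /cb; rewrite /between /= mdistxx => h.
  apply: mdist_positivity; apply/eqP; rewrite eq_le mdist_ge0 andbT.
  by have := mdist_ge0 u x; lra.
have ctri' u v w : simplex (Rips setT r) [set u; v; w] ->
    edge_homotopic (K r) (u :: c u v ++ c v w ++ c w u) [:: u].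
  by move=> /rips_triangleP[_ _ _ [uv vw uw]]; exact: ctri.
rewrite -(edges_fid a) -[in X in edge_homotopic _ _ X](fid Ax0).
apply: (@pullback_homotopic _ _ f _ _ [:: x0]).
apply: rst_trans (rst_sym _ _ _ _ (approx_refine dsr cc (edges_path a))) _.
exact: (refine_seq_homotopic cl cuu ctri' a0).
Qed.

End Approximation.

Lemma s_dense_retraction (R : realType) (X : metricType R) (s : R) (A : set X) :
  0 < s -> s_dense s A -> exists f : X -> X,
    [/\ forall x, A (f x), forall x, mdist x (f x) < s &
        forall x, A x -> f x = x].
Proof.
move=> s0 sA.
have /choice[f hf] : forall x, exists y, [/\ A y, mdist x y < s & A x -> y = x].
  move=> x; have [Ax|nAx] := pselect (A x); first by exists x; rewrite mdistxx.
  by have [y Ay xy] := sA x; exists y.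
by exists f; split=> x; have [] := hf x.
Qed.

(** * Finitely many triangles of least diameter *)

(** Compactness in the form in which finite nets and finite sets of
    representatives are found. *)
Lemma compact_finite_near (T : topologicalType) (D : set T)
    (P : T -> T -> Prop) :
  compact D -> (forall x, D x -> \forall y \near x, D y -> P x y) ->
  exists F : set T, [/\ finite_set F, F `<=` D &
    forall y, D y -> exists2 x, F x & P x y].
Proof.
move=> cD hP.
(* the filter generated by the supersets of finite subsets of D *)
pose G : set_system (set T) := [set Q | exists F0,
  [/\ finite_set F0, F0 `<=` D & forall F, F0 `<=` F -> Q F]].
have FG : Filter G.
  split; first by exists set0; split.
    move=> Q Q' [F0 [fF0 F0D hQ]] [F1 [fF1 F1D hQ']]; exists (F0 `|` F1); split.
    - by rewrite finite_setU.
    - by rewrite subUset.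
    - by move=> F; rewrite subUset => -[? ?]; split; [exact: hQ|exact: hQ'].
  by move=> Q Q' QQ' [F0 [fF0 F0D hQ]]; exists F0; split=> // F /hQ /QQ'.
have /compact_near_coveringP/near_covering_withinP cov := cD.
have [] := cov _ G (fun F y => exists2 x, F x & P x y) FG _.
  move=> x Dx; exists ([set y | D y -> P x y], [set F | F x]).
    split => /=; first exact: hP.
    exists [set x]; split; first exact: finite_set1.
      by move=> _ ->.
    by move=> F; apply.
  by move=> [y F] /= [xy Fx] Dy; exists x => //; exact: xy.
by move=> F0 [fF0 F0D hF]; exists F0; split=> //; exact: hF.
Qed.

(** On a compact set an equivalence relation with open classes has finitely many
    classes, and these are compact, so that a continuous function attains its
    minimum on each of them. *)
Lemma compact_minimal_representatives (R : realType) (T : topologicalType)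
    (D : set T) (E : T -> T -> Prop) (m : T -> R) :
  compact D -> continuous m -> (forall x, E x x) ->
  (forall x y, E x y -> E y x) -> (forall x y z, E x y -> E y z -> E x z) ->
  (forall x, D x -> \forall y \near x, D y -> E x y) ->
  exists F : set T, [/\ finite_set F, F `<=` D &
    forall x, D x -> exists2 y, F y & E x y /\ m y <= m x].
Proof.
move=> cD cm Er Es Et Eo.
have ex_min x : D x -> exists y, [/\ D y, E x y &
    forall z, D z -> E x z -> m y <= m z].
  move=> Dx; pose V := [set y | D y -> ~ E x y]°.
  have CE : D `&` ~` V = [set y | D y /\ E x y].
    apply/seteqP; split=> y [Dy hy]; split=> //; last first.
      by move=> /nbhs_singleton /(_ Dy).
    apply: contrapT => nE; apply: hy; rewrite /V /interior /=.
    apply: filterS (Eo y Dy) => z hz Dz xz; apply: nE.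
    by apply: Et xz _; apply: Es; exact: hz.
  have cC : compact (D `&` ~` V).
    by apply: compact_closedI => //; apply: open_closedC; exact: open_interior.
  have [|y] := compact_EVT_min _ cC (continuous_subspaceT cm).
    by exists x; rewrite CE.
  by rewrite CE => /set_mem[Dy xy] hy; exists y; split=> // z Dz xz;
    apply: hy; apply/mem_set.
have /choice[k hk] : forall x, exists y, D x -> [/\ D y, E x y &
    forall z, D z -> E x z -> m y <= m z].
  by move=> x; have [/ex_min[y]|nDx] := pselect (D x); [exists y|exists x].
have [F [fF FD hF]] := compact_finite_near cD Eo.
exists (k @` F); split; first exact: finite_image.
- by move=> _ [x Fx <-]; have [] := hk x (FD x Fx).
- move=> x Dx; have [y Fy yx] := hF x Dx.
  have [Dk yk kmin] := hk y (FD y Fy); exists (k y); first by exists y.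
  by split; [exact: Et (Es _ _ yx) yk|exact: kmin].
Qed.

Lemma closed_le_fun (R : realType) (T : topologicalType) (f g : T -> R) :
  continuous f -> continuous g -> closed [set t | f t <= g t].
Proof.
move=> cf cg; rewrite (_ : [set _ | _] = [set t | f t - g t <= 0]).
  by apply: closed_le_comp => t; apply: cvgB; [exact: cf|exact: cg].
by apply/seteqP; split=> t /=; rewrite subr_le0.
Qed.

Lemma continuous_add (R : realType) (T : topologicalType) (f g : T -> R) :
  continuous f -> continuous g -> continuous (fun t => f t + g t).
Proof. by move=> cf cg t; apply: cvgD; [exact: cf|exact: cg]. Qed.

Lemma continuous_maxr (R : realType) (T : topologicalType) (f g : T -> R) :
  continuous f -> continuous g -> continuous (fun t => Num.max (f t) (g t)).
Proof. by move=> cf cg t; apply: continuous_max; [exact: cf|exact: cg]. Qed.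

Section Triangles.
Context {R : realType} {X : metricType R}.
Hypothesis Xc : compact [set: X].
Variables (n : nat) (d : R).
Implicit Types (t : nat -> X) (K : simplicial_complex X).

(** Perimeters of geodesic triangles with vertices t 0, t n and t (2 n), as
    infinite sequences of which only the first 3 n + 1 terms matter: this puts
    triangles into a product of copies of X, which is compact. *)
Definition triangle t : Prop :=
  [/\ forall i, (i < 3 * n)%N -> mdist (t i) (t i.+1) <= d,
      t (3 * n)%N = t 0%N &
      forall j i, (j < 3)%N -> (i <= n)%N ->
        between (t (j * n)%N) (t (j.+1 * n)%N) (t (j * n + i)%N)].

Definition triangle_size t : R :=
  Num.max (mdist (t 0%N) (t n)) (Num.max (mdist (t n) (t (2 * n)%N))
    (mdist (t 0%N) (t (2 * n)%N))).

Definition triangle_path t : seq X := [seq t i | i <- iota 0 (3 * n).+1].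

Definition triangle_null K t : Prop :=
  edge_homotopic K (triangle_path t) [:: t 0%N].

Let Y := prod_topology (fun _ : nat => X).

Let proj_cvg (t : Y) i : (fun u : Y => u i) @ nbhs t --> t i.
Proof. exact: (@proj_continuous nat (fun _ => X) i t). Qed.

Let cont_mdist i j : continuous (fun t : Y => mdist (t i) (t j)).
Proof. move=> t. exact: (cvg_mdist (nbhs_filter t) (@proj_cvg t i) (@proj_cvg t j)). Qed.

(** All the defining conditions are closed, and a countable product of compact
    spaces is compact. *)
Lemma compact_triangles : compact [set t : Y | triangle t].
Proof.
have cY : compact [set: Y].
  have := @tychonoff _ (fun _ : nat => X) _ (fun=> Xc).
  by congr (compact _); apply/seteqP; split.
apply: subclosed_compact cY _ => //.
rewrite (_ : [set t : Y | triangle t] =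
  (\bigcap_(i in [set i | (i < 3 * n)%N]) [set t : Y | mdist (t i) (t i.+1) <= d])
  `&` ([set t : Y | mdist (t (3 * n)%N) (t 0%N) <= 0] `&`
  \bigcap_(ji in [set ji : nat * nat | (ji.1 < 3)%N /\ (ji.2 <= n)%N])
    [set t : Y | mdist (t (ji.1 * n)%N) (t (ji.1 * n + ji.2)%N) +
       mdist (t (ji.1 * n + ji.2)%N) (t (ji.1.+1 * n)%N) <=
       mdist (t (ji.1 * n)%N) (t (ji.1.+1 * n)%N)])).
- apply: closedI; last apply: closedI.
  + apply: closed_bigI => i _; apply: closed_le_fun; first exact: cont_mdist.
    exact: cst_continuous.
  + apply: closed_le_fun; first exact: cont_mdist.
    exact: cst_continuous.
  + apply: closed_bigI => i _; apply: closed_le_fun; last exact: cont_mdist.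
    by apply: continuous_add; exact: cont_mdist.
- apply/seteqP; split=> t.
  + move=> [h1 h2 h3]; split; [|split] => /=.
    * by move=> i; exact: h1.
    * by rewrite h2 mdistxx.
    * by move=> [j i] /= [jn im]; exact: h3.
  + move=> [h1 [h2 h3]]; split.
    * by move=> i; exact: h1.
    * apply: mdist_positivity; apply/eqP; rewrite eq_le mdist_ge0 andbT.
      exact: h2.
    * by move=> j i jn im; exact: (h3 (j, i)).
Qed.

Lemma triangle_size_continuous : continuous (triangle_size : Y -> R).
Proof.
by apply: continuous_maxr; [|apply: continuous_maxr]; exact: cont_mdist.
Qed.


(** The prism between two nearby triangles is made of small simplices. *)
Lemma triangle_null_near (r : R) K t t' : simplex (Rips setT r) `<=` simplex K ->
  triangle t -> triangle t' ->
  (forall i, (i <= 3 * n)%N -> mdist (t i) (t' i) < r - d) -> 0 <= d ->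
  triangle_null K t' -> triangle_null K t.
Proof.
move=> rK [ts tl _] [ts' tl' _] tt' d0 nt'.
have close i : (i <= 3 * n)%N -> mdist (t i) (t' i) < r by move=> /tt'; lra.
(* nothing is known of t and t' beyond the index 3 n, so the sequences are made
   constant there *)
pose g i := t (minn i (3 * n)%N); pose h i := t' (minn i (3 * n)%N).
have gh i : mdist (g i) (h i) < r - d by apply: tt'; exact: geq_minr.
have gg i : mdist (g i) (g i.+1) <= d.
  rewrite /g; have [i3|i3] := ltnP i (3 * n)%N.
    by rewrite (minn_idPl i3); exact: ts.
  by rewrite (minn_idPr (leqW i3)) mdistxx.
have hh i : mdist (h i) (h i.+1) <= d.
  rewrite /h; have [i3|i3] := ltnP i (3 * n)%N.
    by rewrite (minn_idPl i3); exact: ts'.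
  by rewrite (minn_idPr (leqW i3)) mdistxx.
have gE : triangle_path t = map g (iota 0 (3 * n).+1).
  apply/eq_in_map => i; rewrite mem_iota add0n ltnS => /andP[_ i3].
  by rewrite /g (minn_idPl i3).
have hE : triangle_path t' = map h (iota 0 (3 * n).+1).
  apply/eq_in_map => i; rewrite mem_iota add0n ltnS => /andP[_ i3].
  by rewrite /h (minn_idPl i3).
have hp m i : path (fun i j => j == i.+1) i (iota i.+1 m).
  by elim: m i => //= m IH i; rewrite IH andbT.
have diag i : mdist (g i) (h i.+1) < r.
  by have := metric_triangle (g i) (g i.+1) (h i.+1); have := gg i;
    have := gh i.+1; lra.
have lad : edge_homotopic K (map g (iota 0 (3 * n).+1))
    (g 0%N :: map h (iota 0 (3 * n).+1) ++ [:: g (3 * n)%N]).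
  rewrite -[X in _ ++ [:: g X]](last_iota1 (3 * n)).
  apply: (@edge_ladder _ K nat (fun i j => j == i.+1) g h 0%N (iota 1 (3 * n))).
  - move=> i; apply/rK/rips_triangle => //; have := gh i; rewrite ?mdistxx;
      rewrite ?(metric_sym (h i)); have := mdist_ge0 (g i) (h i); lra.
  - move=> i j /eqP ->; apply/rK/rips_triangle => //; have := gg i;
      have := gh i.+1; have := gh i; have := mdist_ge0 (g i) (h i);
      have := diag i; lra.
  - move=> i j /eqP ->; apply/rK/rips_triangle => //; have := hh i;
      have := gh i; have := mdist_ge0 (g i) (h i); have := diag i; lra.
  - exact: hp.
rewrite /triangle_null gE; apply: rst_trans lad _.
rewrite -hE /g minnn tl.
apply: rst_trans (edge_homotopic_cons _ (edge_homotopic_catr _ nt')) _.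
rewrite /= min0n; apply: rst_trans (edge_triangle _ _) _; last exact: edge_repeat.
have := close 0%N (leq0n _); have := mdist_ge0 (t 0%N) (t' 0%N) => h1 h2.
by apply/rK/rips_triangle => //; rewrite ?(metric_sym (t' 0%N)) ?mdistxx//; lra.
Qed.

(** Triangles are considered equivalent when they are null-homotopic in the same
    complexes containing the Rips complex of X at scale r.  This relation is
    coarser than free homotopy at scale r.  The complexes in question include
    the pulled back Rips complexes of the finite subset of X that will be chosen
    by means of the minimal triangles. *)
Lemma minimal_triangles (r : R) : 0 <= d -> d < r ->
  exists F : set (nat -> X), [/\ finite_set F, F `<=` triangle &
    forall t, triangle t -> exists2 t', F t' &
      triangle_size t' <= triangle_size t /\
      forall K, simplex (Rips setT r) `<=` simplex K ->
        triangle_null K t' -> triangle_null K t].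
Proof.
move=> d0 dr.
pose E t t' := forall K, simplex (Rips setT r) `<=` simplex K ->
  triangle_null K t <-> triangle_null K t'.
have [|F [fF FT hF]] := @compact_minimal_representatives R Y [set t : Y | triangle t] E
  (triangle_size : Y -> R) compact_triangles triangle_size_continuous
  (fun _ _ _ => iff_refl _) (fun _ _ h K hK => iff_sym (h K hK))
  (fun _ _ _ h h' K hK => iff_trans (h K hK) (h' K hK)) _.
- move=> t Tt.
  have near_t (i : 'I_(3 * n).+1) :
      \forall t' \near (t : Y), mdist (t i) ((t' : Y) (i : nat)) < r - d.
    have := @proj_cvg t i.
    by move/metricType_numDomainType.cvgr_dist_lt; apply; rewrite subr_gt0.
  have := filter_forall (nbhs_filter (t : Y)) near_t.
  apply: filterS => t' tt' Tt' K rK.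
  have {}tt' i : (i <= 3 * n)%N -> mdist (t i) (t' i) < r - d.
    by rewrite -ltnS => i3; exact: (tt' (Ordinal i3)).
  split; apply: triangle_null_near rK _ _ _ d0 => //.
  by move=> i /tt'; rewrite metric_sym.
- exists F; split => // t /hF[t' Ft' [tt' le]]; exists t' => //; split => // K.
  by move=> /tt'[].
Qed.

End Triangles.

(** * A finite approximation with the right relations *)

Section FiniteApproximation.
Context {R : realType} {X : metricType R} (x0 : X).
Hypotheses (Xc : compact [set: X]) (hgeo : geodesic X).

Lemma compact_mdist_bounded : exists M : R, forall x y : X, mdist x y <= M.
Proof.
have cm : {within [set: X], continuous (mdist x0)}.
  by apply: within_mdist; apply: continuous_subspaceT => x; exact: cvg_id.
have [|m _ hm] := compact_EVT_max _ Xc cm; first by exists x0.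
exists (mdist x0 m + mdist x0 m) => x y.
apply: le_trans (metric_triangle x x0 y) _; rewrite (metric_sym x x0).
by apply: lerD; apply: hm; rewrite inE.
Qed.

Lemma finite_s_dense s : 0 < s -> exists2 A : set X, finite_set A & s_dense s A.
Proof.
move=> s0; have [|F [fF _ hF]] := @compact_finite_near X setT
    (fun x y => mdist y x < s) Xc.
  move=> x _; have := nbhsx_ballx x s s0; rewrite ballEmdist.
  apply: filterS => y xy _.
  by rewrite metric_sym.
by exists F => // x; have [y Fy] := hF x Logic.I; exists y.
Qed.

Let triangle_of n k (u v w : X) : nat -> X := fun i =>
  if (i <= n)%N then k u v i else
  if (i <= 2 * n)%N then k v w (i - n)%N else k w u (i - 2 * n)%N.

Let triangle_ofP n d k u v w :
  (forall u w : X, [/\ k u w 0%N = u, k u w n = w,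
     forall i, mdist (k u w i) (k u w i.+1) <= d &
     forall i, between u w (k u w i)]) ->
  [/\ triangle n d (triangle_of n k u v w),
      triangle_size n (triangle_of n k u v w) =
        Num.max (mdist u v) (Num.max (mdist v w) (mdist u w)) &
      triangle_path n (triangle_of n k u v w) =
        u :: chain_seq n k u v ++ chain_seq n k v w ++ chain_seq n k w u].
Proof.
move=> hk; set t := triangle_of n k u v w.
have k0 x y : k x y 0%N = x by have [] := hk x y.
have kn x y : k x y n = y by have [] := hk x y.
have t0 i : (i <= n)%N -> t i = k u v i by rewrite /t /triangle_of => ->.
have t1 i : (i <= n)%N -> t (n + i)%N = k v w i.
  move=> ni; rewrite /t /triangle_of addKn mul2n -addnn leq_add2l ni.
  by case: ifPn => //; case: i ni => [|i] ni; rewrite ?addn0 ?kn ?k0//;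
    rewrite addnS -ltn_subRL subnn ltn0.
have t2 i : (i <= n)%N -> t (2 * n + i)%N = k w u i.
  case: i => [_|i ni]; first by rewrite addn0 mul2n -addnn t1// kn k0.
  rewrite /t /triangle_of addKn.
  have h : (2 * n < 2 * n + i.+1)%N by rewrite addnS ltnS leq_addr.
  rewrite !ifN// -ltnNge; first by [].
  by apply: leq_ltn_trans h; rewrite leq_pmull.
have t0E : t 0%N = u by rewrite t0.
have t1E : t n = v by rewrite t0.
have t2E : t (2 * n)%N = w by rewrite mul2n -addnn t1.
have t3E : t (3 * n)%N = u by rewrite mulSn addnC t2.
split; last 2 first.
- by rewrite /triangle_size t0E t1E t2E.
- rewrite /triangle_path (_ : (3 * n).+1 = 1 + (n + (n + n)))%N; last lia.
  rewrite !iotaD !map_cat /= t0E; congr (_ :: _ ++ _ ++ _).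
  + by apply/eq_in_map => i; rewrite mem_iota => /andP[_ ni]; rewrite t0.
  + rewrite add1n -addn1 iotaDl -map_comp; apply/eq_in_map => i.
    by rewrite mem_iota => /andP[_ ni] /=; rewrite t1.
  + rewrite (_ : (0 + 1 + n + n = 2 * n + 1)%N); last lia.
    rewrite iotaDl -map_comp; apply/eq_in_map => i.
    by rewrite mem_iota => /andP[_ ni] /=; rewrite t2.
- split; last 2 first.
  + by rewrite t3E t0E.
  + move=> [|[|[|//]]] i _ ni; rewrite ?mul0n ?mul1n ?add0n.
    * by rewrite t0E t1E t0//; have [] := hk u v.
    * by rewrite t1E t2E t1//; have [] := hk v w.
    * by rewrite t2E t3E t2//; have [] := hk w u.
  + move=> i i3; have [ni|ni] := ltnP i n.
      by rewrite !t0// 1?ltnW//; have [] := hk u v.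
    have [ni2|ni2] := ltnP i (2 * n)%N.
      rewrite -(subnKC ni) -addnS !t1; [by have [] := hk v w|lia|lia].
    rewrite -(subnKC ni2) -addnS !t2; [by have [] := hk w u|lia|lia].
Qed.

(** Each side is homotopic to an edge of the Rips complex of A, and the three
    edges bound a simplex. *)
Let triangle_filled (A : set X) s f n d r t :
  (forall x, A (f x)) -> (forall x, mdist x (f x) < s) ->
  (forall x, A x -> f x = x) -> 2 * (d + s) <= r -> triangle n d t ->
  A (t 0%N) -> A (t n) -> A (t (2 * n)%N) -> triangle_size n t < r ->
  triangle_null n (pullback f (Rips A r)) t.
Proof.
move=> fA fs fid dsr [ts t3 tb] A0 A1 A2.
rewrite !gt_max => /and3P[d01 d12 d02].
set K := pullback _ _.
have side j : (j < 3)%N -> A (t (j * n)%N) -> A (t (j.+1 * n)%N) ->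
    mdist (t (j * n)%N) (t (j.+1 * n)%N) < r ->
    edge_homotopic K (t (j * n)%N :: [seq t (j * n + i)%N | i <- iota 1 n])
      [:: t (j * n)%N; t (j.+1 * n)%N].
  move=> j3 Aj Aj1 jr; pose p i := t (j * n + i)%N.
  have p0 : p 0%N = t (j * n)%N by rewrite /p addn0.
  apply: (approx_chain fA fs fid dsr Aj Aj1 jr).
  - have hp m i : (i + m <= n)%N ->
        path (fun a b => mdist (p a) (p b) <= d) i (iota i.+1 m).
      elim: m i => //= m IH i im; rewrite IH ?andbT; last lia.
      by rewrite /p addnS; apply: ts; nia.
    by rewrite -{1}p0 (path_map (f := p)); exact: hp.
  - rewrite -{1}(addn0 (j * n)%N) (last_map (fun i => t (j * n + i)%N)).
    by rewrite last_iota1 mulSn addnC.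
  - by move=> x /mapP[i]; rewrite mem_iota => /andP[_ ni] ->; apply: tb; lia.
have A3 : A (t (3 * n)%N) by rewrite t3.
have := side 0%N isT; have := side 1%N isT; have := side 2%N isT.
rewrite mul0n mul1n => /(_ A2 A3) h2 /(_ A1 A2 d12) h1 /(_ A0 A1 d01) h0.
have {}h2 := h2 _; rewrite {1}t3 metric_sym in h2; have {}h2 := h2 d02.
rewrite /triangle_null.
have -> : triangle_path n t = (t 0%N :: [seq t (0 + i)%N | i <- iota 1 n]) ++
    [seq t (n + i)%N | i <- iota 1 n] ++ [seq t (2 * n + i)%N | i <- iota 1 n].
  rewrite /triangle_path (_ : (3 * n).+1 = 1 + (n + (n + n)))%N; last lia.
  rewrite !iotaD !map_cat /=; congr (_ :: _ ++ _ ++ _).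
  - by rewrite add1n -addn1 iotaDl -map_comp.
  - rewrite (_ : (0 + 1 + n + n = 2 * n + 1)%N); last lia.
    by rewrite iotaDl -map_comp.
apply: rst_trans (edge_homotopic_catr _ h0) _ => /=.
have {}h1 := edge_homotopic_cons (t 0%N) (edge_homotopic_catr
  [seq t (2 * n + i)%N | i <- iota 1 n] h1).
apply: rst_trans h1 _ => /=.
apply: rst_trans (edge_homotopic_catl [:: t 0%N; t n] h2) _ => /=; rewrite t3.
have tri u v w : A u -> A v -> A w -> mdist u v < r -> mdist v w < r ->
    mdist u w < r -> simplex K [set u; v; w].
  by move=> *; apply: approx_triangle; rewrite ?fid.
have r0 : 0 < r by exact: le_lt_trans (mdist_ge0 _ _) d01.
apply: rst_trans (edge_triangle _ (tri _ _ _ A0 A1 A2 d01 d12 d02)) _.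
apply: rst_trans (edge_repeat _ _ _); apply: edge_triangle.
by apply: tri => //; rewrite ?mdistxx// metric_sym.
Qed.

(** The set A consists of a finite s-dense set, x0 and the vertices of the
    minimal triangles.  A triangle of X of diameter less than r is equivalent to
    a minimal triangle of diameter less than r, which is filled in at scale r
    since its vertices are in A. *)
Lemma finite_approximation (s c : R) : 0 < s -> s < c / 2 ->
  exists A : set X, [/\ finite_set A, s_dense s A, A x0 &
    forall r, c <= r -> forall a : edge_loop (Rips A r) x0,
      edge_homotopic (Rips setT r) (x0 :: a) [:: x0] ->
      edge_homotopic (Rips A r) (x0 :: a) [:: x0]].
Proof.
(* steps of length d, with triangles compared at scale 2 d, so that
   2 (d + s) < c *)
move=> s0 sc; pose d := (c - 2 * s) / 4.
have dE : 4 * d = c - 2 * s by rewrite /d; lra.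
have d0 : 0 < d by lra.
have [M hM] := compact_mdist_bounded.
have [n [k hk]] := geodesic_subdivisions hgeo hM d0.
have [|F [fF FT hF]] := @minimal_triangles R X Xc n d (2 * d) (ltW d0).
  lra.
have [B fB sB] := finite_s_dense s0.
pose V i := (fun t : nat -> X => t (i * n)%N) @` F.
pose A := B `|` [set x0] `|` (V 0%N `|` V 1%N `|` V 2%N).
exists A; split.
- rewrite !finite_setU; do !split => //; try exact: finite_set1;
    exact: finite_image.
- by move=> x; have [y By xy] := sB x; exists y => //; left; left.
- by left; right.
have sA : s_dense s A.
  by move=> x; have [y By xy] := sB x; exists y => //; left; left.
have [f [fA fs fid]] := s_dense_retraction s0 sA.
move=> r cr; apply: (approx_incl_inj fA fs fid _ (d := d) (c := chain_seq n k)).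
- by left; right.
- lra.
- exact: geodesic_chains_seq.
move=> u v w uv vw uw; have [Tt tsz tp] := triangle_ofP u v w hk.
have [t' Ft' [le nul]] := hF _ Tt.
have t0 : triangle_of n k u v w 0%N = u.
  by rewrite /triangle_of /=; have [] := hk u v.
have := nul (pullback f (Rips A r)); rewrite /triangle_null tp t0.
apply; first by apply: (approx_rips fA fs); lra.
apply: (triangle_filled fA fs fid _ (FT _ Ft')); first lra.
- by right; left; left; exists t'.
- by right; left; right; exists t' => //; rewrite mul1n.
- by right; right; exists t'.
- by apply: le_lt_trans le _; rewrite tsz !gt_max uv vw uw.
Qed.

End FiniteApproximation.

(** * The persistence below the smallest critical value *)

Section Bonds.
Context {R : realType} {X : metricType R} (x0 : X).
Implicit Types (A : set X) (p q r : R).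

Lemma rips_bondE A p q (pq : p < q) (a : edge_loop (Rips A p) x0) :
  rips_bond x0 A pq (edge_class a) =
  edge_class (incl_edge_loop (Rips_subset (@subset_refl _ A) (ltW pq)) a).
Proof. exact: edge_pi1_inclE. Qed.

Lemma rips_inclE A r (a : edge_loop (Rips A r) x0) :
  rips_incl x0 A r (edge_class a) =
  edge_class (incl_edge_loop (Rips_subset (@subsetT _ A) (lexx r)) a).
Proof. exact: edge_pi1_inclE. Qed.

Lemma edge_pi1_surj (K : simplicial_complex X) (h : edge_pi1 K x0) :
  exists a : edge_loop K x0, h = edge_class a.
Proof. exact: gclass_surj. Qed.

Lemma rips_bond_comp A p q r (pq : p < q) (qr : q < r) (pr : p < r) :
  rips_bond x0 A pr =1 rips_bond x0 A qr \o rips_bond x0 A pq.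
Proof.
move=> h; have [a ->] := edge_pi1_surj h.
by rewrite /comp 3!rips_bondE; apply/edge_class_eq; exact: rst_refl.
Qed.

Lemma rips_incl_bond A p q (pq : p < q) h :
  rips_incl x0 A q (rips_bond x0 A pq h) =
  rips_bond x0 setT pq (rips_incl x0 A p h).
Proof.
have [a ->] := edge_pi1_surj h.
rewrite rips_bondE 2!rips_inclE rips_bondE.
by apply/edge_class_eq; exact: rst_refl.
Qed.

Lemma rips_inclT r h : rips_incl x0 setT r h = h.
Proof.
have [a ->] := edge_pi1_surj h; rewrite rips_inclE.
by apply/edge_class_eq; exact: rst_refl.
Qed.

End Bonds.

Lemma inj_surj_bijective (T U : Type) (f : T -> U) :
  injective f -> (forall y, exists x, f x = y) -> bijective f.
Proof.
by move=> fi /choice[g gf]; exists g => // x; apply: fi; rewrite gf.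
Qed.

Section BelowCritical.
Context {R : realType} {X : metricType R} (x0 : X).
Hypotheses (hgeo : geodesic X) (M : R) (hM : forall x y : X, mdist x y <= M).
Implicit Types p q r t : R.

Lemma rips_bond_surj p q (pq : p < q) : 0 < p ->
  forall h, exists g, rips_bond x0 [set: X] pq g = h.
Proof.
move=> p0; apply: edge_pi1_incl_surj => b.
apply: (@approx_bond_surj _ _ setT (p / 4) id _ _ _ x0 _ hgeo M hM) => //.
- by move=> x; rewrite mdistxx divr_gt0.
- lra.
- exact: ltW.
Qed.

Let bond_inj p q := forall pq : p < q, injective (rips_bond x0 [set: X] pq).

Let bond_inj_trans p q r : p < q -> q < r ->
  bond_inj p q -> bond_inj q r -> bond_inj p r.
Proof.
move=> pq qr ipq iqr pr g h.
by rewrite !(rips_bond_comp pq qr pr) => /iqr /ipq.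
Qed.

Let bond_inj_sub p p' q' q : 0 < p -> p < p' -> p' < q' -> q' < q ->
  bond_inj p q -> bond_inj p' q'.
Proof.
move=> p0 pp' p'q' q'q ipq pq' g h.
have pq := lt_trans pp' (lt_trans p'q' q'q).
have [g' <-] := rips_bond_surj pp' p0 g.
have [h' <-] := rips_bond_surj pp' p0 h.
move=> e; congr (_ _); apply: (ipq pq).
have E k : rips_bond x0 [set: X] pq k = rips_bond x0 [set: X] q'q
    (rips_bond x0 [set: X] pq' (rips_bond x0 [set: X] pp' k)).
  have p'q := lt_trans p'q' q'q.
  by rewrite (rips_bond_comp pp' p'q pq) /= (rips_bond_comp pq' q'q p'q).
by rewrite !E e.
Qed.

Let noncritical_inj t : 0 < t -> ~ critical_value x0 t ->
  exists2 q, 0 < q < t & exists2 r, t < r & bond_inj q r.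
Proof.
move=> t0 nt.
have [q [qt q0] bq] : exists2 q, q < t /\ 0 < q & bond_inj q t.
  apply: contrapT => hn; apply: nt; split=> //; left; exists t => // q qt q0 _ bij.
  apply: hn; exists q => // qt'; rewrite (bool_irrelevance qt' qt).
  exact: bij_inj.
have [r tr br] : exists2 r, t < r & bond_inj t r.
  apply: contrapT => hn; apply: nt; split=> //; right=> r tr bij.
  apply: hn; exists r => // tr'; rewrite (bool_irrelevance tr' tr).
  exact: bij_inj.
exists q; first by rewrite q0.
by exists r => //; exact: bond_inj_trans bq br.
Qed.

(** A non-critical value has a neighbourhood on which the bonding maps are
    injective, as surjectivity makes injectivity pass to smaller intervals.  So
    the infimum of the scales at which injectivity fails would be a critical
    value below c. *)
Lemma rips_bond_bijective c p q (pq : p < q) :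
  smallest_critical_value x0 c -> 0 < p -> q < c ->
  bijective (rips_bond x0 [set: X] pq).
Proof.
move=> [_ hc] p0 qc; apply: inj_surj_bijective; last exact: rips_bond_surj.
suff : bond_inj p q by exact.
apply: contrapT => nq; pose B := [set t | p < t /\ ~ bond_inj p t].
have Bq : B q by [].
have lB : has_lbound B by exists p => t [/ltW].
pose t := inf B.
have tq : t <= q by exact: ge_inf.
have pt : p <= t by apply: lb_le_inf; [exists q|move=> u [/ltW]].
have [||a /andP[a0 at_] [b tb ab]] := @noncritical_inj t.
- exact: lt_le_trans pt.
- by move=> /hc; rewrite leNgt (le_lt_trans tq qc).
have good u : t <= u -> u < b -> ~ B u.
  move=> tu ub [pu]; apply.
  have [tp|pt'] := leP t p.
    have {tp}tp : t = p by apply/eqP; rewrite eq_le tp pt.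
    by apply: (@bond_inj_sub a p u b) => //; rewrite -tp.
  have [p' p'1 p'2] : exists2 p', p' < t & Num.max a p < p'.
    exists ((Num.max a p + t) / 2); have : Num.max a p < t by rewrite gt_max at_.
      lra.
    lra.
  move: p'2; rewrite gt_max => /andP[ap' pp'].
  apply: (@bond_inj_trans p p' u) => //; first exact: lt_le_trans tu.
    apply: contrapT => np'; have : t <= p' by apply: ge_inf.
    by rewrite leNgt p'1.
  by apply: (@bond_inj_sub a p' u b) => //; exact: lt_le_trans tu.
suff : b <= t by rewrite leNgt tb.
apply: lb_le_inf; first by exists q.
move=> u Bu; rewrite leNgt; apply/negP => ub.
by apply: (good u _ ub Bu); exact: ge_inf.
Qed.

End BelowCritical.

(** * Paths up to homotopy *)

Section Paths.
Context {R : realType} {X : topologicalType}.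
Implicit Types (f g h : R -> X) (s t : R).

Definition path_homotopic f g : Prop :=
  exists H : R * R -> X,
    [/\ {within unit_square, continuous H},
        forall t, unit_itv t -> H (0, t) = f t /\ H (1, t) = g t &
        forall s, unit_itv s -> H (s, 0) = f 0 /\ H (s, 1) = f 1].

Let U0 : unit_itv (0 : R). Proof. by apply/unit_itvP; lra. Qed.
Let U1 : unit_itv (1 : R). Proof. by apply/unit_itvP; lra. Qed.

(** A square is convex, so curves in it with common ends are homotopic, and so
    are their images. *)
Lemma square_curves (H : R * R -> X) (a1 a2 b1 b2 : R -> R) f g :
  {within unit_square, continuous H} ->
  continuous a1 -> continuous a2 -> continuous b1 -> continuous b2 ->
  (forall t, unit_itv t -> [/\ unit_itv (a1 t), unit_itv (a2 t),
     unit_itv (b1 t) & unit_itv (b2 t)]) ->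
  a1 0 = b1 0 -> a2 0 = b2 0 -> a1 1 = b1 1 -> a2 1 = b2 1 ->
  (forall t, unit_itv t -> f t = H (a1 t, a2 t)) ->
  (forall t, unit_itv t -> g t = H (b1 t, b2 t)) ->
  path_homotopic f g.
Proof.
move=> cH ca1 ca2 cb1 cb2 ab e10 e20 e11 e21 fE gE.
exists (fun z => H ((1 - z.1) * a1 z.2 + z.1 * b1 z.2,
                    (1 - z.1) * a2 z.2 + z.1 * b2 z.2)); split.
- have conv (a b : R -> R) : continuous a -> continuous b ->
      continuous (fun z : R * R => (1 - z.1) * a z.2 + z.1 * b z.2).
    move=> ca cb z.
    have c1 : {for z, continuous (fst : R * R -> R)} by exact: cvg_fst.
    have c2 : {for z, continuous (snd : R * R -> R)} by exact: cvg_snd.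
    apply: cvgD; apply: cvgM => //.
    + by apply: cvgB => //; exact: cst_continuous.
    + by apply: continuous_comp => //; exact: ca.
    + by apply: continuous_comp => //; exact: cb.
  apply: (@within_comp _ _ _ unit_square unit_square H (fun z : R * R =>
    ((1 - z.1) * a1 z.2 + z.1 * b1 z.2, (1 - z.1) * a2 z.2 + z.1 * b2 z.2))) => //.
  + by apply: continuous_subspaceT; apply: continuous_pair; exact: conv.
  + by move=> [s t] /= [Us Ut]; have [? ? ? ?] := ab t Ut; split => /=;
      apply: unit_itv_conv.
- move=> t Ut /=; rewrite subr0 subrr !mul0r !mul1r !addr0 !add0r.
  by rewrite fE// gE.
- move=> s Us /=; rewrite -e10 -e20 -e11 -e21 -!mulrDl subrK !mul1r.
  by rewrite !fE.
Qed.

Lemma path_reparam (F : R -> X) (phi psi : R -> R) f g :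
  {within unit_itv, continuous F} -> continuous phi -> continuous psi ->
  (forall t, unit_itv t -> unit_itv (phi t) /\ unit_itv (psi t)) ->
  phi 0 = psi 0 -> phi 1 = psi 1 ->
  (forall t, unit_itv t -> f t = F (phi t)) ->
  (forall t, unit_itv t -> g t = F (psi t)) ->
  path_homotopic f g.
Proof.
move=> cF cphi cpsi U e0 e1 fE gE.
apply: (@square_curves (F \o snd) (cst 0) phi (cst 0) psi) => //.
- apply: (@within_comp _ _ _ unit_square unit_itv F snd) => //.
    by apply: continuous_subspaceT => z; exact: cvg_snd.
  by move=> z [].
- exact: cst_continuous.
- exact: cst_continuous.
- by move=> t /U[].
Qed.

Lemma path_homotopic_refl f : {within unit_itv, continuous f} ->
  path_homotopic f f.
Proof.
move=> cf; apply: (path_reparam (phi := id) (psi := id) cf) => //;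
  by move=> t; exact: cvg_id.
Qed.

Lemma path_homotopic_ends f g : path_homotopic f g -> g 0 = f 0 /\ g 1 = f 1.
Proof.
move=> [H [_ H01 Hx]]; have [a b] := Hx 1 U1.
by split; rewrite -1?a -1?b; [have [_ ->] := H01 0 U0|have [_ ->] := H01 1 U1].
Qed.

Lemma path_homotopic_sym f g : path_homotopic f g -> path_homotopic g f.
Proof.
move=> fg; have [e0 e1] := path_homotopic_ends fg.
move: fg => [H [cH H01 Hx]]; exists (fun z => H (1 - z.1, z.2)); split.
- apply: (@within_comp _ _ _ unit_square unit_square H
    (fun z : R * R => (1 - z.1, z.2))) => //.
  + apply: continuous_subspaceT; apply: continuous_pair => z.
      apply: cvgB; first exact: cst_continuous.
      exact: cvg_fst.
    exact: cvg_snd.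
  + move=> [s t] /unit_squareP[Us Ut]; apply/unit_squareP; split => /=; lra.
- by move=> t /H01 /=; rewrite subr0 subrr => -[-> ->].
- move=> s /unit_itvP Us /=; rewrite e0 e1; apply: Hx; apply/unit_itvP; lra.
Qed.

Lemma square_paste_fst (H K : R * R -> X) :
  {within unit_square, continuous H} -> {within unit_square, continuous K} ->
  (forall t, unit_itv t -> H (1, t) = K (0, t)) ->
  {within unit_square, continuous (fun z =>
     if z.1 <= 2^-1 then H (2 * z.1, z.2) else K (2 * z.1 - 1, z.2))}.
Proof.
move=> cH cK HK.
apply: (@within_paste _ _ [set z : R * R | z.1 <= 2^-1]
  [set z : R * R | 2^-1 <= z.1] _
  (fun z => H (2 * z.1, z.2)) (fun z => K (2 * z.1 - 1, z.2))).
- by apply: closed_le_comp => z; exact: cvg_fst.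
- by apply: closed_ge_comp => z; exact: cvg_fst.
- exact: closed_unit_square.
- by move=> z _ /=; apply/orP; exact: le_total.
- by move=> z _ /= ->.
- move=> [s t] [_ Ut] /= hs; case: ifPn => // hs'.
  have -> : s = 2^-1 by apply/eqP; rewrite eq_le hs hs'.
  by rewrite mulfV// subrr HK.
- apply: (@within_comp _ _ _ _ unit_square H
    (fun z : R * R => (2 * z.1, z.2))) => //.
    apply: continuous_subspaceT; apply: continuous_pair => z.
      apply: cvgM; first exact: cst_continuous.
      exact: cvg_fst.
    exact: cvg_snd.
  move=> [s t] [/unit_squareP[Us Ut] /= h2]; apply/unit_squareP; split => /=; lra.
- apply: (@within_comp _ _ _ _ unit_square K
    (fun z : R * R => (2 * z.1 - 1, z.2))) => //.
    apply: continuous_subspaceT; apply: continuous_pair => z.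
      apply: cvgB; last exact: cst_continuous.
      apply: cvgM; first exact: cst_continuous.
      exact: cvg_fst.
    exact: cvg_snd.
  move=> [s t] [/unit_squareP[Us Ut] /= h2]; apply/unit_squareP; split => /=; lra.
Qed.

Let swap_continuous_square (H : R * R -> X) :
  {within unit_square, continuous H} ->
  {within unit_square, continuous (fun z => H (z.2, z.1))}.
Proof.
move=> cH; apply: (@within_comp _ _ _ unit_square unit_square H
    (fun z : R * R => (z.2, z.1))) => //.
  apply: continuous_subspaceT; apply: continuous_pair => z.
    exact: cvg_snd.
  exact: cvg_fst.
by move=> [s t] [? ?]; split.
Qed.

Lemma square_paste_snd (H K : R * R -> X) :
  {within unit_square, continuous H} -> {within unit_square, continuous K} ->
  (forall s, unit_itv s -> H (s, 1) = K (s, 0)) ->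
  {within unit_square, continuous (fun z =>
     if z.2 <= 2^-1 then H (z.1, 2 * z.2) else K (z.1, 2 * z.2 - 1))}.
Proof.
move=> cH cK HK.
have := square_paste_fst (swap_continuous_square cH) (swap_continuous_square cK).
by move=> /(_ HK) /swap_continuous_square.
Qed.

Lemma path_homotopic_trans f g h :
  path_homotopic f g -> path_homotopic g h -> path_homotopic f h.
Proof.
move=> fg; have [e0 e1] := path_homotopic_ends fg.
move: fg => [H [cH H01 Hx]] [K [cK K01 Kx]].
exists (fun z => if z.1 <= 2^-1 then H (2 * z.1, z.2)
                 else K (2 * z.1 - 1, z.2)); split.
- by apply: square_paste_fst => // t Ut; rewrite (H01 t Ut).2 (K01 t Ut).1.
- move=> t Ut /=; rewrite !mulr0 invr_ge0 ler0n.
  rewrite ifN ?mulr1; last by rewrite -ltNge; lra.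
  rewrite (_ : 2 - 1 = 1 :> R); last lra.
  by rewrite (H01 t Ut).1 (K01 t Ut).2.
- move=> s /unit_itvP Us /=; case: ifPn => hs.
    by apply: Hx; apply/unit_itvP; lra.
  rewrite -ltNge in hs; rewrite -e0 -e1.
  by apply: Kx; apply/unit_itvP; lra.
Qed.

Definition cat_path_fun f g (t : R) : X :=
  if t <= 2^-1 then f (2 * t) else g (2 * t - 1).

Lemma cat_path_fun0 f g : cat_path_fun f g 0 = f 0.
Proof. by rewrite /cat_path_fun invr_ge0 ler0n mulr0. Qed.

Lemma cat_path_fun1 f g : cat_path_fun f g 1 = g 1.
Proof.
rewrite /cat_path_fun ifN; last by rewrite -ltNge; lra.
by congr (g _); lra.
Qed.

Let square_of f : {within unit_itv, continuous f} ->
  {within unit_square, continuous (f \o snd)}.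
Proof.
move=> cf; apply: (@within_comp _ _ _ unit_square unit_itv f snd) => //.
  by apply: continuous_subspaceT => z; exact: cvg_snd.
by move=> z [].
Qed.

Lemma cat_path_continuous f g : {within unit_itv, continuous f} ->
  {within unit_itv, continuous g} -> f 1 = g 0 ->
  {within unit_itv, continuous (cat_path_fun f g)}.
Proof.
move=> cf cg fg; have := square_paste_snd (square_of cf) (square_of cg).
move=> /(_ (fun _ _ => fg)) c.
apply: (@within_comp _ _ _ unit_itv unit_square _ (fun t : R => (0, t))) c.
  apply: continuous_subspaceT; apply: continuous_pair => t.
    exact: cst_continuous.
  exact: cvg_id.
by move=> t Ut; split.
Qed.

Lemma cat_path_homotopic f f' g g' : f 1 = g 0 ->
  path_homotopic f f' -> path_homotopic g g' ->
  path_homotopic (cat_path_fun f g) (cat_path_fun f' g').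
Proof.
move=> fg [H [cH H01 Hx]] [K [cK K01 Kx]].
exists (fun z => if z.2 <= 2^-1 then H (z.1, 2 * z.2)
                 else K (z.1, 2 * z.2 - 1)); split.
- by apply: square_paste_snd => // s Us; rewrite (Hx s Us).2 (Kx s Us).1.
- move=> t /unit_itvP Ut; rewrite /= /cat_path_fun; case: ifPn => ht.
    by apply: H01; apply/unit_itvP; lra.
  by rewrite -ltNge in ht; apply: K01; apply/unit_itvP; lra.
- move=> s Us /=; rewrite cat_path_fun0 cat_path_fun1.
  rewrite invr_ge0 ler0n ifN; last by rewrite -ltNge; lra.
  rewrite mulr0 mulr1 (_ : 2 - 1 = 1 :> R); last lra.
  by rewrite (Hx s Us).1 (Kx s Us).2.
Qed.

Let affine_continuous (a b : R) : continuous (fun t : R => a * t + b).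
Proof.
by move=> t; apply: cvgD; [apply: cvgM;
  [exact: cst_continuous|exact: cvg_id]|exact: cst_continuous].
Qed.

Let min_cont (f g : R -> R) : continuous f -> continuous g ->
  continuous (fun t => Num.min (f t) (g t)).
Proof. by move=> cf cg t; apply: continuous_min; [exact: cf|exact: cg]. Qed.

Let max_cont (f g : R -> R) : continuous f -> continuous g ->
  continuous (fun t => Num.max (f t) (g t)).
Proof. by move=> cf cg t; apply: continuous_max; [exact: cf|exact: cg]. Qed.

Lemma cat_path_cst f : {within unit_itv, continuous f} ->
  path_homotopic (cat_path_fun (cst (f 0)) f) f.
Proof.
move=> cf; apply: (path_reparam
  (phi := fun t => Num.max (0 * t + 0) (2 * t + (-1)))
  (psi := fun t => 1 * t + 0) cf) => //.
- exact: max_cont.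
- move=> t /unit_itvP Ut; split; apply/unit_itvP; last lra.
  by case: (leP (0 * t + 0) (2 * t + -1)); lra.
- by case: (leP (0 * 0 + 0 : R) (2 * 0 + -1)); lra.
- by case: (leP (0 * 1 + 0 : R) (2 * 1 + -1)); lra.
- move=> t _; rewrite /cat_path_fun mul0r addr0.
  case: (leP 0 (2 * t + -1)) => h; case: ifPn => // h'.
  + by rewrite /= (_ : 2 * t + -1 = 0)//; lra.
  + by exfalso; rewrite -?ltNge in h'; lra.
- by move=> t _; rewrite mul1r addr0.
Qed.

Lemma cat_pathA f g h : {within unit_itv, continuous f} ->
  {within unit_itv, continuous g} -> {within unit_itv, continuous h} ->
  f 1 = g 0 -> g 1 = h 0 ->
  path_homotopic (cat_path_fun f (cat_path_fun g h))
    (cat_path_fun (cat_path_fun f g) h).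
Proof.
move=> cf cg ch fg gh.
have cF : {within unit_itv, continuous (cat_path_fun f (cat_path_fun g h))}.
  by apply: cat_path_continuous; rewrite ?cat_path_fun0//;
    exact: cat_path_continuous.
apply: (path_reparam (phi := fun t => 1 * t + 0) (psi := fun t =>
  Num.min (Num.min (2 * t + 0) (1 * t + 4^-1)) (2^-1 * t + 2^-1)) cF) => //.
- by apply: min_cont => //; exact: min_cont.
- move=> t /unit_itvP Ut; split; apply/unit_itvP; first lra.
  by rewrite /Num.min; do ?case: ifPn; rewrite -?leNgt; lra.
- by rewrite /Num.min; do ?case: ifPn; rewrite -?leNgt; lra.
- by rewrite /Num.min; do ?case: ifPn; rewrite -?leNgt; lra.
- by move=> t _; rewrite mul1r addr0.
- move=> t /unit_itvP Ut; set m := Num.min _ _.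
  have mE : m = if t <= 2^-1 then if 2 * t <= 2^-1 then 2 * t else t + 4^-1
                else 2^-1 * t + 2^-1.
    by rewrite /m /Num.min; do !case: ifPn; rewrite -?leNgt -?ltNge; lra.
  rewrite mE /cat_path_fun; case: (leP t 2^-1) => ht; last first.
    rewrite ifN; last by rewrite -ltNge; lra.
    rewrite ifN; last by rewrite -ltNge; lra.
    by congr (h _); lra.
  case: (leP (2 * t) 2^-1) => ht'; first by rewrite ht'.
  rewrite ifN; last by rewrite -ltNge; lra.
  rewrite ifT; last lra.
  by congr (g _); lra.
Qed.

Definition subpath f (a b : R) : R -> X := fun t => f (a + (b - a) * t).

Let subpath_itv (a b t : R) : unit_itv a -> unit_itv b -> unit_itv t ->
  unit_itv (a + (b - a) * t).
Proof. by move=> /unit_itvP ? /unit_itvP ? /unit_itvP ?; apply/unit_itvP; nra. Qed.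

Lemma subpath_continuous f a b : {within unit_itv, continuous f} ->
  unit_itv a -> unit_itv b -> {within unit_itv, continuous (subpath f a b)}.
Proof.
move=> cf Ua Ub; apply: (@within_comp _ _ _ unit_itv unit_itv f
    (fun t : R => a + (b - a) * t)) => //; last by move=> t; exact: subpath_itv.
apply: continuous_subspaceT => t; under eq_fun do rewrite addrC.
exact: affine_continuous.
Qed.

Lemma subpath_cat f a b c : {within unit_itv, continuous f} ->
  unit_itv a -> unit_itv b -> unit_itv c ->
  path_homotopic (subpath f a c) (cat_path_fun (subpath f a b) (subpath f b c)).
Proof.
move=> cf Ua Ub Uc; apply: (path_reparam (phi := fun t => (c - a) * t + a)
  (psi := fun t => (b - a) * Num.min (2 * t + 0) (0 * t + 1) +
     ((c - b) * Num.max (2 * t + -1) (0 * t + 0) + a)) cf) => //.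
- have c1 : continuous (fun t : R => Num.min (2 * t + 0) (0 * t + 1)).
    exact: min_cont.
  have c2 : continuous (fun t : R => Num.max (2 * t + -1) (0 * t + 0)).
    exact: max_cont.
  move=> t; apply: cvgD; [|apply: cvgD; last exact: cst_continuous];
    (apply: cvgM; first exact: cst_continuous).
  + exact: c1.
  + exact: c2.
- move=> t Ut; split; first by rewrite addrC; exact: subpath_itv.
  move: Ut => /unit_itvP Ut; case: (leP (2 * t + 0) (0 * t + 1)) => h1;
    case: (leP (2 * t + -1) (0 * t + 0)) => h2.
  + have -> : (b - a) * (2 * t + 0) + ((c - b) * (0 * t + 0) + a) =
      a + (b - a) * (2 * t) by ring.
    by apply: subpath_itv => //; apply/unit_itvP; lra.
  + have -> : t = 2^-1 by lra.
    have -> : (b - a) * (2 * 2^-1 + 0) + ((c - b) * (2 * 2^-1 + -1) + a) = b.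
      by rewrite divff// subrr; lra.
    by [].
  + by exfalso; lra.
  + have -> : (b - a) * (0 * t + 1) + ((c - b) * (2 * t + -1) + a) =
      b + (c - b) * (2 * t + -1) by ring.
    by apply: subpath_itv => //; apply/unit_itvP; lra.
- by case: leP => h1; case: leP => h2; lra.
- by case: leP => h1; case: leP => h2; lra.
- by move=> t _; rewrite /subpath addrC.
- move=> t _; rewrite /cat_path_fun /subpath; case: ifPn => ht.
    case: (leP (2 * t + 0) (0 * t + 1)) => h1; last by exfalso; lra.
    case: (leP (2 * t + -1) (0 * t + 0)) => h2; last by exfalso; lra.
    by congr (f _); ring.
  rewrite -ltNge in ht.
  case: (leP (2 * t + 0) (0 * t + 1)) => h1; first by exfalso; lra.
  case: (leP (2 * t + -1) (0 * t + 0)) => h2; first by exfalso; lra.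
  by congr (f _); ring.
Qed.

(** The null-homotopy of the loop e p q^-1 e^-1 is a square with one side mapped
    by the loop and the other three sides to a point.  The arc of its boundary
    mapped by p has a complementary arc, which goes back along e, around the
    three constant sides, and then along e and q.  By convexity of the square
    the two arcs give homotopic paths. *)
Lemma lasso_homotopic (e p q : R -> X) (L : loop R (e 0)) :
  {within unit_itv, continuous e} -> {within unit_itv, continuous q} ->
  e 1 = q 0 -> p 1 = q 1 ->
  (forall t, unit_itv t -> L t = cat_path_fun (cat_path_fun e p)
     (fun t => cat_path_fun e q (1 - t)) t) ->
  loop_homotopic L (cst_loop (e 0)) -> e 1 = p 0 ->
  path_homotopic p q.
Proof.
move=> ce cq eq0 pq1 LE [H [cH H01 Hx]] ep0.
have cQ : {within unit_itv, continuous (cat_path_fun e q)}.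
  exact: cat_path_continuous.
have hp t : unit_itv t -> p t = H (0, 4^-1 * t + 4^-1).
  move=> /unit_itvP Ut; rewrite (H01 _ _).1; last by apply/unit_itvP; lra.
  rewrite LE; last by apply/unit_itvP; lra.
  rewrite {1}/cat_path_fun ifT; last lra.
  rewrite /cat_path_fun; case: ifPn => ht; last by congr (p _); lra.
  have -> : t = 0 by lra.
  by rewrite -ep0; congr (e _); lra.
have hQ u : unit_itv u -> H (0, 1 - 2^-1 * u) = cat_path_fun e q u.
  move=> /unit_itvP Uu; rewrite (H01 _ _).1; last by apply/unit_itvP; lra.
  rewrite LE; last by apply/unit_itvP; lra.
  rewrite {1}/cat_path_fun; case: ifPn => hu; last by congr cat_path_fun; lra.
  have {hu}-> : u = 1 by lra.
  rewrite cat_path_fun1 -pq1 -(cat_path_fun1 e p).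
  by congr cat_path_fun; lra.
have he u : unit_itv u -> H (0, 2^-1 * u) = cat_path_fun e p u.
  move=> /unit_itvP Uu; rewrite (H01 _ _).1; last by apply/unit_itvP; lra.
  rewrite LE; last by apply/unit_itvP; lra.
  by rewrite {1}/cat_path_fun ifT; [congr cat_path_fun; lra|lra].
(* k m t is 5 t - m clamped to [0, 1]: it moves from 0 to 1 while t moves from
   m / 5 to (m + 1) / 5; b1 and b2 are the coordinates of the complementary
   arc, and phi is the position reached on the path e q *)
pose k (m : R) t := Num.max (0 * t + 0) (Num.min (5 * t + - m) (0 * t + 1)) : R.
have ck m : continuous (k m) by apply: max_cont => //; exact: min_cont.
have k0 m t : 5 * t <= m -> k m t = 0.
  by move=> h; rewrite /k !mul0r !add0r max_l// ge_min subr_le0 h.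
have k1 m t : m + 1 <= 5 * t -> k m t = 1.
  by move=> h; rewrite /k !mul0r !add0r min_r ?max_r//; lra.
have km m t : m <= 5 * t <= m + 1 -> k m t = 5 * t - m.
  by move=> h; rewrite /k !mul0r !add0r min_l ?max_r//; lra.
pose b1 t := k 1 t - k 3 t.
pose b2 t := 4^-1 - 4^-1 * k 0 t + (k 2 t - 2^-1 * k 4 t).
pose phi t := 2^-1 - 2^-1 * k 0 t + k 4 t.
have cM (a : R) m : continuous (fun t => a * k m t).
  by move=> t; apply: cvgM; [exact: cst_continuous|exact: ck].
have cb1 : continuous b1 by move=> t; apply: cvgB; exact: ck.
have cb2 : continuous b2.
  move=> t; apply: cvgD; apply: cvgB; [exact: cst_continuous|exact: cM|exact: ck|].
  exact: cM.
have cphi : continuous phi.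
  by move=> t; apply: cvgD; [apply: cvgB; [exact: cst_continuous|exact: cM]|exact: ck].
have bE t : unit_itv t -> [\/ [/\ 0 <= t <= 1 / 5, b1 t = 0,
       b2 t = 4^-1 - 5 / 4 * t & phi t = 2^-1 - 5 / 2 * t],
     [/\ 1 / 5 <= t <= 2 / 5, b1 t = 5 * t - 1, b2 t = 0 & phi t = 0],
     [/\ 2 / 5 <= t <= 3 / 5, b1 t = 1, b2 t = 5 * t - 2 & phi t = 0] |
     [/\ 3 / 5 <= t <= 4 / 5, b1 t = 4 - 5 * t, b2 t = 1 & phi t = 0] \/
     [/\ 4 / 5 <= t <= 1, b1 t = 0, b2 t = 3 - 5 / 2 * t & phi t = 5 * t - 4]].
  move=> /unit_itvP t01; rewrite /b1 /b2 /phi.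
  have [h1|h1] := leP t (1 / 5).
    have [-> -> -> -> ->] : [/\ k 0 t = 5 * t - 0, k 1 t = 0, k 2 t = 0, k 3 t = 0
        & k 4 t = 0].
      by split; [apply: km|apply: k0|apply: k0|apply: k0|apply: k0]; lra.
    apply: Or41; split; lra.
  have [h2|h2] := leP t (2 / 5).
    have [-> -> -> -> ->] : [/\ k 0 t = 1, k 1 t = 5 * t - 1, k 2 t = 0, k 3 t = 0
        & k 4 t = 0].
      by split; [apply: k1|apply: km|apply: k0|apply: k0|apply: k0]; lra.
    apply: Or42; split; lra.
  have [h3|h3] := leP t (3 / 5).
    have [-> -> -> -> ->] : [/\ k 0 t = 1, k 1 t = 1, k 2 t = 5 * t - 2, k 3 t = 0
        & k 4 t = 0].
      by split; [apply: k1|apply: k1|apply: km|apply: k0|apply: k0]; lra.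
    apply: Or43; split; lra.
  apply: Or44; have [h4|h4] := leP t (4 / 5).
    have [-> -> -> -> ->] : [/\ k 0 t = 1, k 1 t = 1, k 2 t = 1, k 3 t = 5 * t - 3
        & k 4 t = 0].
      by split; [apply: k1|apply: k1|apply: k1|apply: km|apply: k0]; lra.
    left; split; lra.
  have [-> -> -> -> ->] : [/\ k 0 t = 1, k 1 t = 1, k 2 t = 1, k 3 t = 1
      & k 4 t = 5 * t - 4].
    by split; [apply: k1|apply: k1|apply: k1|apply: k1|apply: km]; lra.
  right; split; lra.
have b0 : [/\ b1 0 = 0, b2 0 = 4^-1 & phi 0 = 2^-1].
  by rewrite /b1 /b2 /phi; split; rewrite !k0; lra.
have b1' : [/\ b1 1 = 0, b2 1 = 2^-1 & phi 1 = 1].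
  by rewrite /b1 /b2 /phi; split; rewrite !k1; lra.
apply: (path_homotopic_trans (g := cat_path_fun e q \o phi)).
  apply: (square_curves (a1 := cst 0) (a2 := fun t => 4^-1 * t + 4^-1) (b1 := b1)
    (b2 := b2) cH) => //.
  - exact: cst_continuous.
  - move=> t Ut; have [[]|[]|[]|[[]|[]]] := bE t Ut; move=> h -> -> _;
      move: Ut => /unit_itvP Ut; split; apply/unit_itvP; rewrite /=; lra.
  - by case: b0.
  - by case: b0 => _ -> _; lra.
  - by case: b1'.
  - by case: b1' => _ -> _; lra.
  - move=> t Ut /=.
    have e0 : cat_path_fun e q 0 = e 0 by rewrite cat_path_fun0.
    have [[]|[]|[]|[[]|[]]] := bE t Ut; move=> h -> -> ->; rewrite ?e0.
    + rewrite (_ : 4^-1 - 5 / 4 * t = 2^-1 * (2^-1 - 5 / 2 * t)); last lra.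
      rewrite he; last by apply/unit_itvP; lra.
      by rewrite /cat_path_fun !ifT//; lra.
    + by rewrite (Hx _ _).1 ?loop0//; apply/unit_itvP; lra.
    + by rewrite (H01 _ _).2//; apply/unit_itvP; lra.
    + by rewrite (Hx _ _).2 ?loop0//; apply/unit_itvP; lra.
    + rewrite -hQ; last by apply/unit_itvP; lra.
      by congr (H (_, _)); lra.
apply: (path_reparam (phi := phi) (psi := fun t => 2^-1 * t + 2^-1) cQ) => //.
- move=> t Ut; have [[]|[]|[]|[[]|[]]] := bE t Ut; move=> h _ _ ->;
    move: Ut => /unit_itvP Ut; split; apply/unit_itvP; lra.
- by case: b0 => _ _ ->; lra.
- by case: b1' => _ _ ->; lra.
- move=> t /unit_itvP Ut; rewrite /cat_path_fun; case: ifPn => ht; last first.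
    by congr (q _); lra.
  have -> : t = 0 by lra.
  by rewrite -eq0; congr (e _); lra.
Qed.

End Paths.

(** * Short paths in a semi-locally simply-connected space *)

Section ShortPaths.
Context {R : realType} {X : metricType R}.
Hypotheses (Xc : compact [set: X]) (hgeo : geodesic X).
Hypothesis hslsc : semilocally_simply_connected R X.
Implicit Types (p q : R -> X) (r : R).

Definition short_paths_homotopic r : Prop := forall p q,
  {within unit_itv, continuous p} -> {within unit_itv, continuous q} ->
  p 0 = q 0 -> p 1 = q 1 ->
  (forall t, unit_itv t -> mdist (p 0) (p t) < r /\ mdist (p 0) (q t) < r) ->
  path_homotopic p q.

Let U0 : unit_itv (0 : R). Proof. by apply/unit_itvP; lra. Qed.
Let U1 : unit_itv (1 : R). Proof. by apply/unit_itvP; lra. Qed.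

Let short_from r (x : X) : Prop := forall p q,
  {within unit_itv, continuous p} -> {within unit_itv, continuous q} ->
  p 0 = x -> p 0 = q 0 -> p 1 = q 1 ->
  (forall t, unit_itv t -> mdist x (p t) < r /\ mdist x (q t) < r) ->
  path_homotopic p q.

(** The hypothesis concerns loops at y only, so two paths near y with common
    ends are first joined to y by a geodesic. *)
Let short_at y : \forall x \near (y : X) & r \near (0 : R)^'+, short_from r x.
Proof.
have [U /nbhs_ballP[e /= e0 eU] hU] := hslsc y.
have e2 : 0 < e / 2 by rewrite divr_gt0.
exists (ball y (e / 2), [set r | r < e / 2]).
  by split => /=; [exact: nbhsx_ballx|exact: nbhs_right_lt].
move=> [x r] /= [yx re] p q cp cq p0 pq0 pq1 pq.
rewrite ballEmdist /= in yx.
have [g [cg g0 g1 glen]] := hgeo y x.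
have near t : mdist x t < r -> U t.
  move=> xt; apply: eU; rewrite ballEmdist /=.
  by have := metric_triangle y x t; lra.
have gU t : unit_itv t -> U (g t).
  move=> Ut; apply: eU; rewrite ballEmdist /=.
  have := @geodesic_mdist_le _ _ g 0 t; rewrite g0 g1 => /(_ glen U0 Ut).
  lra.
have catU f h t : (forall t, unit_itv t -> U (f t)) ->
    (forall t, unit_itv t -> U (h t)) -> unit_itv t -> U (cat_path_fun f h t).
  move=> fU hU' /unit_itvP Ut; rewrite /cat_path_fun; case: ifPn => ht.
    by apply: fU; apply/unit_itvP; lra.
  by rewrite -ltNge in ht; apply: hU'; apply/unit_itvP; lra.
have gp0 : g 1 = p 0 by rewrite g1 p0.
have gq0 : g 1 = q 0 by rewrite gp0.
have cgq : {within unit_itv, continuous (cat_path_fun g q)}.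
  exact: cat_path_continuous.
pose l := cat_path_fun (cat_path_fun g p) (fun t => cat_path_fun g q (1 - t)).
have cl : {within unit_itv, continuous l}.
  apply: cat_path_continuous; first exact: cat_path_continuous.
    apply: (@within_comp _ _ _ unit_itv unit_itv _ (fun t : R => 1 - t)) cgq.
      apply: continuous_subspaceT => t; apply: cvgB.
        exact: cst_continuous.
      exact: cvg_id.
    by move=> t /unit_itvP Ut; apply/unit_itvP; lra.
  by rewrite cat_path_fun1 subr0 cat_path_fun1.
have l0 : l 0 = g 0 by rewrite /l !cat_path_fun0.
have l1 : l 1 = g 0 by rewrite /l cat_path_fun1 subrr cat_path_fun0.
apply: (@lasso_homotopic _ _ g p q (Loop cl l0 l1)) => //.
apply/(gclass_eq (loop_upto R (g 0))).
subst y; apply: (hU (Loop cl l0 l1)) => t Ut /=; apply: (catU) => //.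
  by move=> u Uu; apply: (catU) => // v Uv; apply: (near); have [] := pq v Uv.
move=> u /unit_itvP Uu; apply: (catU) => //; last by apply/unit_itvP; lra.
by move=> v Uv; apply: (near); have [] := pq v Uv.
Qed.

(** The local statement at the points of a compact space gives a uniform one. *)
Lemma short_paths : exists2 r, 0 < r & short_paths_homotopic r.
Proof.
have /compact_near_coveringP cov := Xc.
have h : \forall r \near (0 : R)^'+, [set: X] `<=` short_from r.
  by apply: cov => x _; exact: short_at.
have [r [r0 hr]] := filter_ex (filterI (nbhs_right_gt (0 : R)) h).
by exists r => // p q cp cq pq0 pq1 pq; exact: (hr (p 0)).
Qed.

End ShortPaths.

(** * Realising edge paths by geodesics *)

Section Realization.
Context {R : realType} {X : metricType R} (geo : X -> X -> R -> X).
Hypothesis geoP : forall u w, [/\ {within unit_itv, continuous (geo u w)},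
  geo u w 0 = u, geo u w 1 = w & path_length 0 1 (geo u w) = (mdist u w)%:E].
Implicit Types (u v w : X) (a b : seq X).

Let geoc u w : {within unit_itv, continuous (geo u w)}.
Proof. by have [] := geoP u w. Qed.
Let geo0 u w : geo u w 0 = u. Proof. by have [] := geoP u w. Qed.
Let geo1 u w : geo u w 1 = w. Proof. by have [] := geoP u w. Qed.

Lemma geo_mdist u w (s t : R) : unit_itv s -> unit_itv t ->
  mdist (geo u w s) (geo u w t) <= mdist u w.
Proof.
have [_ g0 g1 gl] := geoP u w => Us Ut.
by have := @geodesic_mdist_le _ _ (geo u w) s t; rewrite g0 g1; apply.
Qed.

Fixpoint realize u a : R -> X :=
  if a is v :: a' then cat_path_fun (geo u v) (realize v a') else cst u.

Lemma realize0 u a : realize u a 0 = u.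
Proof. by case: a => //= v a; rewrite cat_path_fun0 geo0. Qed.

Lemma realize1 u a : realize u a 1 = last u a.
Proof. by elim: a u => //= v a IH u; rewrite cat_path_fun1 IH. Qed.

Lemma realize_continuous u a : {within unit_itv, continuous (realize u a)}.
Proof.
elim: a u => /= [|v a IH] u; first exact: cst_loop_continuous.
by apply: cat_path_continuous; rewrite ?geo1 ?realize0.
Qed.

Variable r : R.
Hypothesis short : short_paths_homotopic (X := X) (2 * r).

Let unit0 : unit_itv (0 : R). Proof. by apply/unit_itvP; lra. Qed.
Let unit1 : unit_itv (1 : R). Proof. by apply/unit_itvP; lra. Qed.

Let geo_near u w (t : R) : unit_itv t -> mdist u (geo u w t) <= mdist u w.
Proof. by move=> Ut; have := geo_mdist u w unit0 Ut; rewrite geo0. Qed.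

Lemma realize_repeat u a :
  0 < r -> path_homotopic (realize u (u :: a)) (realize u a).
Proof.
move=> r0 /=; apply: path_homotopic_trans (cat_path_homotopic _ _ _) _.
- by rewrite geo1 realize0.
- apply: (short (q := cst u)) => //; rewrite ?geo0 ?geo1//.
    exact: cst_loop_continuous.
  move=> t Ut; rewrite /= mdistxx.
  have := geo_near u u Ut; rewrite mdistxx; lra.
- by apply: path_homotopic_refl; exact: realize_continuous.
- rewrite -{1}(realize0 u a); apply: cat_path_cst; exact: realize_continuous.
Qed.

Lemma realize_triangle u v w a : mdist u v < r -> mdist v w < r ->
  mdist u w < r ->
  path_homotopic (realize u [:: v, w & a]) (realize u (w :: a)).
Proof.
move=> uv vw uw /=.
apply: path_homotopic_trans (cat_pathA _ _ _ _ _) _ => //; rewrite ?geo0 ?geo1 ?realize0//.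
  exact: realize_continuous.
apply: cat_path_homotopic; rewrite ?cat_path_fun1 ?geo1 ?realize0//; last first.
  by apply: path_homotopic_refl; exact: realize_continuous.
apply: short => //; rewrite ?cat_path_fun0 ?cat_path_fun1 ?geo0 ?geo1//.
  by apply: cat_path_continuous; rewrite ?geo0 ?geo1.
have uw0 := mdist_ge0 u w.
move=> t Ut; split; last by have := geo_near u w Ut; lra.
rewrite /cat_path_fun; move: Ut => /unit_itvP Ut; case: ifPn => ht.
  have Ut' : unit_itv (2 * t) by apply/unit_itvP; lra.
  by have := geo_near u v Ut'; have := mdist_ge0 u v; lra.
rewrite -ltNge in ht; have Ut' : unit_itv (2 * t - 1) by apply/unit_itvP; lra.
have := geo_near v w Ut'; have := metric_triangle u v (geo v w (2 * t - 1)).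
lra.
Qed.

(** Edge homotopies are between vertex sequences, among them the empty one,
    which has no realization but is not homotopic to any other. *)
Definition realize_homotopic a b : Prop :=
  match a, b with
  | u :: a', v :: b' => path_homotopic (realize u a') (realize v b')
  | [::], [::] => True
  | _, _ => False
  end.

(** An edge move replaces a short subpath of the realization by another one with
    the same ends. *)
Lemma realize_edge_homotopic a b : 0 < r ->
  edge_homotopic (Rips setT r) a b -> realize_homotopic a b.
Proof.
move=> r0.
have catl p u v c d : path_homotopic (realize u c) (realize v d) ->
    realize_homotopic (p ++ u :: c) (p ++ v :: d).
  move=> h; elim: p => [|x p] //=; case: p => [|y p] /= IH.
    have [e0 _] := path_homotopic_ends h; rewrite !realize0 in e0; subst v.
    by apply: cat_path_homotopic => //; rewrite ?geo1 ?realize0//;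
      exact: path_homotopic_refl.
  by apply: cat_path_homotopic => //; rewrite ?geo1 ?realize0//;
    exact: path_homotopic_refl.
elim=> [{}a {}b []|{}a|{}a {}b _|{}a {}b c _ IH1 _ IH2].
- by move=> p u q; apply: catl; exact: realize_repeat.
- move=> p u v w q /rips_triangleP[_ _ _ [uv vw uw]].
  by apply: catl; exact: realize_triangle.
- case: a => //= u a; apply: path_homotopic_refl; exact: realize_continuous.
- by case: a b => [|u a] [|v b] //=; exact: path_homotopic_sym.
- by case: a b c IH1 IH2 => [|u a] [|v b] [|w c] //=; exact: path_homotopic_trans.
Qed.

(** Each piece of a finely subdivided path is short, hence homotopic to the
    geodesic between its ends. *)
Lemma subpath_realize (f : R -> X) (x : R) (l : seq R) :
  {within unit_itv, continuous f} -> unit_itv x -> last x l = 1 ->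
  path (fun y z : R => `[< [/\ y <= z, unit_itv z &
    forall s t, y <= s <= z -> y <= t <= z -> mdist (f s) (f t) < r] >]) x l ->
  path_homotopic (subpath f x 1) (realize (f x) (map f l)).
Proof.
move=> cf; elim: l x => [|y l IH] x Ux /=.
  move=> -> _; have e : subpath f 1 1 = cst (f 1).
    by apply/funext => t; rewrite /subpath subrr mul0r addr0.
  by rewrite e; apply: path_homotopic_refl; exact: cst_loop_continuous.
move=> yl /andP[/asboolP[xy Uy hr] hl].
have s0 : subpath f x y 0 = f x by rewrite /subpath mulr0 addr0.
have s1 : subpath f x y 1 = f y by rewrite /subpath mulr1 addrC subrK.
have s0' : subpath f y 1 0 = f y by rewrite /subpath mulr0 addr0.
apply: path_homotopic_trans (subpath_cat cf Ux Uy unit1) _.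
apply: cat_path_homotopic (IH _ Uy yl hl); first by rewrite s0' s1.
apply: short; rewrite ?s0 ?s1 ?geo0 ?geo1//; first exact: subpath_continuous.
have xx : x <= x <= y by rewrite lexx.
have yy : x <= y <= y by rewrite lexx xy.
have fxy := hr _ _ xx yy.
move=> t Ut; split; last first.
  by have := geo_near (f x) (f y) Ut; have := mdist_ge0 (f x) (f y); lra.
have := mdist_ge0 (f x) (f y); rewrite /subpath.
have := hr x (x + (y - x) * t) xx; move: Ut => /unit_itvP Ut.
have h : x <= x + (y - x) * t <= y by nra.
by move=> /(_ h); lra.
Qed.

End Realization.

(** * Subdividing loops *)

Section Subdivision.
Context {R : realType} {X : metricType R}.
Implicit Types (r x y z : R) (f : R -> X) (s : seq R).

Definition fine_step r f x y : Prop :=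
  [/\ 0 <= x, x <= y, y <= 1 & (diam (f @` `[x, y]) < r%:E)%E].

Definition fine_rel r f : rel R := fun x y => `[< fine_step r f x y >].

Lemma fine_step_mdist r f x y t u : fine_step r f x y ->
  x <= t <= y -> x <= u <= y -> mdist (f t) (f u) < r.
Proof.
move=> [_ _ _ d] ht hu; apply: mdist_lt_diam d _ _.
  by exists t => //=; rewrite in_itv.
by exists u => //=; rewrite in_itv.
Qed.

Lemma fine_step_sub r f x y x' y' : fine_step r f x y ->
  x <= x' -> x' <= y' -> y' <= y -> fine_step r f x' y'.
Proof.
move=> [x0 xy y1 d] h1 h2 h3; split; [lra|lra|lra|].
apply: le_lt_trans d; apply: diam_subset => _ [t /= ht <-]; exists t => //=.
by move: ht; rewrite !in_itv /= => /andP[? ?]; lra.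
Qed.

Lemma fine_triangle r f x y z : fine_step r f x z -> x <= y <= z ->
  simplex (Rips setT r) [set f x; f y; f z].
Proof.
move=> h /andP[xy yz]; have xz := le_trans xy yz.
by apply: rips_triangle => //; apply: fine_step_mdist h _ _;
  rewrite ?lexx ?xy ?yz ?xz.
Qed.

Lemma lt_path_le_last x s : path <%R x s -> x <= last x s.
Proof.
by elim: s x => //= y s IH x /andP[xy /IH]; exact: le_trans (ltW xy).
Qed.

(* 1 is appended to the subdivision to treat the last step like the others *)
Lemma fine_path_subdivision r f s a : path <%R a s -> 0 <= a ->
  last a s <= 1 ->
  (forall i, (i < size s)%N ->
     (diam (f @` `[nth 0%R (a :: s) i, nth 0%R (a :: s) i.+1]) < r%:E)%E) ->
  (diam (f @` `[last a s, 1%R]) < r%:E)%E -> path (fine_rel r f) a (rcons s 1).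
Proof.
elim: s a => [|b s IH] a /=; first by move=> _ a0 a1 _ d; rewrite andbT; apply/asboolP.
move=> /andP[ab bs] a0 s1 hs d; have b1 := le_trans (lt_path_le_last bs) s1.
apply/andP; split.
  by apply/asboolP; split => //; [exact: ltW|exact: (hs 0%N)].
apply: IH => //; first exact: le_trans a0 (ltW ab).
by move=> i is_; exact: (hs i.+1).
Qed.

Lemma fine_subdivisionP r f s : fine_subdivision r f s <->
  [/\ path <%R 0 s, last 0 s <= 1 & path (fine_rel r f) 0 (rcons s 1)].
Proof.
split=> [[s0 s1 hs h1]|[s0 s1]].
  by split => //; apply: fine_path_subdivision.
rewrite rcons_path => /andP[/(pathP 0) hs /asboolP[_ _ _ h1]]; split => //.
by move=> i /hs /asboolP[].
Qed.

(** A vertex inserted into the edge path spans a triangle with the step that it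
    subdivides. *)
Lemma fine_refine r f e s' s a : path (fine_rel r f) a (rcons s e) ->
  subseq s s' -> path <=%R a (rcons s' e) ->
  path (fine_rel r f) a (rcons s' e) /\
  edge_homotopic (Rips setT r) (map f (a :: rcons s' e)) (map f (a :: rcons s e)).
Proof.
elim: s' s a => [|b s' IH] s a /=.
  by move=> h /eqP sE _; subst s; split => //; exact: rst_refl.
have ins : path (fine_rel r f) a (rcons s e) -> subseq s s' ->
    (a <= b) && path <=%R b (rcons s' e) ->
    fine_rel r f a b && path (fine_rel r f) b (rcons s' e) /\
    edge_homotopic (Rips setT r) [:: f a, f b & map f (rcons s' e)]
      (f a :: map f (rcons s e)).
  move=> hs ss' /andP[ab bs'].
  have [c [l [sE cin]]] : exists c l, rcons s e = c :: l /\ c \in rcons s' e.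
    case: s ss' {hs} => [|c s] ss'; first by exists e, [::]; rewrite mem_rcons mem_head.
    exists c, (rcons s e); split => //; rewrite mem_rcons inE.
    by rewrite (mem_subseq ss') ?mem_head ?orbT.
  have bc : b <= c by have /allP := order_path_min le_trans bs'; apply.
  move: hs; rewrite sE /= => /andP[/asboolP ac cl].
  have [ab' bc'] : fine_step r f a b /\ fine_step r f b c.
    by split; apply: fine_step_sub ac _ _ _ => //; exact: le_trans bc.
  have [|h1 h2] := IH s b _ ss' bs'.
    by rewrite sE /= cl andbT; apply/asboolP.
  split; first by rewrite h1 andbT; apply/asboolP.
  apply: rst_trans (edge_homotopic_cons _ h2) _; rewrite sE /=.
  by apply: edge_triangle; apply: fine_triangle ac _; rewrite ab.
case: s ins => [|c s] ins hs; first by move=> _; exact: (ins hs (sub0seq _)).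
case: eqP => [<-|_]; last exact: (ins hs).
move=> ss' /andP[cb bs']; move: hs => /= /andP[ac cs].
have [h1 h2] := IH s c cs ss' bs'; split; first by rewrite ac h1.
exact: edge_homotopic_cons.
Qed.

(** Both edge paths are homotopic to that of a common refinement. *)
Lemma fine_subdivision_homotopic r f s1 s2 :
  fine_subdivision r f s1 -> fine_subdivision r f s2 ->
  edge_homotopic (Rips setT r) (map f (0 :: rcons s1 1)) (map f (0 :: rcons s2 1)).
Proof.
move=> /fine_subdivisionP[p1 l1 h1] /fine_subdivisionP[p2 l2 h2].
pose s := sort <=%R (undup (s1 ++ s2)).
have slt : sorted <%R s by rewrite sort_lt_sorted undup_uniq.
have memE x : x \in s = (x \in s1) || (x \in s2).
  by rewrite mem_sort mem_undup mem_cat.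
have sub s' : path <%R 0 s' -> {subset s' <= s} -> subseq s' s.
  move=> ps' s's; rewrite -[s'](@lt_sorted_eq _ R [seq x <- s | x \in s'] s').
  - exact: filter_subseq.
  - exact: (sorted_filter lt_trans).
  - exact: path_sorted ps'.
  - by move=> x; rewrite mem_filter andb_idr// => /s's.
have b01 s' : path <%R 0 s' -> last 0 s' <= 1 ->
    forall x, x \in s' -> 0 <= x <= 1.
  move=> ps' ls' x xs'; have /allP := order_path_min lt_trans ps'.
  move=> /(_ x xs') x0; rewrite (ltW x0) /=; apply: le_trans ls'.
  case/splitPr: xs' ps' => q q'; rewrite cat_path last_cat /= => /and3P[_ _ h].
  exact: lt_path_le_last h.
have s01 x : x \in s -> 0 <= x <= 1.
  by rewrite memE => /orP[]; exact: b01.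
have ps : path <=%R 0 (rcons s 1).
  rewrite rcons_path; apply/andP; split.
    rewrite le_path_sortedE; apply/andP; split; last exact: (sub_sorted ltW).
    by apply/allP => x /s01/andP[].
  case: (lastP s) s01 => [_|q x s01] /=; first exact: ler01.
  rewrite last_rcons; have := s01 x; rewrite mem_rcons mem_head.
  by move=> /(_ isT) /andP[].
have [|_ e1] := fine_refine h1 _ ps.
  by apply: sub p1 _ => x xs; rewrite memE xs.
have [|_ e2] := fine_refine h2 _ ps.
  by apply: sub p2 _ => x xs; rewrite memE xs orbT.
by apply: rst_trans e2; exact: rst_sym.
Qed.

(** With 0 and 1 added, n + 1 steps of the same length. *)
Definition uniform_subdivision n : seq R :=
  [seq i%:R / n.+1%:R | i <- iota 1 n].

Definition uniformly_fine r f n : Prop := forall i, (i < n)%N ->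
  (diam (f @` `[(i%:R / n%:R)%R, (i.+1%:R / n%:R)%R]) < r%:E)%E.

Lemma rcons_uniform_subdivision n : 0 :: rcons (uniform_subdivision n) 1 =
  [seq i%:R / n.+1%:R | i <- iota 0 n.+2].
Proof.
have iotaS : iota 1 n.+1 = rcons (iota 1 n) n.+1.
  by rewrite -[X in iota 1 X]addn1 iotaD cats1 add1n.
rewrite -[iota 0 n.+2]/(0%N :: iota 1 n.+1) iotaS map_cons map_rcons mul0r.
by rewrite divff// pnatr_eq0.
Qed.

Lemma uniformly_fine_subdivision r f n :
  uniformly_fine r f n.+1 -> fine_subdivision r f (uniform_subdivision n).
Proof.
move=> h; have n0 : 0 < n.+1%:R^-1 :> R by rewrite invr_gt0 ltr0n.
apply/fine_subdivisionP.
have E : rcons (uniform_subdivision n) 1 = [seq i%:R / n.+1%:R | i <- iota 1 n.+1].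
  by have [] := rcons_uniform_subdivision n.
have hp (e : rel R) m i : (forall j, (j < i + m)%N ->
      e (j%:R / n.+1%:R) (j.+1%:R / n.+1%:R)) ->
    path e (i%:R / n.+1%:R) [seq j%:R / n.+1%:R | j <- iota i.+1 m].
  elim: m i => //= m IH i he; apply/andP; split.
    by apply: he; rewrite addnS ltnS leq_addr.
  by apply: IH => j ji; apply: he; rewrite addnS -addSn.
have z : 0 = 0%:R / n.+1%:R :> R by rewrite mul0r.
split.
- rewrite z; apply: hp => j _; rewrite ltr_pM2r// ltr_nat//.
- rewrite z /uniform_subdivision (last_map (fun i => i%:R / n.+1%:R)) last_iota1.
  by rewrite ler_pdivrMr ?ltr0n// mul1r ler_nat.
- rewrite E {1}z; apply: hp => j; rewrite add0n => jn; apply/asboolP; split.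
  + by rewrite divr_ge0// ler0n.
  + by rewrite ler_pM2r// ler_nat.
  + by rewrite ler_pdivrMr ?ltr0n// mul1r ler_nat.
  + exact: h.
Qed.

Lemma square_uniformly_continuous (H : R * R -> X) (e : R) :
  {within unit_square, continuous H} -> 0 < e ->
  exists2 d : R, 0 < d & forall z w : R * R, unit_square z -> unit_square w ->
    `|z.1 - w.1| < d -> `|z.2 - w.2| < d -> mdist (H z) (H w) < e.
Proof.
move=> /subspace_continuousP cH e0.
have cS : compact (@unit_square R).
  by apply: compact_setX; exact: segment_compact.
pose P (d : R) (z : R * R) := forall w, unit_square w ->
  `|z.1 - w.1| < d -> `|z.2 - w.2| < d -> mdist (H z) (H w) < e.
have /compact_near_coveringP/near_covering_withinP cov := cS.
have h : \forall d \near (0 : R)^'+, unit_square `<=` P d.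
  apply: cov => z Sz.
  have e2 : 0 < e / 2 by rewrite divr_gt0.
  have : \forall w \near (z : R * R), unit_square w -> mdist (H z) (H w) < e / 2.
    have := metricType_numDomainType.cvgr_dist_lt (cH z Sz) e2.
    by rewrite near_withinE; apply; exact: within_filter.
  move=> /nbhs_ballP[k /= k0 hk].
  have k2 : 0 < k / 2 by rewrite divr_gt0.
  exists (ball z (k / 2), [set d | d < k / 2]).
    by split => /=; [exact: nbhsx_ballx|exact: nbhs_right_lt].
  move=> [z' d] /= [[b1 b2] dk] Sz' w Sw w1 w2.
  rewrite /ball /= in b1 b2.
  have kk : k / 2 + k / 2 = k by rewrite -splitr.
  have h1 : mdist (H z) (H z') < e / 2.
    by apply: hk => //; split; rewrite /ball /=; lra.
  have h2 : mdist (H z) (H w) < e / 2.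
    apply: hk => //; split; rewrite /ball /=.
      have := ler_distD z'.1 z.1 w.1; lra.
    have := ler_distD z'.2 z.2 w.2; lra.
  have := metric_triangle (H z') (H z) (H w); rewrite (metric_sym (H z') (H z)); lra.
have [d [d0 hd]] := filter_ex (filterI (nbhs_right_gt (0 : R)) h).
by exists d => // z w Sz Sw; exact: hd.
Qed.

(** The rows of a fine grid in the square give a sequence of edge paths, each of
    which forms a ladder with the next. *)
Lemma homotopic_subdivisions r (x : X) (f g : loop R x) : 0 < r ->
  loop_homotopic f g -> exists n0, forall n, (n0 <= n)%N ->
  [/\ uniformly_fine r f n.+1, uniformly_fine r g n.+1 &
    edge_homotopic (Rips setT r) (map f (0 :: rcons (uniform_subdivision n) 1))
      (map g (0 :: rcons (uniform_subdivision n) 1))].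
Proof.
move=> r0 [H [cH H01 Hx]].
have r2 : 0 < r / 2 by rewrite divr_gt0.
have [d d0 hd] := square_uniformly_continuous cH r2.
exists (Num.trunc d^-1) => n hn; set N := n.+1.
have N0 : 0 < N%:R :> R by rewrite ltr0n.
have Nd : N%:R^-1 < d.
  rewrite -[d]invrK ltf_pV2 ?posrE ?invr_gt0//.
  by apply: lt_le_trans (truncnS_gt _) _; rewrite ler_nat.
have N1 : 0 < N%:R^-1 :> R by rewrite invr_gt0.
have divS i : i.+1%:R / N%:R = i%:R / N%:R + N%:R^-1 :> R.
  by rewrite -natr1 mulrDl mul1r.
have U i : (i <= N)%N -> unit_itv (i%:R / N%:R : R).
  by move=> iN; apply/unit_itvP; rewrite divr_ge0 ?ler0n//= ler_pdivrMr// mul1r ler_nat.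
have fineH (k : R) i : unit_itv k -> (i < N)%N ->
    (diam ((fun t => H (k, t)) @` `[(i%:R / N%:R)%R, (i.+1%:R / N%:R)%R]) < r%:E)%E.
  move=> Uk iN; apply: (@le_lt_trans _ _ (r / 2)%:E); last by rewrite lte_fin; lra.
  have [/unit_itvP U1 /unit_itvP U2] := (U _ (ltnW iN), U _ iN).
  rewrite divS in U2 *.
  apply: diam_le => _ _ [t /= + <-] [u /= + <-]; rewrite !in_itv /= => ht hu.
  apply: ltW; apply: hd => /=; rewrite ?subrr ?normr0//.
  - by split => //=; apply/unit_itvP; lra.
  - by split => //=; apply/unit_itvP; lra.
  - by rewrite ltr_norml; lra.
have fineE (h : R -> X) k : unit_itv k -> (forall t, unit_itv t -> H (k, t) = h t) ->
    uniformly_fine r h N.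
  move=> Uk hE i iN; have := fineH k i Uk iN; congr (diam _ < _)%E.
  apply/eq_imagel => t /=; rewrite in_itv /= => ht; apply: hE.
  have [/unit_itvP U1 /unit_itvP U2] := (U _ (ltnW iN), U _ iN).
  by apply/unit_itvP; lra.
have U0 : unit_itv (0 : R) by apply/unit_itvP; lra.
have U1 : unit_itv (1 : R) by apply/unit_itvP; lra.
split; [by apply: fineE U0 _ => t /H01[]|by apply: fineE U1 _ => t /H01[]|].
pose c i : R := (minn i N)%:R / N%:R.
have Uc i : unit_itv (c i) by apply: U; exact: geq_minr.
have cS i : `|c i - c i.+1| < d.
  rewrite /c; case: (ltnP i N) => iN.
    rewrite (minn_idPl iN) divS (_ : _ - _ = - N%:R^-1); last lra.
    by rewrite normrN gtr0_norm.
  by rewrite (minn_idPr (leqW iN)) subrr normr0.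
pose G k i := H (c k, c i).
have near k i k' i' : (k' = k \/ k' = k.+1) -> (i' = i \/ i' = i.+1) ->
    mdist (G k i) (G k' i') < r.
  move=> hk hi; apply: (@lt_trans _ _ (r / 2)); last lra.
  by apply: hd; rewrite /=; [split|split|case: hk => ->|case: hi => ->] => //=;
    rewrite ?subrr ?normr0.
have row k : edge_homotopic (Rips setT r) (map (G k) (iota 0 N.+1))
    (map (G k.+1) (iota 0 N.+1)).
  have hp m i : path (fun i j => j == i.+1) i (iota i.+1 m).
    by elim: m i => //= m IH i; rewrite IH andbT.
  have c0 : c 0%N = 0 by rewrite /c min0n mul0r.
  have cN : c N = 1 by rewrite /c minnn divff// gt_eqF.
  apply: (edge_ladder_ends (e := fun i j => j == i.+1) (i := 0%N) (s := iota 1 N)).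
  - move=> i; apply: rips_triangle; rewrite ?mdistxx// ?(metric_sym (G k.+1 i)) ;
      by apply: near; auto.
  - move=> i j /eqP ->; apply: rips_triangle => //; by apply: near; auto.
  - move=> i j /eqP ->; apply: rips_triangle => //; by apply: near; auto.
  - exact: hp.
  - by rewrite /G c0 !(Hx _ _).1.
  - by rewrite last_iota1 /G cN !(Hx _ _).2.
have rows k : edge_homotopic (Rips setT r) (map (G 0%N) (iota 0 N.+1))
    (map (G k) (iota 0 N.+1)).
  by elim: k => [|k IH]; [exact: rst_refl|exact: rst_trans IH (row k)].
have := rows N; rewrite rcons_uniform_subdivision -!map_comp.
have cE i : i \in iota 0 N.+1 -> c i = i%:R / N%:R.
  by rewrite mem_iota add0n ltnS => /andP[_ iN]; rewrite /c (minn_idPl iN).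
have c0 : c 0%N = 0 by rewrite /c min0n mul0r.
have cN : c N = 1 by rewrite /c minnn divff// gt_eqF.
congr (edge_homotopic _ _ _); apply/eq_in_map => i iN /=.
  by rewrite /G c0 (H01 _ (Uc i)).1 cE.
by rewrite /G cN (H01 _ (Uc i)).2 cE.
Qed.

End Subdivision.

(** * The fundamental group at small scales *)

(** The identifications are given as relations; they become morphisms by
    choosing the related elements. *)
Section RelationMorphism.
Context {G H : groupType} (rel_gh : G -> H -> Prop).
Hypothesis rel_total : forall g, exists h, rel_gh g h.
Hypothesis rel_fun : forall g h h', rel_gh g h -> rel_gh g h' -> h = h'.
Hypothesis rel_mul : forall g g' h h', rel_gh g h -> rel_gh g' h' ->
  rel_gh (g * g')%g (h * h')%g.

Definition rel_map (g : G) : H := sval (cid (rel_total g)).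

Lemma rel_mapP g h : rel_gh g h <-> h = rel_map g.
Proof.
have hg : rel_gh g (rel_map g) := svalP (cid (rel_total g)).
by split=> [/rel_fun|->//]; apply.
Qed.

Lemma rel_mapM : {morph rel_map : g g' / (g * g')%g}.
Proof. by move=> g g'; apply/esym/rel_mapP/rel_mul; apply/rel_mapP. Qed.

HB.instance Definition _ := isMultiplicative.Build G H rel_map rel_mapM.

Lemma rel_morphism : exists f : {multiplicative G -> H},
  forall g h, rel_gh g h <-> h = f g.
Proof. by exists rel_map; exact: rel_mapP. Qed.

End RelationMorphism.

Lemma trivial_morphism (G H : groupType) :
  exists f : {multiplicative G -> H}, forall g, f g = 1%g.
Proof.
have [||g g' h h' -> ->|f hf] := @rel_morphism G H (fun _ h => h = 1%g).
- by move=> _; exists 1%g.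
- by move=> _ h h' -> ->.
- by rewrite mulg1.
- by exists f => g; exact/hf.
Qed.

Lemma lift_morphism (G H K : groupType) (i : {multiplicative H -> K})
    (f : {multiplicative G -> K}) :
  injective i -> (forall g, exists h, i h = f g) ->
  exists phi : {multiplicative G -> H}, forall g h, i h = f g <-> h = phi g.
Proof.
move=> ii fi; apply: rel_morphism => //.
- by move=> g h h' hg h'g; apply: ii; rewrite hg h'g.
- by move=> g g' h h' hg h'g; rewrite !gmulfM hg h'g.
Qed.

Section Correspondence.
Context {R : realType} {X : metricType R} (x0 : X).
Implicit Types (r p q : R) (f : loop R x0).

Lemma loop_homotopic_path f (g : loop R x0) : loop_homotopic f g <-> path_homotopic f g.
Proof.
split=> -[H [cH H01 Hx]]; exists H; split=> // s Us; have := Hx s Us;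
  by rewrite loop0 loop1.
Qed.

Lemma pi1_class_eq f (g : loop R x0) : pi1_class f = pi1_class g <-> loop_homotopic f g.
Proof. exact: gclass_eq. Qed.

Lemma fine_edge_loop r f l : path (fine_rel r f) 0 l -> last 0 l = 1 ->
  exists a : edge_loop (Rips setT r) x0, edges a = map f l.
Proof.
move=> fl ll; have ap : path (Defs.adjacent (Rips setT r)) x0 (map f l).
  rewrite -[X in path _ X _](loop0 f) path_map; apply: sub_path fl => x y.
  move=> /asboolP h; have [_ xy _ _] := h.
  by apply/rips_adjacent; split => //; apply: fine_step_mdist h _ _;
    rewrite lexx xy.
have al : last x0 (map f l) = x0 by rewrite -{1}(loop0 f) last_map ll loop1.
by exists (EdgeLoop ap al).
Qed.

Lemma corr_class r f s (a : edge_loop (Rips setT r) x0) :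
  fine_subdivision r f s -> edges a = map f (rcons s 1) ->
  pi1_rips_corr (pi1_class f) (edge_class a).
Proof. by move=> fs aE; exists f, s, a; split=> //; rewrite aE map_rcons loop1. Qed.

Lemma corr_elim r g (h : rips_pi1 x0 setT r) : pi1_rips_corr g h ->
  exists f s (a : edge_loop (Rips setT r) x0), [/\ g = pi1_class f,
    h = edge_class a, fine_subdivision r f s &
    x0 :: a = map f (0 :: rcons s 1)].
Proof.
move=> [f [s [a [gE fs aE hE]]]]; exists f, s, a; split => //.
by rewrite aE /= map_rcons loop0 loop1.
Qed.

Lemma uniform_edge_loop r f n : uniformly_fine r f n.+1 ->
  exists a : edge_loop (Rips setT r) x0,
    edges a = map f (rcons (uniform_subdivision n) 1).
Proof.
move=> /uniformly_fine_subdivision/fine_subdivisionP[_ _ h].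
by apply: fine_edge_loop h _; rewrite last_rcons.
Qed.

(** Two loops with the same class have a common uniform subdivision along which
    their edge paths are homotopic. *)
Lemma corr_fun r g (h h' : rips_pi1 x0 setT r) : 0 < r ->
  pi1_rips_corr g h -> pi1_rips_corr g h' -> h = h'.
Proof.
move=> r0 /corr_elim[f [s [a [-> -> fs aE]]]] /corr_elim[f' [s' [a' [+ -> fs' aE']]]].
move=> /pi1_class_eq ff'; apply/edge_class_eq.
have [n /(_ n (leqnn n))[u u' uu']] := homotopic_subdivisions r0 ff'.
have := fine_subdivision_homotopic fs (uniformly_fine_subdivision u).
have := fine_subdivision_homotopic fs' (uniformly_fine_subdivision u').
rewrite aE aE' => h2 h1; apply: rst_trans h1 _; apply: rst_trans uu' _.
exact: rst_sym.
Qed.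

Lemma corr_total r g : 0 < r -> exists h : rips_pi1 x0 setT r, pi1_rips_corr g h.
Proof.
move=> r0; have [f ->] := gclass_surj g.
have [n /(_ n (leqnn n))[u _ _]] := homotopic_subdivisions r0 (loop_homotopic_refl f).
have [a aE] := uniform_edge_loop u; exists (edge_class a).
exact: corr_class (uniformly_fine_subdivision u) aE.
Qed.

Let uniformE n : rcons (uniform_subdivision n) 1 =
  [seq i%:R / n.+1%:R | i <- iota 1 n.+1] :> seq R.
Proof. by have [] := rcons_uniform_subdivision (R := R) n. Qed.

Lemma uniformly_fine_cat r f (g : loop R x0) n : (0 < n)%N -> uniformly_fine r f n ->
  uniformly_fine r g n -> uniformly_fine r (cat_loop f g) (n + n).
Proof.
move=> n0 uf ug i i2n.
have nr : 0 < n%:R :> R by rewrite ltr0n.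
have half j : j%:R / (n + n)%:R = 2^-1 * (j%:R / n%:R) :> R.
  by rewrite natrD -mulr2n -[_ *+ 2]mulr_natl invfM mulrCA.
rewrite !half.
have [ni|ni] := ltnP i n.
  apply: le_lt_trans (uf i ni); apply: diam_subset => _ [t /= + <-].
  rewrite in_itv /= => ht.
  have i1 : i.+1%:R / n%:R <= 1 :> R by rewrite ler_pdivrMr// mul1r ler_nat.
  exists (2 * t); first by rewrite /= in_itv /=; lra.
  by rewrite /cat_loop_fun ifT//; lra.
have jn : (i - n < n)%N by lia.
apply: le_lt_trans (ug _ jn); apply: diam_subset => _ [t /= + <-].
rewrite in_itv /= => ht.
have e j : (n <= j)%N -> (j - n)%:R / n%:R = j%:R / n%:R - 1 :> R.
  by move=> nj; rewrite natrB// mulrBl divff// gt_eqF.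
have n1 : 1 <= i%:R / n%:R :> R by rewrite ler_pdivlMr// mul1r ler_nat.
exists (2 * t - 1).
  by rewrite /= in_itv /= -subSn// !e// ?leqW//; lra.
rewrite /cat_loop_fun; case: ifPn => // th.
have -> : t = 2^-1 by lra.
by rewrite divff// subrr loop0 loop1.
Qed.

Lemma cat_loop_uniform f (g : loop R x0) n :
  map (cat_loop f g) [seq i%:R / (n.+1 + n.+1)%:R | i <- iota 1 (n.+1 + n.+1)] =
  map f [seq i%:R / n.+1%:R | i <- iota 1 n.+1] ++
  map g [seq i%:R / n.+1%:R | i <- iota 1 n.+1].
Proof.
set N := n.+1; have nr : 0 < N%:R :> R by rewrite ltr0n.
have half j : j%:R / (N + N)%:R = 2^-1 * (j%:R / N%:R) :> R.
  by rewrite natrD -mulr2n -[_ *+ 2]mulr_natl invfM mulrCA.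
rewrite iotaD !map_cat (addnC 1%N N) iotaDl -!map_comp.
congr (_ ++ _); apply/eq_in_map => i; rewrite mem_iota => /andP[i1 iN] /=.
  have h : i%:R / N%:R <= 1 :> R by rewrite ler_pdivrMr// mul1r ler_nat -ltnS.
  by rewrite half /cat_loop_fun ifT; [congr (f _); lra|lra].
have h : 0 < i%:R / N%:R :> R by rewrite divr_gt0// ltr0n.
rewrite half natrD mulrDl divff ?gt_eqF// /cat_loop_fun ifN; last first.
  by rewrite -ltNge; lra.
by congr (g _); lra.
Qed.

(** The uniform subdivision of a product into 2 n steps is the concatenation of
    the uniform subdivisions of the factors into n steps. *)
Lemma corr_mul r g g' (h h' : rips_pi1 x0 setT r) : 0 < r ->
  pi1_rips_corr g h -> pi1_rips_corr g' h' ->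
  pi1_rips_corr (g * g')%g (h * h')%g.
Proof.
move=> r0; have [f ->] := gclass_surj g; have [f' ->] := gclass_surj g'.
move=> hh hh'.
have [m hm] := homotopic_subdivisions r0 (loop_homotopic_refl f).
have [m' hm'] := homotopic_subdivisions r0 (loop_homotopic_refl f').
pose n := maxn m m'.
have [u _ _] := hm n (leq_maxl _ _); have [u' _ _] := hm' n (leq_maxr _ _).
have [a aE] := uniform_edge_loop u; have [a' aE'] := uniform_edge_loop u'.
have -> : h = edge_class a.
  by apply: corr_fun hh _ => //; exact: corr_class (uniformly_fine_subdivision u) aE.
have -> : h' = edge_class a'.
  by apply: corr_fun hh' _ => //; exact: corr_class (uniformly_fine_subdivision u') aE'.
rewrite /edge_class gclassM gclassM.
have uu := uniformly_fine_cat (ltn0Sn n) u u'.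
apply: (corr_class (s := uniform_subdivision (n + n.+1))).
  exact: uniformly_fine_subdivision uu.
by rewrite uniformE /= aE aE' !uniformE -cat_loop_uniform.
Qed.

Lemma corr_bond p q (pq : p < q) g (h : rips_pi1 x0 setT p) :
  pi1_rips_corr g h -> pi1_rips_corr g (rips_bond x0 setT pq h).
Proof.
move=> [f [s [a [-> [s0 s1 hs h1] aE ->]]]]; rewrite rips_bondE.
exists f, s, (incl_edge_loop (Rips_subset (@subset_refl _ _) (ltW pq)) a).
split=> //; split=> // [i /hs hi|]; first by apply: lt_trans hi _; rewrite lte_fin.
by apply: lt_trans h1 _; rewrite lte_fin.
Qed.

Section Geodesics.
Variable geo : X -> X -> R -> X.
Hypothesis geoP : forall u w, [/\ {within unit_itv, continuous (geo u w)},
  geo u w 0 = u, geo u w 1 = w & path_length 0 1 (geo u w) = (mdist u w)%:E].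

Fixpoint dyadic_subdivision n : seq R :=
  if n is m.+1 then 2^-1 :: [seq 2^-1 + 2^-1 * t | t <- dyadic_subdivision m]
  else [::].

Let half0 : 2^-1 = 2^-1 + 2^-1 * 0 :> R. Proof. by rewrite mulr0 addr0. Qed.

Let dyadic_path n : path <%R 0 (dyadic_subdivision n).
Proof.
elim: n => //= n IH; rewrite invr_gt0 ltr0n /= {1}half0.
rewrite (path_map (f := fun t : R => 2^-1 + 2^-1 * t)).
by apply: sub_path IH => x y xy /=; lra.
Qed.

Let dyadic_last n : last 0 (dyadic_subdivision n) <= 1.
Proof.
elim: n => //= n IH; rewrite {1}half0 (last_map (fun t : R => 2^-1 + 2^-1 * t)).
lra.
Qed.

(* concatenation is halving: the vertices of an edge path are the values of its
   realization at 1/2, 3/4, 7/8, ... *)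
Let dyadic_realize u (a : seq X) :
  map (realize geo u a) (dyadic_subdivision (size a)) = a.
Proof.
elim: a u => //= v a IH u; rewrite /cat_path_fun lexx divff//.
have [_ _ -> _] := geoP u v; congr (_ :: _); rewrite -[RHS](IH v) -map_comp.
apply/eq_in_map => t /=.
have /allP /[apply] t0 := order_path_min lt_trans (dyadic_path (size a)).
by rewrite ifN; [congr realize; lra|rewrite -ltNge; lra].
Qed.

Let dyadic_fine r u (a : seq X) : 0 < r ->
  path (Defs.adjacent (Rips setT r)) u a ->
  path (fine_rel r (realize geo u a)) 0 (rcons (dyadic_subdivision (size a)) 1).
Proof.
move=> r0; elim: a u => [|v a IH] u /=.
  move=> _; rewrite andbT; apply/asboolP; split; rewrite ?lexx ?ler01//.
  apply: (@le_lt_trans _ _ 0%:E); last by rewrite lte_fin.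
  by apply: diam_le => _ _ [t _ <-] [t' _ <-]; rewrite mdistxx.
move=> /andP[/rips_adjacent[_ _ uv] va]; apply/andP; split.
  apply/asboolP; split; [lra|lra|lra|].
  apply: (@le_lt_trans _ _ (mdist u v)%:E); last by rewrite lte_fin.
  apply: diam_le => _ _ [t /= + <-] [t' /= + <-]; rewrite !in_itv /= => ht ht'.
  rewrite /cat_path_fun !ifT; [|lra|lra].
  by apply: (geo_mdist geoP); apply/unit_itvP; lra.
have -> : rcons [seq 2^-1 + 2^-1 * t | t <- dyadic_subdivision (size a)] 1 =
    [seq 2^-1 + 2^-1 * t | t <- rcons (dyadic_subdivision (size a)) 1] :> seq R.
  by rewrite map_rcons; congr rcons; lra.
rewrite {1}half0.
rewrite (path_map (f := fun t : R => 2^-1 + 2^-1 * t)).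
apply: sub_path (IH v va) => x y /asboolP[h1 h2 h3 h4] /=; apply/asboolP.
split; [lra|lra|lra|]; apply: le_lt_trans h4.
apply: diam_subset => _ [t /= + <-]; rewrite in_itv /= => ht.
exists (2 * t - 1); first by rewrite /= in_itv /=; lra.
rewrite /cat_path_fun; case: ifPn => // ht'.
have -> : t = 2^-1 by lra.
have [_ _ g1 _] := geoP u v.
by rewrite divff// subrr realize0// g1.
Qed.

Lemma corr_surj r (h : rips_pi1 x0 setT r) : 0 < r -> exists g, pi1_rips_corr g h.
Proof.
move=> r0; have [a ->] := edge_pi1_surj h.
have l1 : realize geo x0 a 1 = x0 by rewrite realize1// edges_last.
pose f := Loop (@realize_continuous _ _ geo geoP x0 a) (realize0 geoP x0 a) l1.
exists (pi1_class f), f, (dyadic_subdivision (size a)).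
have bp : path (Defs.adjacent (Rips setT r)) x0 (rcons a x0).
  rewrite rcons_path edges_path edges_last; apply/rips_adjacent.
  by rewrite mdistxx.
have bl : last x0 (rcons a x0) = x0 by rewrite last_rcons.
exists (EdgeLoop bp bl); split=> //.
- apply/fine_subdivisionP; split=> //.
  exact: dyadic_fine (edges_path a).
- by rewrite /= dyadic_realize.
- apply/edge_class_eq => /=; rewrite -cats1 -cat_cons [x0 :: a]lastI edges_last.
  rewrite cat_rcons -cats1; apply: edge_homotopic_catl; apply: rst_sym.
  exact: edge_repeat.
Qed.

(** At a scale where short paths with common ends are homotopic, a loop is
    homotopic to the realization of its edge path, which depends on the
    homotopy class of the edge path only. *)
Lemma corr_inj r : 0 < r -> short_paths_homotopic (X := X) (2 * r) ->
  forall g g' (h : rips_pi1 x0 setT r),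
  pi1_rips_corr g h -> pi1_rips_corr g' h -> g = g'.
Proof.
move=> r0 short g g' h.
have real f s (a : edge_loop (Rips setT r) x0) : fine_subdivision r f s ->
    x0 :: a = map f (0 :: rcons s 1) -> path_homotopic f (realize geo x0 a).
  move=> /fine_subdivisionP[_ _ hs] [_ aE].
  have U0 : unit_itv (0 : R) by apply/unit_itvP; lra.
  have := @subpath_realize _ _ geo geoP r short f 0 (rcons s 1)
    (@loop_continuous _ _ _ f) U0 (last_rcons _ _ _).
  rewrite loop0 -aE.
  have -> : subpath f 0 1 = f.
    by apply/funext => t; rewrite /subpath add0r subr0 mul1r.
  apply; apply: sub_path hs => x y /asboolP hxy; apply/asboolP.
  have [x_0 xy y1 _] := hxy; split=> //; first by apply/unit_itvP; lra.
  by move=> t t' ht ht'; exact: fine_step_mdist hxy _ _.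
move=> /corr_elim[f [s [a [-> -> fs aE]]]] /corr_elim[f' [s' [a' [-> + fs' aE']]]].
move=> /edge_class_eq /(realize_edge_homotopic geoP short r0) /= aa'.
apply/pi1_class_eq/loop_homotopic_path.
apply: path_homotopic_trans (real _ _ _ fs aE) _.
apply: path_homotopic_trans aa' _.
exact: path_homotopic_sym (real _ _ _ fs' aE').
Qed.

End Geodesics.
End Correspondence.

(** * Comparing the persistent groups *)

Section Persistence.
Context {R : realType} {X : metricType R} (x0 : X) (c s : R).
Hypotheses (Xc : compact [set: X]) (hgeo : geodesic X).
Hypothesis hslsc : semilocally_simply_connected R X.
Hypothesis hc : smallest_critical_value x0 c.
Hypotheses (s0 : 0 < s) (sc : s < c / 2).
Implicit Types (A : set X) (r p q : R).

Let M_exists : exists M : R, forall x y : X, mdist x y <= M.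
Proof. exact: (compact_mdist_bounded x0). Qed.

(** Injectivity at scale r follows from injectivity at a small scale p, the
    bonding map from p to r being injective. *)
Lemma rips_iota r : 0 < r -> r < c ->
  exists iota : {multiplicative pi1 R x0 -> rips_pi1 x0 setT r},
    bijective iota /\
    forall g h, pi1_rips_corr g h <-> h = iota g.
Proof.
move=> r0 rc; have [iota hi] := rel_morphism
  (fun g => corr_total g r0) (fun g h h' => @corr_fun _ _ x0 r g h h' r0)
  (fun g g' h h' => @corr_mul _ _ x0 r g g' h h' r0).
exists iota; split=> //.
have [geo geoP] : exists geo : X -> X -> R -> X, forall u w,
    [/\ {within unit_itv, continuous (geo u w)}, geo u w 0 = u, geo u w 1 = w &
     path_length 0 1 (geo u w) = (mdist u w)%:E].
  have /choice[k hk] : forall uw : X * X, exists f : R -> X,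
      [/\ {within unit_itv, continuous f}, f 0 = uw.1, f 1 = uw.2 &
       path_length 0 1 f = (mdist uw.1 uw.2)%:E].
    by move=> [u w]; exact: hgeo.
  by exists (fun u w => k (u, w)) => u w; exact: hk (u, w).
apply: inj_surj_bijective; last first.
  move=> h; have [g gh] := corr_surj geoP h r0.
  by exists g; apply/esym/hi.
have [e e0 short] := short_paths Xc hgeo hslsc.
pose p := Num.min e r / 2.
have m0 : 0 < Num.min e r by rewrite lt_min e0.
have p0 : 0 < p by rewrite divr_gt0.
have [me mr] : Num.min e r <= e /\ Num.min e r <= r.
  by rewrite !ge_min !lexx orbT.
have pr : p < r by rewrite /p; lra.
have shortp : short_paths_homotopic (X := X) (2 * p).
  move=> f g cf cg e_0 e_1 fg; apply: short => // t Ut.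
  by have := fg t Ut; rewrite /p => -[]; lra.
have [M hM] := M_exists.
have bij := rips_bond_bijective hgeo hM pr hc p0 rc.
move=> g g' gg'.
have [h gh] := corr_total g p0; have [h' gh'] := corr_total g' p0.
have hh' : h = h'.
  apply: (bij_inj bij); apply: corr_fun r0 (corr_bond pr gh) _.
  have /hi -> := corr_bond pr gh'.
  by rewrite -gg'; apply/hi.
by apply: (corr_inj geoP p0 shortp gh); rewrite hh'.
Qed.

Section DenseSubset.
Variable A : set X.
Hypotheses (sA : s_dense s A) (Ax0 : A x0).

Lemma rips_incl_surj r : 2 * s < r ->
  forall h, exists g, rips_incl x0 A r g = h.
Proof.
move=> sr; apply: edge_pi1_incl_surj => b.
have [f [fA fs fid]] := s_dense_retraction s0 sA; have [M hM] := M_exists.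
exact: (approx_incl_surj fA fs fid Ax0 hgeo hM sr).
Qed.

Lemma rips_bond_dense_surj p q (pq : p < q) : 2 * s < p ->
  forall h, exists g, rips_bond x0 A pq g = h.
Proof.
move=> sp; apply: edge_pi1_incl_surj => b.
have [f [fA fs fid]] := s_dense_retraction s0 sA; have [M hM] := M_exists.
exact: (approx_bond_surj fA fs fid Ax0 hgeo hM sp (ltW pq)).
Qed.

Lemma rips_incl_bijective_small r : 2 * s < r -> r < c ->
  bijective (rips_incl x0 A r).
Proof.
move=> sr rc; apply: inj_surj_bijective; last exact: rips_incl_surj.
apply: edge_pi1_incl_inj.
have [f [fA fs fid]] := s_dense_retraction s0 sA; have [M hM] := M_exists.
apply: (approx_incl_inj_small fA fs fid Ax0 hgeo hM sr) => b b0.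
have p0 : 0 < r - 2 * s by lra.
have pr : r - 2 * s < r by rewrite ltrBlDr ltrDl mulr_gt0.
have bij := rips_bond_bijective hgeo hM pr hc p0 rc.
apply/(edge_class_eq b (cst_edge_loop _ x0)); apply: (bij_inj bij).
rewrite !rips_bondE; apply/edge_class_eq; exact: b0.
Qed.

(** The identification for A is that for X followed by the inverse of the
    isomorphism induced by inclusion. *)
Lemma icsp_dense : icsp (2 * s) (rips_persistence x0 A).
Proof.
split=> /=.
- by move=> p q t pq qt pt _; exact: rips_bond_comp.
- by move=> p q pq sp; exact: rips_bond_dense_surj.
exists c; first by have := sc; lra.
have ex r : exists iota : {multiplicative pi1 R x0 -> rips_pi1 x0 A r},
    2 * s < r < c -> bijective iota /\
      forall g h, rips_ident (A := A) g h <-> h = iota g.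
  have [/andP[sr rc]|/negP nr] := boolP (2 * s < r < c); last first.
    have [iota _] := trivial_morphism (pi1 R x0) (rips_pi1 x0 A r).
    by exists iota.
  have r0 : 0 < r by have := s0; lra.
  have [iX [bX hX]] := rips_iota r0 rc.
  have bA := rips_incl_bijective_small sr rc.
  have [iA hA] := lift_morphism (bij_inj bA)
    (fun g => rips_incl_surj sr (iX g)).
  exists iA => _; split.
    apply: inj_surj_bijective => [g g' gg'|h].
      apply: (bij_inj bX); have /hA <- := erefl (iA g).
      by have /hA <- := erefl (iA g'); rewrite gg'.
    have [jX _ jK] := bX; exists (jX (rips_incl x0 A r h)).
    by apply/esym/hA; rewrite jK.
  by move=> g h; rewrite /rips_ident hX; exact: hA.
pose iota r := sval (cid (ex r)); have hi r := svalP (cid (ex r)).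
exists iota; split=> // p q pq sp qc g /=.
have bA := rips_incl_bijective_small (lt_trans sp pq) qc.
have /hi[_ hp] : 2 * s < p < c by rewrite sp (lt_trans pq qc).
have /hi[_ hq] : 2 * s < q < c by rewrite (lt_trans sp pq).
by apply/hq; rewrite /rips_ident rips_incl_bond; apply/corr_bond/hp.
Qed.

End DenseSubset.

(** The morphism is the map induced by the inclusion of B in X, followed by the
    inverse of the isomorphism for A. *)
Lemma rips_persistence_hom A B : s_dense s A -> A x0 -> s_dense s B -> B x0 ->
  (forall r, 2 * s < r -> bijective (rips_incl x0 A r)) ->
  exists2 phi, @persistence_hom R (pi1 R x0) (2 * s) (rips_persistence x0 B)
      (rips_persistence x0 A) phi &
    forall r h, 2 * s < r -> rips_incl x0 A r (phi r h) = rips_incl x0 B r h.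
Proof.
move=> sA Ax0 sB Bx0 bA.
have ex r : exists phi : {multiplicative rips_pi1 x0 B r -> rips_pi1 x0 A r},
    2 * s < r -> forall h, rips_incl x0 A r (phi h) = rips_incl x0 B r h.
  have [sr|nr] := ltP (2 * s) r; last first.
    have [phi _] := trivial_morphism (rips_pi1 x0 B r) (rips_pi1 x0 A r).
    by exists phi.
  have [phi hphi] := lift_morphism (bij_inj (bA r sr))
    (fun g => rips_incl_surj sA Ax0 sr (rips_incl x0 B r g)).
  by exists phi => _ h; apply/hphi.
pose phi r := sval (cid (ex r)); have hphi r := svalP (cid (ex r)).
exists phi; last by move=> r h sr; exact: hphi.
split=> [p q pq sp h|].
  have sq := lt_trans sp pq; apply: (bij_inj (bA q sq)) => /=.
  by rewrite rips_incl_bond !hphi// rips_incl_bond.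
exists c; first by have := sc; lra.
move=> r /andP[sr rc] g h.
by rewrite /= /rips_ident hphi.
Qed.

End Persistence.

Theorem theorem5p6 (R : realType) (X : metricType R) (x0 : X) (c s : R)
    (hcompact : compact [set: X])
    (hgeodesic : geodesic X)
    (hslsc : semilocally_simply_connected R X)
    (hc : smallest_critical_value x0 c)
    (hs : 0 < s < c / 2) :
  exists2 H : persistence R (pi1 R x0), FP x0 s H &
    persistence_iso (2 * s) (rips_persistence x0 [set: X]) H /\
    forall H' : persistence R (pi1 R x0), FP x0 s H' ->
      persistence_le (2 * s) H H'.
Proof.
have /andP[s0 sc] := hs.
have [A [fA sA Ax0 hA]] := finite_approximation x0 hcompact hgeodesic s0 sc.
have bA r : 2 * s < r -> bijective (rips_incl x0 A r).
  move=> sr; have [rc|cr] := ltP r c.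
    exact: (rips_incl_bijective_small hcompact hgeodesic hc s0).
  apply: inj_surj_bijective; last exact: (rips_incl_surj hcompact hgeodesic s0).
  by apply: edge_pi1_incl_inj; exact: hA.
have sT : s_dense s [set: X] by move=> x; exists x => //; rewrite mdistxx.
have icsp_of B : s_dense s B -> B x0 -> icsp (2 * s) (rips_persistence x0 B).
  exact: (icsp_dense hcompact hgeodesic hslsc hc s0 sc).
have hom_of B : s_dense s B -> B x0 -> _ :=
  fun sB Bx0 => rips_persistence_hom hcompact hgeodesic s0 sc sA Ax0 sB Bx0 bA.
exists (rips_persistence x0 A); first by exists A.
split; last first.
  move=> _ [B [_ sB Bx0] ->]; split; [exact: icsp_of|exact: icsp_of|].
  by have [phi hphi _] := hom_of B sB Bx0; exists phi.
split; [exact: icsp_of|exact: icsp_of|].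
have [phi hphi phiE] := hom_of setT sT Logic.I; exists phi => // r sr.
have [j jK jK'] := bA r sr.
exists (rips_incl x0 A r) => h; first by rewrite phiE// rips_inclT.
by apply: (bij_inj (bA r sr)); rewrite phiE// rips_inclT.
Qed.
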